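(* Let $f\in L^1(\mathbb{R}^2,\mathbb{H})$ and $(x_0,y_0)\in\mathbb{R}^2$. Suppose that in a cross-neighborhood of $(x_0,y_0)$ the function $f$ is a quaternion bounded variation function (QBVF) and belongs to $\mathbf{LC}$. Let $$\mathcal{F}_R(u,v)=\int_{\mathbb{R}^2}f(s,t)e^{-\mathbf{i}us}e^{-\mathbf{j}vt}\,ds\,dt,\qquad \mathcal{F}_L(u,v)=\int_{\mathbb{R}^2}e^{-\mathbf{i}us}e^{-\mathbf{j}vt}f(s,t)\,ds\,dt$$ be the right-sided and left-sided quaternion Fourier transforms of $f$, and let $$\eta(x_0,y_0)=\frac{f(x_0+0,y_0+0)+f(x_0+0,y_0-0)+f(x_0-0,y_0+0)+f(x_0-0,y_0-0)}{4}.$$ Then (a) $\displaystyle \eta(x_0,y_0)=\lim_{N\to\infty,\,M\to\infty}\frac{1}{4\pi^2}\int_{-N}^{N}\int_{-M}^{M}\mathcal{F}_R(u,v)e^{\mathbf{j}vy_0}e^{\mathbf{i}ux_0}\,du\,dv;$ (b) $\displaystyle \eta(x_0,y_0)=\lim_{N\to\infty,\,M\to\infty}\frac{1}{4\pi^2}\int_{-N}^{N}\int_{-M}^{M}e^{\mathbf{j}vy_0}e^{\mathbf{i}ux_0}\mathcal{F}_L(u,v)\,du\,dv.$ If moreover $f$ is continuous at $(x_0,y_0)$, then $f(x_0,y_0)=\eta(x_0,y_0)$.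
   Context: $\mathbb{H}$ is the algebra of quaternions $q=q_0+\mathbf{i}q_1+\mathbf{j}q_2+\mathbf{k}q_3$ ($q_n\in\mathbb{R}$) with $\mathbf{i}^2=\mathbf{j}^2=\mathbf{k}^2=-1$, $\mathbf{i}\mathbf{j}=-\mathbf{j}\mathbf{i}=\mathbf{k}$, $\mathbf{j}\mathbf{k}=-\mathbf{k}\mathbf{j}=\mathbf{i}$, $\mathbf{k}\mathbf{i}=-\mathbf{i}\mathbf{k}=\mathbf{j}$, and modulus $|q|=(q_0^2+q_1^2+q_2^2+q_3^2)^{1/2}$; $e^{\mathbf{i}\theta}=\cos\theta+\mathbf{i}\sin\theta$ and likewise for $\mathbf{j}$. $L^1(\mathbb{R}^2,\mathbb{H})$ is the space of $f:\mathbb{R}^2\to\mathbb{H}$ with $\int_{\mathbb{R}^2}|f|\,ds\,dt<\infty$; integrals are taken componentwise. One-sided limits: $f(x_0\pm0,y_0\pm0)=\lim_{h\to0^+,k\to0^+}f(x_0\pm h,y_0\pm k)$ (all four sign combinations, double limits). In the double integrals $u\in[-M,M]$, $v\in[-N,N]$, and $M,N\to\infty$ independently. Bounded variation: a real function $f$ on a rectangle $[a_1,b_1]\times[a_2,b_2]$ is a bounded variation function (BVF) if (i) the sums $\sum_{i=0}^{m-1}\sum_{j=0}^{n-1}|f(s_{i+1},t_{j+1})-f(s_{i+1},t_j)-f(s_i,t_{j+1})+f(s_i,t_j)|$ are bounded over all nets $a_1=s_0<\dots<s_m=b_1$, $a_2=t_0<\dots<t_n=b_2$; (ii) for at least one $\tilde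 s\in[a_1,b_1]$, $f(\tilde s,\cdot)$ is of (one-dimensional) bounded variation on $[a_2,b_2]$; (iii) for at least one $\tilde t\in[a_2,b_2]$, $f(\cdot,\tilde t)$ is of bounded variation on $[a_1,b_1]$. A quaternionic function $f=f_0+\mathbf{i}f_1+\mathbf{j}f_2+\mathbf{k}f_3$ ($f_n$ real) is a QBVF if and only if each component $f_n$, $n=0,1,2,3$, is a BVF. Cross-neighborhood: for $\varepsilon_1,\varepsilon_2>0$, the set of points $(s,t)$ with $|s-x_0|\le\varepsilon_1$ or $|t-y_0|\le\varepsilon_2$ (or both). A function is a BVF (QBVF) in this set if its restriction to each closed bounded rectangle contained in it is. Class $\mathbf{LC}$: put $\tilde f(s,t)=f(x_0-s,y_0-t)+f(x_0+s,y_0+t)+f(x_0-s,y_0+t)+f(x_0+s,y_0-t)$, $\mathbb{A}=\{s\in\mathbb{R}:\int_{\mathbb{R}}|\tilde f(s,t)|dt<\infty\}$, $\mathbb{B}=\{t\in\mathbb{R}:\int_{\mathbb{R}}|\tilde f(s,t)|ds<\infty\}$. Then $f$ belongs to $\mathbf{LC}$ in the cross-neighborhood of $(x_0,y_0)$ with parameters $\varepsilon_1,\varepsilon_2$ if for some $a\in\mathbb{A}$, $b\in\mathbb{B}$ $$\int_{\varepsilon_2}^{\infty}\int_0^{\varepsilon_1}\left|\frac{\tilde f(s,t)-\tilde f(a,t)}{s}\right|ds\,dt<\infty,\qquad \int_{\varepsilon_1}^{\infty}\int_0^{\varepsilon_2}\left|\frac{\tilde f(s,t)-\tilde f(s,b)}{t}\right|dt\,ds<\infty.$$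 *)

(* Defs.v *)
From HB Require Import structures.
From mathcomp Require Export all_boot all_order all_algebra.
From mathcomp Require Import ring.
From mathcomp Require Export all_classical all_reals all_analysis.
Export Order.TTheory GRing.Theory Num.Theory.
Export numFieldNormedType.Exports.

Set Implicit Arguments.
Unset Strict Implicit.
Unset Printing Implicit Defensive.

Local Open Scope classical_set_scope.
Local Open Scope ring_scope.

(* The quaternion q0 + i q1 + j q2 + k q3 is the row vector (q0, q1, q2, q3).
   The topology is that of R^4.  Pitfall: the inherited norm `|q| is the
   sup-norm; it gives the same topology as the modulus, but the modulus
   itself is [qnorm] below. *)
Definition quat (R : realType) : Type := 'rV[R]_4.

HB.instance Definition _ (R : realType) :=
  NormedModule.copy (quat R) 'rV[R]_4.

Definition mkquat (R : realType) (a b c d : R) : quat R :=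
  \row_(n < 4) [:: a; b; c; d]`_n.

Definition qcomp (R : realType) (n : 'I_4) (q : quat R) : R := q ord0 n.

Definition qone (R : realType) : quat R := mkquat 1 0 0 0.
Definition qi (R : realType) : quat R := mkquat 0 1 0 0.
Definition qj (R : realType) : quat R := mkquat 0 0 1 0.
Definition qk (R : realType) : quat R := mkquat 0 0 0 1.

Definition qmul (R : realType) (p q : quat R) : quat R :=
  let p0 := qcomp 0 p in let p1 := qcomp 1 p in
  let p2 := qcomp 2%:R p in let p3 := qcomp 3%:R p in
  let q0 := qcomp 0 q in let q1 := qcomp 1 q in
  let q2 := qcomp 2%:R q in let q3 := qcomp 3%:R q in
  mkquat (p0 * q0 - p1 * q1 - p2 * q2 - p3 * q3)
         (p0 * q1 + p1 * q0 + p2 * q3 - p3 * q2)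
         (p0 * q2 - p1 * q3 + p2 * q0 + p3 * q1)
         (p0 * q3 + p1 * q2 - p2 * q1 + p3 * q0).

Lemma qcompE (R : realType) (n : 'I_4) (a b c d : R) :
  qcomp n (mkquat a b c d) = [:: a; b; c; d]`_n.
Proof. by rewrite /qcomp /mkquat mxE. Qed.

Lemma qcompD (R : realType) (n : 'I_4) (p q : quat R) :
  qcomp n (p + q) = qcomp n p + qcomp n q.
Proof. by rewrite /qcomp mxE. Qed.

Lemma qcompZ (R : realType) (n : 'I_4) (a : R) (q : quat R) :
  qcomp n (a *: q) = a * qcomp n q.
Proof. by rewrite /qcomp mxE. Qed.

Lemma quatP (R : realType) (p q : quat R) :
  qcomp 0 p = qcomp 0 q -> qcomp 1 p = qcomp 1 q ->
  qcomp 2%:R p = qcomp 2%:R q -> qcomp 3%:R p = qcomp 3%:R q -> p = q.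
Proof.
move=> h0 h1 h2 h3; apply/rowP.
case=> [[|[|[|[|n]]]] ltn4] //.
- by move: h0; rewrite /qcomp; congr (_ = _); congr (_ _ _); apply: val_inj.
- by move: h1; rewrite /qcomp; congr (_ = _); congr (_ _ _); apply: val_inj.
- by move: h2; rewrite /qcomp; congr (_ = _); congr (_ _ _); apply: val_inj.
- by move: h3; rewrite /qcomp; congr (_ = _); congr (_ _ _); apply: val_inj.
Qed.

Fact qmulA (R : realType) : associative (@qmul R).
Proof. by move=> p q r; apply: quatP; rewrite /qmul !qcompE /=; ring. Qed.

Fact qmul1q (R : realType) : left_id (qone R) (@qmul R).
Proof. by move=> q; apply: quatP; rewrite /qmul !qcompE /=; ring. Qed.

Fact qmulq1 (R : realType) : right_id (qone R) (@qmul R).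
Proof. by move=> q; apply: quatP; rewrite /qmul !qcompE /=; ring. Qed.

Fact qmulDl (R : realType) : left_distributive (@qmul R) +%R.
Proof. by move=> p q r; apply: quatP; rewrite /qmul !(qcompD, qcompE) /=; ring. Qed.

Fact qmulDr (R : realType) : right_distributive (@qmul R) +%R.
Proof. by move=> p q r; apply: quatP; rewrite /qmul !(qcompD, qcompE) /=; ring. Qed.

Fact qone_neq0 (R : realType) : qone R != 0.
Proof.
apply/eqP => /(congr1 (qcomp 0)); rewrite qcompE /qcomp mxE /=.
exact/eqP/oner_neq0.
Qed.

HB.instance Definition _ (R : realType) :=
  GRing.Zmodule_isNzRing.Build (quat R)
    (@qmulA R) (@qmul1q R) (@qmulq1 R) (@qmulDl R) (@qmulDr R) (@qone_neq0 R).

Fact qscaleAl (R : realType) (a : R) (p q : quat R) :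
  a *: (p * q) = (a *: p) * q.
Proof. by apply: quatP; rewrite /GRing.mul /= /qmul !(qcompZ, qcompE) /=; ring. Qed.

HB.instance Definition _ (R : realType) :=
  GRing.Lmodule_isLalgebra.Build R (quat R) (@qscaleAl R).

Fact qscaleAr (R : realType) (a : R) (p q : quat R) :
  a *: (p * q) = p * (a *: q).
Proof. by apply: quatP; rewrite /GRing.mul /= /qmul !(qcompZ, qcompE) /=; ring. Qed.

HB.instance Definition _ (R : realType) :=
  GRing.Lalgebra_isAlgebra.Build R (quat R) (@qscaleAr R).

Lemma quat_relations (R : realType) :
  [/\ [/\ qi R * qi R = -1, qj R * qj R = -1 & qk R * qk R = -1],
      qi R * qj R = qk R /\ qj R * qi R = - qk R,
      qj R * qk R = qi R /\ qk R * qj R = - qi R &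
      qk R * qi R = qj R /\ qi R * qk R = - qj R].
Proof.
by split; split; apply: quatP;
  rewrite /qcomp ?mxE /= /qcomp ?mxE /=; ring.
Qed.

Lemma quat_decomp (R : realType) (q : quat R) :
  q = (qcomp 0 q)%:A + qcomp 1 q *: qi R + qcomp 2%:R q *: qj R
      + qcomp 3%:R q *: qk R.
Proof. by apply: quatP; rewrite !qcompD !qcompZ !qcompE /=; ring. Qed.

Definition qnorm (R : realType) (q : quat R) : R :=
  Num.sqrt (\sum_(n < 4) qcomp n q ^+ 2).

Definition expi (R : realType) (x : R) : quat R := (cos x)%:A + sin x *: qi R.
Definition expj (R : realType) (x : R) : quat R := (cos x)%:A + sin x *: qj R.

(* Componentwise integral. *)
Definition qint (R : realType) (d : measure_display) (T : measurableType d)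
    (mu : {measure set T -> \bar R}) (D : set T) (f : T -> quat R) : quat R :=
  \row_(n < 4) \int[mu]_(x in D) qcomp n (f x).

(* Measurability with respect to the completion of mu; for Lebesgue measure on
   R or R^2 this is Lebesgue (rather than Borel) measurability.  No a.e.
   identification is made: f stays a function defined at every point. *)
Definition qmeasurable (R : realType) (d : measure_display)
    (T : measurableType d) (mu : {measure set T -> \bar R})
    (f : T -> quat R) : Prop :=
  exists2 g : T -> quat R,
    forall n, measurable_fun setT (fun x => qcomp n (g x)) &
    {ae mu, forall x, f x = g x}.

Definition qL1 (R : realType) (d : measure_display) (T : measurableType d)
    (mu : {measure set T -> \bar R}) (f : T -> quat R) : Prop :=
  qmeasurable mu f /\ (\int[mu]_x (qnorm (f x))%:E < +oo)%E.

Notation leb R := (@lebesgue_measure R) (only parsing).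
Notation leb2 R := (lebesgue_measure \x lebesgue_measure :
  {measure set (measurableTypeR R * measurableTypeR R) -> \bar R})%E
  (only parsing).

Definition QFT_right (R : realType) (f : R * R -> quat R) (u v : R) : quat R :=
  qint (leb2 R) setT
    (fun z => f z * expi (- (u * z.1)) * expj (- (v * z.2))).

Definition QFT_left (R : realType) (f : R * R -> quat R) (u v : R) : quat R :=
  qint (leb2 R) setT
    (fun z => expi (- (u * z.1)) * expj (- (v * z.2)) * f z).

(* The nets are a1 :: s and a2 :: t, as for [variation] in numfun. *)
Definition variation2 (R : realType) (a1 b1 a2 b2 : R) (f : R * R -> R)
    (s t : seq R) : R :=
  let S := nth b1 (a1 :: s) in let T := nth b2 (a2 :: t) in
  \sum_(0 <= i < size s) \sum_(0 <= j < size t)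
    `|f (S i.+1, T j.+1) - f (S i.+1, T j) - f (S i, T j.+1) + f (S i, T j)|.

Definition BVF (R : realType) (a1 b1 a2 b2 : R) (f : R * R -> R) : Prop :=
  [/\ exists C : R, forall s t : seq R,
        itv_partition a1 b1 s -> itv_partition a2 b2 t ->
        variation2 a1 b1 a2 b2 f s t <= C,
      exists2 s, s \in `[a1, b1] & bounded_variation a2 b2 (fun t => f (s, t)) &
      exists2 t, t \in `[a2, b2] & bounded_variation a1 b1 (fun s => f (s, t))].

Definition QBVF (R : realType) (a1 b1 a2 b2 : R) (f : R * R -> quat R) : Prop :=
  forall n : 'I_4, BVF a1 b1 a2 b2 (fun z => qcomp n (f z)).

Definition cross_nbhd (R : realType) (x0 y0 e1 e2 : R) : set (R * R) :=
  [set z | `|z.1 - x0| <= e1 \/ `|z.2 - y0| <= e2].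

Definition QBVF_in (R : realType) (K : set (R * R)) (f : R * R -> quat R) :
    Prop :=
  forall a1 b1 a2 b2 : R, a1 < b1 -> a2 < b2 ->
    `[a1, b1] `*` `[a2, b2] `<=` K -> QBVF a1 b1 a2 b2 f.

Definition symm (R : realType) (f : R * R -> quat R) (x0 y0 s t : R) : quat R :=
  f (x0 - s, y0 - t) + f (x0 + s, y0 + t)
  + f (x0 - s, y0 + t) + f (x0 + s, y0 - t).

Definition LC (R : realType) (x0 y0 e1 e2 : R) (f : R * R -> quat R) : Prop :=
  let ft := symm f x0 y0 in
  exists a b : R,
  [/\ qL1 (leb R) (fun t => ft a t),
      qL1 (leb R) (fun s => ft s b),
      (\int[leb R]_(t in `[e2, +oo[) \int[leb R]_(s in `[0%R, e1])
          (qnorm (s^-1 *: (ft s t - ft a t)))%:E < +oo)%E &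
      (\int[leb R]_(s in `[e1, +oo[) \int[leb R]_(t in `[0%R, e2])
          (qnorm (t^-1 *: (ft s t - ft s b)))%:E < +oo)%E].

(* The filter h -> 0+, k -> 0+ (independently), and M, N -> +oo. *)
Definition corner (R : realType) : set_system (R * R) :=
  filter_prod (at_right 0) (at_right 0).
Definition pinfty2 (R : realType) : set_system (R * R) :=
  filter_prod (pinfty_nbhs R) (pinfty_nbhs R).

Arguments corner R : clear implicits.
Arguments pinfty2 R : clear implicits.

Definition fpp (R : realType) (f : R * R -> quat R) (x0 y0 : R) (p : R * R) :=
  f (x0 + p.1, y0 + p.2).
Definition fpm (R : realType) (f : R * R -> quat R) (x0 y0 : R) (p : R * R) :=
  f (x0 + p.1, y0 - p.2).
Definition fmp (R : realType) (f : R * R -> quat R) (x0 y0 : R) (p : R * R) :=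
  f (x0 - p.1, y0 + p.2).
Definition fmm (R : realType) (f : R * R -> quat R) (x0 y0 : R) (p : R * R) :=
  f (x0 - p.1, y0 - p.2).

(* [lim] is a total operator; this says that the four limits in [eta] exist. *)
Definition corner_limits_exist (R : realType) (f : R * R -> quat R)
    (x0 y0 : R) : Prop :=
  [/\ cvg (fpp f x0 y0 @ corner R), cvg (fpm f x0 y0 @ corner R),
      cvg (fmp f x0 y0 @ corner R) & cvg (fmm f x0 y0 @ corner R)].

Definition eta (R : realType) (f : R * R -> quat R) (x0 y0 : R) : quat R :=
  4%:R^-1 *: (lim (fpp f x0 y0 @ corner R) + lim (fpm f x0 y0 @ corner R)
              + lim (fmp f x0 y0 @ corner R) + lim (fmm f x0 y0 @ corner R)).

Definition qint_box (R : realType) (M N : R) (F : R -> R -> quat R) : quat R :=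
  qint (leb R) `[- N, N]
    (fun v => qint (leb R) `[- M, M] (fun u => F u v)).

(* Main.v *)
From HB Require Import structures.
Require Import Defs.
From mathcomp Require Import all_boot all_order all_algebra.
From mathcomp Require Import all_classical all_reals all_analysis.
From mathcomp Require Import measurable_realfun.
From mathcomp Require Import ring lra.

Set Implicit Arguments.
Unset Strict Implicit.
Unset Printing Implicit Defensive.

Local Open Scope classical_set_scope.
Local Open Scope ring_scope.
Import Order.TTheory GRing.Theory Num.Theory.
Import numFieldNormedType.Exports.

(** The idea is the one of the Dirichlet-Jordan theorem, in two variables.

    Fourier side.  Insert the definition of the transform into the integral
    over the box [-M, M] x [-N, N] and exchange the integrals, which is
    legitimate because f is integrable and the kernel is bounded on a set of
    finite measure.  The kernel is a product of exponentials in i and in j;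
    multiplied out, it has four real components, each of the form
    a(u, s) b(v, t).  In all components but the real one a or b is a sine,
    odd in its frequency, so that its integral over a symmetric interval
    vanishes.  What remains, for each component g of f and for both transforms
    alike, is the real double integral of g(s, t) D_M(s - x0) D_N(t - y0),
    where D_M(s) = 2 sin(M s) / s is the Dirichlet kernel
    ([inversion_kernel_right], [inversion_kernel_left]).  From here on all
    functions are real.

    Real side.  Folding the four quadrants around (x0, y0) onto the first one
    ([fold_quadrants]) leaves an integral over s, t > 0, which is cut along
    s = e1 and t = e2 ([kernel_split]).

    On the near rectangle a function of bounded variation is a curve s |->
    phi(s, .) of bounded variation with values in the functions of bounded
    variation of t ([bv_curve], [BVF_bv_curve]).  Such a curve has a limit L
    at the corner ([corner_cvg]), and after subtraction of L its variation
    over a small rectangle at the corner is small.  Abel summation bounds the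
    integral of g k by the variation of g times the largest primitive of k
    ([NV_integral_le]); primitives of D_M are bounded uniformly in M near 0
    ([dker_int_le]) and tend to 0 away from 0 ([dker_tail]).  With Dirichlet's
    integral ([dker_limit]) this gives the limit pi^2 L ([corner_integral]).

    Where both variables are far the factors 1 / s and 1 / t are bounded, and
    the Riemann-Lebesgue lemma applies ([far_far]).  Where one variable is
    near, say s, condition LC says precisely that (f~(s, t) - f~(a, t)) / s is
    integrable, so that this difference is again in reach of the
    Riemann-Lebesgue lemma, while f~(a, t) splits off as a product of one-
    dimensional integrals ([LC_integrable], [far_near]).  The two parameters
    M and N go to infinity independently; this is why the Riemann-Lebesgue
    lemma for the plane ([riemann_lebesgue2]) is uniform over all bounded
    factors that depend on the other variable.

    The four corners together give pi^2 times the sum of the four limits, that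
    is 4 pi^2 times eta.

    One care is needed throughout: f is only almost everywhere equal to a Borel
    function, while its variation, its corner limits and condition LC speak of
    f itself. *)

(** * Almost everywhere equality and changes of variables *)

Section ae_tools.
Context d (T : measurableType d) (R : realType) (mu : {measure set T -> \bar R}).
Import HBNNSimple.

(** The integral of a nonnegative function is the supremum of the integrals of
    the simple functions below it.  A simple function below f, multiplied by
    the indicator of the complement of the null set, lies below g and has the
    same integral.  Here f and g are arbitrary functions, as the integrands of
    condition LC are. *)
Lemma ge0_le_integral_ae (f g : T -> \bar R) :
  (forall x, 0 <= f x)%E -> (forall x, 0 <= g x)%E ->
  {ae mu, forall x, (f x <= g x)%E} ->
  (\int[mu]_x f x <= \int[mu]_x g x)%E.
Proof.
move=> f0 g0 [N [mN muN0 fgN]].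
rewrite [leLHS]ge0_integralTE// [leRHS]ge0_integralTE//.
apply: ge_ereal_sup => _ [h /= hf <-].
(* h' is h set to 0 on the null set N. *)
pose h' := mul_nnsfun h (indic_nnsfun R (measurableC mN)).
have h'E x : h' x = h x * \1_(~` N) x by [].
have -> : sintegral mu h = sintegral mu h'.
  rewrite -!integralT_nnsfun; apply: ae_eq_integral => //.
  - exact/measurable_EFinP.
  - exact/measurable_EFinP.
  - exists N; split => // x /= /not_implyP[_].
    apply: contra_notP => Nx; congr EFin; rewrite [RHS]h'E indicE.
    by rewrite mem_set// mulr1.
apply: ereal_sup_ubound; exists h' => // x; rewrite h'E indicE.
have [Nx|Nx] := pselect (N x).
  by rewrite memNset ?mulr0//= => /(_ Nx).
rewrite mem_set// mulr1 (le_trans (hf x))//.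
by apply: contrapT => fg; apply: Nx; apply: fgN.
Qed.

Lemma ae_integral_eq (f g : T -> \bar R) (D : set T) :
  {ae mu, forall x, f x = g x} ->
  (\int[mu]_(x in D) f x = \int[mu]_(x in D) g x)%E.
Proof.
move=> fg; rewrite [LHS]integralE [RHS]integralE; congr (_ - _)%E;
  rewrite integral_mkcond [RHS]integral_mkcond; apply/eqP; rewrite eq_le;
  apply/andP; split; apply: ge0_le_integral_ae;
  try (by apply: erestrict_ge0 => x Dx; exact: funepos_ge0);
  try (by apply: erestrict_ge0 => x Dx; exact: funeneg_ge0);
  by apply: filterS fg => x fgx; rewrite !patchE ?funeposE ?funenegE fgx.
Qed.

Lemma ae_Rintegral_eq (f g : T -> R) (D : set T) :
  {ae mu, forall x, f x = g x} ->
  \int[mu]_(x in D) f x = \int[mu]_(x in D) g x.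
Proof.
move=> fg; rewrite /Rintegral; congr fine; apply: ae_integral_eq.
by apply: filterS fg => x ->.
Qed.

Lemma Rintegral_indic (A : set T) (f : T -> R) :
  \int[mu]_(x in A) f x = \int[mu]_x (\1_A x * f x).
Proof.
rewrite Rintegral_mkcond; apply: eq_Rintegral => x _; rewrite patchE indicE.
by case: ifPn => _; rewrite ?mul1r ?mul0r.
Qed.

Lemma integrable_indicP (A : set T) (f : T -> R) : measurable A ->
  mu.-integrable A (EFin \o f) <->
  mu.-integrable setT (EFin \o (fun x => \1_A x * f x)).
Proof.
move=> mA; rewrite (integrable_mkcond _ mA).
suff -> : (EFin \o f) \_ A = EFin \o (fun x => \1_A x * f x) by [].
apply/funext => x; rewrite patchE /= indicE.
by case: ifPn => _; rewrite ?mul1r ?mul0r.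
Qed.

Lemma Rintegral_sum (I : Type) (s : seq I) (F : I -> T -> R) (D : set T) :
  measurable D -> (forall i, mu.-integrable D (EFin \o F i)) ->
  mu.-integrable D (EFin \o (fun x => \sum_(i <- s) F i x)) /\
  \int[mu]_(x in D) (\sum_(i <- s) F i x) = \sum_(i <- s) \int[mu]_(x in D) F i x.
Proof.
move=> mD iF; elim: s => [|i s [ih1 ih2]].
  split.
    by apply: eq_integrable (integrable0 _ _) => // x _ /=; rewrite big_nil.
  rewrite big_nil; under eq_Rintegral do rewrite big_nil.
  by rewrite Rintegral_cst// mul0r.
split.
  by apply: eq_integrable (integrableD mD (iF i) ih1) => // x _ /=; rewrite big_cons.
rewrite big_cons -ih2 -RintegralD//.
by apply: eq_Rintegral => x _; rewrite big_cons.
Qed.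

End ae_tools.

Section product_ae.
Context d1 d2 (T1 : measurableType d1) (T2 : measurableType d2) (R : realType).
Variable m1 : {sigma_finite_measure set T1 -> \bar R}.
Variable m2 : {sigma_finite_measure set T2 -> \bar R}.

(** A null set of the product has null sections, since its measure is the
    integral of the measures of the sections. *)
Lemma ae_xsection (P : T1 * T2 -> Prop) :
  {ae (m1 \x m2)%E, forall z, P z} ->
  {ae m1, forall x, {ae m2, forall y, P (x, y)}}.
Proof.
move=> [N [mN N0 PN]].
have : {ae m1, forall x, setT x -> m2 (xsection N x) = 0%E}.
  apply/(ae_eq_integral_abs m1 measurableT).
    exact: measurable_fun_xsection.
  rewrite -[RHS]N0; apply: eq_integral => x _.
  by rewrite gee0_abs.
apply: filterS => x /(_ I) Nx; exists (xsection N x); split => //.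
  exact: measurable_xsection.
by move=> y /= Py; rewrite /xsection/= inE; apply: PN.
Qed.

Lemma integral_swap (F : T1 * T2 -> R) :
  (m1 \x m2)%E.-integrable setT (EFin \o F) ->
  (m2 \x m1)%E.-integrable setT (EFin \o (fun z => F (z.2, z.1))) /\
  \int[(m2 \x m1)%E]_z F (z.2, z.1) = \int[(m1 \x m2)%E]_z F z.
Proof.
move=> iF.
have mF : measurable_fun setT (EFin \o F) by exact: measurable_int iF.
have mG : measurable_fun setT (EFin \o (fun z : T2 * T1 => F (z.2, z.1))).
  apply: (measurableT_comp mF).
  by apply: measurable_fun_pair; [exact: measurable_snd|exact: measurable_fst].
have iG : (m2 \x m1)%E.-integrable setT (EFin \o (fun z => F (z.2, z.1))).
  apply/(integrable12ltyP m2 m1 mG) => /=.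
  exact/(integrable21ltyP m1 m2 mF).
split=> //; rewrite /Rintegral; congr fine.
rewrite -[RHS](integral21_prod_meas1 iF) -[LHS](integral12_prod_meas1 iG).
by [].
Qed.

End product_ae.

Section product_Rintegral.
Context d1 d2 (T1 : measurableType d1) (T2 : measurableType d2) (R : realType).
Variable m1 : {sigma_finite_measure set T1 -> \bar R}.
Variable m2 : {sigma_finite_measure set T2 -> \bar R}.
Variable F : T1 * T2 -> R.
Hypothesis iF : (m1 \x m2)%E.-integrable setT (EFin \o F).

Lemma Rintegral_fubini1 :
  \int[(m1 \x m2)%E]_z F z = \int[m1]_x \int[m2]_y F (x, y).
Proof.
rewrite /Rintegral -(integral12_prod_meas1 iF); congr fine.
apply: ae_integral_eq; apply: filterS (ae_integrable1 iF) => x ix.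
by rewrite fineK//; exact: integrable_fin_num.
Qed.

Lemma Rintegral_fubini2 :
  \int[(m1 \x m2)%E]_z F z = \int[m2]_y \int[m1]_x F (x, y).
Proof.
rewrite /Rintegral -(integral21_prod_meas1 iF); congr fine.
apply: ae_integral_eq; apply: filterS (ae_integrable2 iF) => x ix.
by rewrite fineK//; exact: integrable_fin_num.
Qed.

Lemma integrable_Rfubini1 :
  m1.-integrable setT (EFin \o (fun x => \int[m2]_y F (x, y))).
Proof.
have iG := integrable_fubini_F iF.
apply/integrableP; split.
  apply: measurableT_comp => //; apply: measurableT_comp => //.
  exact: measurable_int iG.
have /integrableP[_] := iG; apply: le_lt_trans.
rewrite le_eqVlt; apply/orP; left; apply/eqP; apply: ae_integral_eq.
apply: filterS (ae_integrable1 iF) => x ix /=.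
by rewrite EFin_normr_Rintegral.
Qed.

End product_Rintegral.

Section measure_preserving.
Context d (T : measurableType d) (R : realType) (mu : {measure set T -> \bar R}).
Variable phi : T -> T.
Hypothesis mphi : measurable_fun setT phi.
Hypothesis muphi : forall A, measurable A -> mu (phi @^-1` A) = mu A.

Lemma Rintegral_preserving (F : T -> R) :
  mu.-integrable setT (EFin \o F) ->
  mu.-integrable setT (EFin \o (F \o phi)) /\
  \int[mu]_x F (phi x) = \int[mu]_x F x.
Proof.
move=> iF; have mF := measurable_int _ iF.
pose mix := isMeasurableFun.Build _ _ _ _ _ mphi.
pose sw : {mfun T >-> T} := HB.pack phi mix.
have push (G : T -> \bar R) : measurable_fun setT G -> (forall x, 0 <= G x)%E ->
    (\int[mu]_x G (phi x) = \int[mu]_x G x)%E.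
  move=> mG G0.
  transitivity (\int[pushforward mu sw]_x G x)%E.
    by rewrite ge0_integral_pushforward.
  by apply: eq_measure_integral => A mA _; exact: muphi.
have iF' : mu.-integrable setT (EFin \o (F \o phi)).
  apply/integrableP; split; first exact: (measurableT_comp mF mphi).
  have /integrableP[_] := iF; rewrite -push//.
  exact: measurableT_comp.
split=> //; rewrite /Rintegral; congr fine; rewrite [LHS]integralE [RHS]integralE.
congr (_ - _)%E.
  rewrite -(push _ (measurable_funepos mF))//.
  by apply: eq_integral => x _; rewrite !funeposE.
rewrite -(push _ (measurable_funeneg mF))//.
by apply: eq_integral => x _; rewrite !funenegE.
Qed.

Lemma ae_preserving (P : T -> Prop) :
  {ae mu, forall z, P z} -> {ae mu, forall z, P (phi z)}.
Proof.
move=> [N [mN N0 PN]]; exists (phi @^-1` N); split.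
- by rewrite -[X in measurable X]setTI; exact: mphi.
- by rewrite muphi.
- by move=> z /= Pz; apply: PN.
Qed.

End measure_preserving.

Section product_preserving.
Context d1 d2 (T1 : measurableType d1) (T2 : measurableType d2) (R : realType).
Variable m1 : {sigma_finite_measure set T1 -> \bar R}.
Variable m2 : {sigma_finite_measure set T2 -> \bar R}.
Variables (phi1 : T1 -> T1) (phi2 : T2 -> T2).
Hypothesis mphi1 : measurable_fun setT phi1.
Hypothesis mphi2 : measurable_fun setT phi2.
Hypothesis muphi1 : forall A, measurable A -> m1 (phi1 @^-1` A) = m1 A.
Hypothesis muphi2 : forall A, measurable A -> m2 (phi2 @^-1` A) = m2 A.
Let phi (z : T1 * T2) := (phi1 z.1, phi2 z.2).

Lemma measurable_product_map : measurable_fun setT phi.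
Proof.
apply: measurable_fun_pair.
  exact: (measurableT_comp mphi1 measurable_fst).
exact: (measurableT_comp mphi2 measurable_snd).
Qed.

Lemma product_preserving (A : set (T1 * T2)) : measurable A ->
  (m1 \x m2)%E (phi @^-1` A) = (m1 \x m2)%E A.
Proof.
move=> mA; apply/esym.
pose mix := isMeasurableFun.Build _ _ _ _ _ measurable_product_map.
pose sw : {mfun (T1 * T2)%type >-> (T1 * T2)%type} := HB.pack phi mix.
apply: (@product_measure_unique _ _ _ _ _ m1 m2 (pushforward (m1 \x m2)%E sw)) => // B C mB mC.
have mB' : measurable (phi1 @^-1` B).
  by rewrite -[X in measurable X]setTI; exact: mphi1.
have mC' : measurable (phi2 @^-1` C).
  by rewrite -[X in measurable X]setTI; exact: mphi2.
rewrite -[LHS]/((m1 \x m2)%E ((phi1 @^-1` B) `*` (phi2 @^-1` C))).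
rewrite product_measure1E//.
by congr (_ * _)%E; [exact: muphi1|exact: muphi2].
Qed.

End product_preserving.

Section affine.
Context (R : realType).
Notation mu := (@lebesgue_measure R).

(** The line seen from c, forwards (b = false) or backwards (b = true). *)
Definition refl_shift (c : R) (b : bool) : R -> R := fun s => c + (-1) ^+ b * s.

Lemma measurable_refl_shift c b :
  measurable_fun (setT : set (measurableTypeR R))
    (refl_shift c b : measurableTypeR R -> measurableTypeR R).
Proof.
suff : measurable_fun (setT : set R) (refl_shift c b) by [].
by apply: measurable_funD => //; apply: measurable_funM.
Qed.

(** Lebesgue measure is determined by its values on half-open intervals; a
    reflection exchanges the closed and the open end, which costs a null set. *)
Lemma lebesgue_refl_shift c b (A : set (measurableTypeR R)) : measurable A ->
  pushforward mu (refl_shift c b : _ -> measurableTypeR R) A = mu A.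
Proof.
move=> mA; apply/esym.
have ms : measurable_fun (setT : set (measurableTypeR R))
  (refl_shift c b : _ -> measurableTypeR R) by exact: measurable_refl_shift.
pose mix := isMeasurableFun.Build _ _ _ _ _ ms.
pose sw : {mfun measurableTypeR R >-> measurableTypeR R} := HB.pack (refl_shift c b) mix.
apply: (@lebesgue_measure_unique R (pushforward mu sw)) => // _ [[u v]] _ <-.
rewrite -[RHS]/(mu (refl_shift c b @^-1` `]u, v]%classic)) /= {sw mix ms}.
case: b.
- rewrite (_ : _ @^-1` _ = `[c - v, c - u[%classic); last first.
    apply/seteqP; split => x; rewrite /= /refl_shift !in_itv/= expr1 mulN1r;
    by move=> /andP[? ?]; apply/andP; split; lra.
  rewrite !lebesgue_measure_itv/= !lte_fin ltrD2l ltrN2.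
  by congr (if _ then _ else _); rewrite -!EFinD; congr EFin; ring.
- rewrite (_ : _ @^-1` _ = `]u - c, v - c]%classic); last first.
    apply/seteqP; split => x; rewrite /= /refl_shift !in_itv/= expr0 mul1r;
    by move=> /andP[? ?]; apply/andP; split; lra.
  rewrite !lebesgue_measure_itv/= !lte_fin ltrD2r.
  by congr (if _ then _ else _); rewrite -!EFinD; congr EFin; ring.
Qed.

Lemma Rintegral_refl_shift c b (F : R -> R) :
  mu.-integrable setT (EFin \o F) ->
  mu.-integrable setT (EFin \o (F \o refl_shift c b)) /\
  \int[mu]_x F (refl_shift c b x) = \int[mu]_x F x.
Proof.
apply: Rintegral_preserving; first exact: measurable_refl_shift.
exact: lebesgue_refl_shift.
Qed.

End affine.

Section affine2.
Context (R : realType).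
Notation mu := (@lebesgue_measure R).
Notation mu2 := (leb2 R).
Variables (c1 c2 : R) (b1 b2 : bool).

Definition refl_shift2 (z : R * R) : R * R :=
  (refl_shift c1 b1 z.1, refl_shift c2 b2 z.2).

Lemma Rintegral_refl_shift2 (F : R * R -> R) :
  mu2.-integrable setT (EFin \o F) ->
  mu2.-integrable setT (EFin \o (F \o refl_shift2)) /\
  \int[mu2]_x F (refl_shift2 x) = \int[mu2]_x F x.
Proof.
apply: Rintegral_preserving.
  exact: (measurable_product_map (measurable_refl_shift c1 b1)
    (measurable_refl_shift c2 b2)).
apply: (product_preserving (measurable_refl_shift c1 b1)
  (measurable_refl_shift c2 b2)); exact: lebesgue_refl_shift.
Qed.

Lemma ae_refl_shift2 (P : R * R -> Prop) :
  {ae mu2, forall z, P z} -> {ae mu2, forall z, P (refl_shift2 z)}.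
Proof.
apply: ae_preserving.
  exact: (measurable_product_map (measurable_refl_shift c1 b1)
    (measurable_refl_shift c2 b2)).
apply: (product_preserving (measurable_refl_shift c1 b1)
  (measurable_refl_shift c2 b2)); exact: lebesgue_refl_shift.
Qed.

End affine2.

(** * Abel summation for integrals against a function of bounded variation *)

Section interval_integrals.
Context (R : realType).
Notation mu := (@lebesgue_measure R).
Implicit Types (a b c h p x B : R) (F g k : R -> R).

Lemma integrable_bounded a b F B : measurable_fun `]a, b] F ->
  (forall x, a < x -> x <= b -> `|F x| <= B) ->
  mu.-integrable `]a, b] (EFin \o F).
Proof.
move=> mF FB; apply: measurable_bounded_integrable => //.
  by rewrite /= lebesgue_measure_itv/=; case: ifP => _; rewrite ?ltry// -EFinD ltry.
exists B; split; first exact: num_real.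
move=> M BM x; rewrite /= in_itv/= => /andP[? ?].
by rewrite (le_trans (FB _ _ _))// ltW.
Qed.

Lemma Rintegral_bounded_le a b F B : a <= b ->
  mu.-integrable `]a, b] (EFin \o F) ->
  (forall x, a < x -> x <= b -> `|F x| <= B) ->
  `|\int[mu]_(x in `]a, b]) F x| <= B * (b - a).
Proof.
move=> ab iF FB; apply: (le_trans (le_normr_Rintegral _ iF)) => //.
apply: (@le_trans _ _ (\int[mu]_(x in `]a, b]) (cst B x))).
  apply: le_Rintegral => //.
  - exact: integrable_norm.
  - exact: (@integrable_bounded _ _ _ `|B|).
  - by move=> x /=; rewrite in_itv/= => /andP[? ?]; exact: FB.
rewrite Rintegral_cst//.
rewrite /= lebesgue_measure_itv/= lte_fin; case: ifPn => [_|].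
  by rewrite -EFinD.
rewrite -leNgt => ba.
have -> : a = b by apply/eqP; rewrite eq_le ab.
by rewrite subrr.
Qed.

Lemma Rintegral_cat a b c F : a <= b -> b <= c ->
  mu.-integrable `]a, c] (EFin \o F) ->
  \int[mu]_(x in `]a, c]) F x =
  \int[mu]_(x in `]a, b]) F x + \int[mu]_(x in `]b, c]) F x.
Proof.
move=> ab bc iF; rewrite -(@Rintegral_itvB _ _ _ _ b iF)//.
by rewrite addrC subrK.
Qed.

Lemma Rintegral_shift a h p F : mu.-integrable `]p + a, p + h] (EFin \o F) ->
  mu.-integrable `]a, h] (EFin \o (fun s => F (p + s))) /\
  \int[mu]_(s in `]a, h]) F (p + s) = \int[mu]_(s in `]p + a, p + h]) F s.
Proof.
move=> iF.
have iF1 : mu.-integrable setT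
    (EFin \o (fun x => \1_(`]p + a, p + h]%classic) x * F x)).
  by apply/(@integrable_indicP _ (measurableTypeR R) R mu `]p + a, p + h]%classic F).
have [iG GE] := Rintegral_refl_shift p false iF1.
have E s : \1_(`]p + a, p + h]%classic) (refl_shift p false s) = \1_(`]a, h]%classic) s :> R.
  rewrite !indicE /refl_shift expr0 mul1r; congr (nat_of_bool _)%:R.
  by apply/idP/idP; rewrite !inE/= !in_itv/= ltrD2l lerD2l.
have FE s : F (refl_shift p false s) = F (p + s).
  by rewrite /refl_shift expr0 mul1r.
split.
  apply/(@integrable_indicP _ (measurableTypeR R) R mu `]a, h]%classic) => //.
  by apply: eq_integrable iG => // s _ /=; rewrite E FE.
rewrite Rintegral_indic [RHS]Rintegral_indic -GE.
by apply: eq_Rintegral => s _; rewrite E FE.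
Qed.

(** Superposing the cells of a uniform grid turns a sum over cells into a single
    integral over the offset s, for each value of which Abel summation can be
    applied. *)
Lemma Rintegral_cells a h m F : 0 <= h ->
  mu.-integrable `]a, a + m%:R * h] (EFin \o F) ->
  \int[mu]_(x in `]a, a + m%:R * h]) F x =
  \sum_(i < m) \int[mu]_(s in `]0, h]) F (a + i%:R * h + s).
Proof.
move=> h0; elim: m => [|m ih] iF.
  rewrite big_ord0 mul0r addr0 (_ : `]a, a]%classic = set0) ?Rintegral_set0//.
  by apply/seteqP; split => x //=; rewrite in_itv/=; lra.
have mh : 0 <= m%:R * h by rewrite mulr_ge0.
have am : a <= a + m%:R * h by rewrite lerDl.
have Sm : a + m.+1%:R * h = a + m%:R * h + h by rewrite -natr1 mulrDl mul1r addrA.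
have le : a + m%:R * h <= a + m.+1%:R * h by rewrite Sm lerDl.
rewrite (Rintegral_cat am le)// ih; last first.
  by apply: integrableS iF => //; apply: subset_itvl; rewrite bnd_simp.
rewrite big_ord_recr/=; congr (_ + _).
have iF0 : mu.-integrable `]a + m%:R * h + 0, a + m%:R * h + h] (EFin \o F).
  rewrite addr0 -Sm; apply: integrableS iF => //.
  by apply: subset_itvr; rewrite bnd_simp.
by have [_ ->] := Rintegral_shift iF0; rewrite addr0 -Sm.
Qed.

End interval_integrals.

Section lipschitz.
Context (R : realType).
Implicit Types (k : R -> R) (K : R).

Definition lip k K := forall x y, `|k x - k y| <= K * `|x - y|.

Lemma lip_ge0 k K : lip k K -> 0 <= K.
Proof. by move=> kK; have := kK 1 0; rewrite subr0 normr1 mulr1; apply: le_trans. Qed.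

Lemma lip_continuous k K : lip k K -> continuous k.
Proof.
move=> kK x; apply/cvgrPdist_le => e e0.
have K0 := lip_ge0 kK.
have K1 : 0 < K + 1 by rewrite ltr_wpDl.
exists (e / (K + 1)) => /=; first by rewrite divr_gt0.
move=> y /= xy; apply: (le_trans (kK x y)).
apply: (@le_trans _ _ ((K + 1) * (e / (K + 1)))).
  by apply: ler_pM => //; [rewrite lerDl|exact: ltW].
by rewrite mulrCA divff ?mulr1// gt_eqF.
Qed.

Lemma lip_measurable k K (D : set R) : lip k K -> measurable_fun D k.
Proof.
by move=> /lip_continuous ck; apply: measurable_funTS; exact: continuous_measurable_fun.
Qed.

Lemma lip_bounded k K (a b : R) x : lip k K -> a <= x -> x <= b ->
  `|k x| <= `|k a| + K * (b - a).
Proof.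
move=> kK ax xb.
have K0 := lip_ge0 kK.
rewrite -lerBlDl; apply: (le_trans (lerB_dist _ _)).
apply: (le_trans (kK x a)); apply: ler_wpM2l => //.
by rewrite ger0_norm ?subr_ge0// lerB.
Qed.

End lipschitz.

Section nets.
Context (R : realType).
Implicit Types (a b C : R) (g : R -> R) (x : nat -> R).

(** The nets stay in the half-open interval ]a, b], so that the value of a
    function at the corner point a does not matter for its variation. *)
Definition strict_net a b n x :=
  (forall i, (i <= n)%N -> a < x i /\ x i <= b) /\
  (forall i, (i < n)%N -> x i < x i.+1).

Definition net_sum g n x := \sum_(i < n) `|g (x i.+1) - g (x i)|.

(** C bounds the norm of g in the space of functions of bounded variation on
    ]a, b]: the value at the last point of the net plus the variation.  Adding
    the value makes the bound control the supremum as well, and it is the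
    boundary term of Abel summation. *)
Definition NV a b g C := forall n x, strict_net a b n x ->
  `|g (x n)| + net_sum g n x <= C.

Lemma NV_le a b g C s : NV a b g C -> a < s -> s <= b -> `|g s| <= C.
Proof.
move=> gC as_ sb; have := gC 0%N (fun=> s); rewrite /net_sum big_ord0 addr0; apply.
by split.
Qed.

Lemma NV_ge0 a b g C : a < b -> NV a b g C -> 0 <= C.
Proof. by move=> ab /NV_le/(_ ab (lexx _)); apply: le_trans. Qed.

Lemma strict_net_sub a b a' b' n x : a <= a' -> b' <= b ->
  strict_net a' b' n x -> strict_net a b n x.
Proof.
move=> aa bb [h1 h2]; split=> // i /h1[h3 h4].
by split; [exact: le_lt_trans h3|exact: le_trans bb].
Qed.

Lemma NV_sub a b a' b' g C : a <= a' -> b' <= b -> NV a b g C -> NV a' b' g C.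
Proof. by move=> aa bb gC n x /(strict_net_sub aa bb)/gC. Qed.

(** The net x_0, ..., x_n with s appended; the value at n.+1 and beyond is s. *)
Definition net_snoc x n s : nat -> R := fun i => if (i <= n)%N then x i else s.

Lemma strict_net_snoc a b n x s : strict_net a b n x -> x n < s -> s <= b ->
  let y := net_snoc x n s in
  strict_net a b n.+1 y /\
  forall D : R -> R -> R, \sum_(i < n.+1) D (y i) (y i.+1) =
    \sum_(i < n) D (x i) (x i.+1) + D (x n) s.
Proof.
move=> [h1 h2] xs sb y.
have yx i : (i <= n)%N -> y i = x i by rewrite /y /net_snoc => ->.
have ys : y n.+1 = s by rewrite /y /net_snoc ltnn.
split; last first.
  move=> D; rewrite big_ord_recr/= ys yx//; congr (_ + _).
  by apply: eq_bigr => i _; rewrite !yx// ltnW.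
split=> i.
  rewrite /y /net_snoc.
  case: ifP => [/h1//|ni _]; split=> //.
  by apply: lt_trans xs; have [] := h1 n (leqnn _).
rewrite ltnS leq_eqVlt => /predU1P[->|lin].
  by rewrite ys yx.
by rewrite !yx//; [exact: h2|exact: ltnW].
Qed.

Lemma nondecreasing_itv_measurable a b (f : R -> R) :
  (forall s t, a < s -> s <= t -> t <= b -> f s <= f t) ->
  measurable_fun `]a, b] f.
Proof.
move=> f_nd.
apply: (measurability (@RGenCInfty.G R)) => [|/= _ [_] [r] -> <-].
  exact: RGenCInfty.measurableE.
apply: is_interval_measurable => s t/=; rewrite !in_itv/= !andbT.
move=> [/andP[as_ sb] rs] [/andP[at_ tb] rt] u /andP[su ut].
have au : a < u by exact: lt_le_trans su.
have ub : u <= b by exact: le_trans tb.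
by split; rewrite in_itv/= ?au ?ub// andbT (le_trans rs)// f_nd.
Qed.

Lemma NV_measurable a b g C : NV a b g C -> measurable_fun `]a, b] g.
Proof.
move=> gC.
(* v is the variation of g up to s; both v and v - g are nondecreasing. *)
pose S s := [set r | exists n x, [/\ strict_net a b n x, x n = s & r = net_sum g n x]].
pose v s := sup (S s).
have S0 s : a < s -> s <= b -> S s 0.
  move=> as_ sb; exists 0%N, (fun=> s); split=> //.
  by rewrite /net_sum big_ord0.
have SC s : has_ubound (S s).
  exists C => _ [n [x [xab _ ->]]]; apply: le_trans (gC _ _ xab).
  by rewrite lerDr.
have step s t : a < s -> s < t -> t <= b -> v s + `|g t - g s| <= v t.
  move=> as_ st tb; rewrite -lerBrDr; apply: ge_sup.
    by exists 0; apply: S0 => //; rewrite (le_trans (ltW st)).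
  move=> _ [n [x [xab xn ->]]]; rewrite lerBrDr; apply: ub_le_sup => //.
  rewrite -xn in st.
  have [yab yE] := strict_net_snoc xab st tb.
  eexists; eexists; split; first exact: yab.
    by rewrite /net_snoc ltnn.
  by rewrite -xn; exact/esym/(yE (fun u w => `|g w - g u|)).
have -> : g = (v \- (fun s => v s - g s)).
  by apply/funext => s /=; ring.
apply: measurable_funB.
  apply: nondecreasing_itv_measurable => s t as_.
  rewrite le_eqVlt => /predU1P[->//|st] tb.
  by apply: le_trans (step s t as_ st tb); rewrite lerDl.
apply: nondecreasing_itv_measurable => s t as_.
rewrite le_eqVlt => /predU1P[->//|st] tb.
have := step s t as_ st tb; have := ler_norm (g t - g s); lra.
Qed.

(** Summation by parts. *)
Lemma abel_bound (G k : nat -> R) n B :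
  (forall i, (i <= n)%N -> `|\sum_(j < i.+1) k j| <= B) ->
  `|\sum_(i < n.+1) G i * k i| <= (`|G n| + \sum_(i < n) `|G i.+1 - G i|) * B.
Proof.
move=> kB; pose T i := \sum_(j < i.+1) k j.
have -> : \sum_(i < n.+1) G i * k i =
    G n * T n - \sum_(i < n) (G i.+1 - G i) * T i.
  elim: n {kB} => [|n ih]; first by rewrite big_ord_recl /T !big_ord0 big_ord_recl big_ord0; ring.
  rewrite big_ord_recr/= ih [in RHS]big_ord_recr/= {3}/T big_ord_recr/= -/(T n); ring.
rewrite mulrDl; apply: (le_trans (ler_normB _ _)); apply: lerD.
  by rewrite normrM ler_wpM2l// kB.
rewrite mulr_suml; apply: (le_trans (ler_norm_sum _ _ _)); apply: ler_sum => i _.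
by rewrite normrM ler_wpM2l// kB// ltnW.
Qed.

End nets.

Section NV_integral.
Context (R : realType).
Notation mu := (@lebesgue_measure R).
Implicit Types (a b h s C K A : R) (g k : R -> R).

Lemma NV_integrable a b g C k K : NV a b g C -> lip k K ->
  mu.-integrable `]a, b] (EFin \o (fun x => g x * k x)).
Proof.
move=> gC kK; apply: (@integrable_bounded _ _ _ _ (C * (`|k a| + K * (b - a)))).
  by apply: measurable_funM; [exact: NV_measurable gC|exact: lip_measurable kK].
move=> x ax xb; rewrite normrM; apply: ler_pM => //; first exact: NV_le gC _ _.
by apply: lip_bounded => //; exact: ltW.
Qed.

Lemma lip_integrable a b k K : lip k K -> mu.-integrable `]a, b] (EFin \o k).
Proof.
move=> kK; apply: (@integrable_bounded _ _ _ _ (`|k a| + K * (b - a))).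
  exact: lip_measurable kK.
by move=> x ax xb; apply: lip_bounded => //; exact: ltW.
Qed.

(** A Riemann sum of k differs from the integral by at most K h on each unit of
    length, because k is K-Lipschitz.  So partial sums over the grid inherit the
    bound A on the primitive of k up to an error that vanishes with the mesh. *)
Lemma uniform_grid_sum a h m k K A s : 0 < h -> lip k K ->
  (forall x, a <= x -> x <= a + m%:R * h -> `|\int[mu]_(t in `]a, x]) k t| <= A) ->
  0 < s -> s <= h -> forall j, (j <= m)%N ->
  h * `|\sum_(i < j) k (a + i%:R * h + s)| <= A + m%:R * h * (K * h).
Proof.
move=> h0 kK kA s0 sh j jm.
have K0 := lip_ge0 kK.
have ik i : mu.-integrable `]0, h] (EFin \o (fun t => k (a + i%:R * h + t))).
  have := @Rintegral_shift _ 0 h (a + i%:R * h) k.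
  by move=> /(_ (lip_integrable _ _ kK))[].
have -> : h * `|\sum_(i < j) k (a + i%:R * h + s)| =
    `|\sum_(i < j) h * k (a + i%:R * h + s)|.
  by rewrite -mulr_sumr normrM (gtr0_norm h0).
have E : \int[mu]_(t in `]a, a + j%:R * h]) k t =
    \sum_(i < j) \int[mu]_(t in `]0, h]) k (a + i%:R * h + t).
  by rewrite Rintegral_cells//; [exact: ltW|exact: lip_integrable kK].
rewrite -[X in `|X|](subrK (\int[mu]_(t in `]a, a + j%:R * h]) k t)).
rewrite addrC; apply: (le_trans (ler_normD _ _)); apply: lerD.
  apply: kA; first by rewrite lerDl mulr_ge0// ltW.
  by rewrite lerD2l ler_wpM2r ?ler_nat// ltW.
rewrite E -sumrB; apply: (le_trans (ler_norm_sum _ _ _)).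
apply: (@le_trans _ _ (\sum_(i < j) (K * h * h))); last first.
  rewrite sumr_const card_ord -[leLHS]mulr_natl.
  rewrite (_ : m%:R * h * (K * h) = m%:R * (K * h * h)); last by ring.
  by apply: ler_wpM2r; [rewrite !mulr_ge0// ltW|rewrite ler_nat].
apply: ler_sum => i _.
have -> : h * k (a + i%:R * h + s) - \int[mu]_(t in `]0, h]) k (a + i%:R * h + t) =
   \int[mu]_(t in `]0, h]) (k (a + i%:R * h + s) - k (a + i%:R * h + t)).
  rewrite RintegralB//; last first.
    by apply: (@integrable_bounded _ _ _ _ `|k (a + i%:R * h + s)|).
  by rewrite Rintegral_cst//= lebesgue_measure_itv/= lte_fin h0 -EFinD subr0/= mulrC.
have -> : K * h * h = K * h * (h - 0) by rewrite subr0.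
apply: Rintegral_bounded_le; first exact: ltW.
  apply: (@integrable_bounded _ _ _ _ (K * h)).
    apply: measurable_funB => //.
    by have /measurable_int/measurable_EFinP := ik i.
  move=> x x0 xh; apply: (le_trans (kK _ _)); apply: ler_wpM2l => //.
  by rewrite opprD addrACA subrr add0r ler_norml; apply/andP; split; lra.
move=> x x0 xh; apply: (le_trans (kK _ _)); apply: ler_wpM2l => //.
by rewrite opprD addrACA subrr add0r ler_norml; apply/andP; split; lra.
Qed.

(** The second mean value theorem in the form of an inequality.  Over a uniform
    grid of mesh h, each sum over the shifted grid points is bounded by Abel
    summation; integrate over the shift and let h tend to 0.  Lipschitz kernels
    suffice for the applications and spare the construction of a Stieltjes
    integral. *)
Lemma NV_integral_le a b g C k K A : a < b -> NV a b g C -> lip k K ->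
  (forall x, a <= x -> x <= b -> `|\int[mu]_(t in `]a, x]) k t| <= A) ->
  `|\int[mu]_(x in `]a, b]) (g x * k x)| <= C * A.
Proof.
move=> ab gC kK kA; have C0 := NV_ge0 ab gC.
have K0 := lip_ge0 kK.
have iF := NV_integrable gC kK.
suff H n : `|\int[mu]_(x in `]a, b]) (g x * k x)| <=
    C * (A + (b - a) * (K * ((b - a) / n.+1%:R))).
  apply/ler_addgt0Pr => e e0.
  (* Q / n.+1 is the error term of the grid with n.+1 cells. *)
  pose Q := C * ((b - a) * (K * (b - a))).
  have Q0 : 0 <= Q by rewrite /Q !mulr_ge0// subr_ge0 ltW.
  have [n nQ] : exists n : nat, Q / e < n.+1%:R.
    exists (Num.truncn (Q / e)); exact: truncnS_gt.
  apply: (le_trans (H n)); rewrite mulrDr lerD2l.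
  rewrite (_ : C * _ = Q / n.+1%:R); last by rewrite /Q !mulrA.
  by rewrite ler_pdivrMr// mulrC -ler_pdivrMr// ltW.
set m := n.+1; set h := (b - a) / m%:R.
have m0 : 0 < m%:R :> R by rewrite ltr0n.
have h0 : 0 < h by rewrite divr_gt0// subr_gt0.
have mh : m%:R * h = b - a by rewrite mulrC divfK// gt_eqF.
have bE : b = a + m%:R * h by rewrite mh addrC subrK.
have iF' : mu.-integrable `]a, a + m%:R * h] (EFin \o (fun x => g x * k x)).
  by rewrite -bE.
rewrite [X in `]a, X]](bE) (Rintegral_cells (ltW h0) iF').
pose G i t := (fun x => g x * k x) (a + i%:R * h + t).
have gr i : (i < m)%N -> a + i%:R * h + h <= b.
  move=> im; rewrite bE -addrA lerD2l -[X in _ + X]mul1r -mulrDl ler_wpM2r ?(ltW h0)//.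
  by rewrite natr1 ler_nat.
(* Set to 0 beyond the last cell, where g is not controlled. *)
pose G' i := if (i < m)%N then G i else cst 0.
have iG' i : mu.-integrable `]0, h] (EFin \o G' i).
  rewrite /G'; case: ifPn => im; last exact: integrable0.
  have := @Rintegral_shift _ 0 h (a + i%:R * h) (fun x => g x * k x).
  move=> /(_ _)[]//; apply: integrableS iF => // x /=; rewrite !in_itv/= addr0.
  move=> /andP[h1 h2]; apply/andP; split; last exact: (le_trans h2 (gr _ im)).
  by apply: le_lt_trans h1; rewrite lerDl mulr_ge0// ltW.
have mD : measurable (`]0, h]%classic : set (measurableTypeR R)) by exact: measurable_itv.
have [iS SE] := Rintegral_sum (index_enum 'I_m) mD (fun i : 'I_m => iG' i).
have -> : \sum_(i < m) \int[mu]_(s in `]0, h])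
    (g (a + i%:R * h + s) * k (a + i%:R * h + s)) =
    \int[mu]_(x in `]0, h]) (\sum_(i < m) G' i x).
  by rewrite SE; apply: eq_bigr => i _; rewrite /G' ltn_ord.
have -> : C * (A + (b - a) * (K * h)) =
  C * (A + m%:R * h * (K * h)) / h * (h - 0).
  by rewrite subr0 divfK ?gt_eqF// mh.
apply: Rintegral_bounded_le => //; first exact: ltW.
move=> s s0 sh.
have -> : \sum_(i < m) G' i s =
    \sum_(i < n.+1) g (a + i%:R * h + s) * k (a + i%:R * h + s).
  by apply: eq_bigr => i _; rewrite /G' ltn_ord.
apply: (le_trans (@abel_bound _ (fun i => g (a + i%:R * h + s))
  (fun i => k (a + i%:R * h + s)) n ((A + m%:R * h * (K * h)) / h) _)).
  move=> i im; rewrite ler_pdivlMr// mulrC.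
  by apply: (@uniform_grid_sum a h m k K A s) => //; rewrite -bE.
rewrite -[leRHS]mulrA; apply: ler_wpM2r.
  apply: divr_ge0 (ltW h0); apply: addr_ge0.
    by apply: le_trans (kA a (lexx _) (ltW ab)).
  by apply: mulr_ge0; (apply: mulr_ge0; last exact: ltW).
(* The shifted grid points form a net of ]a, b]. *)
apply: (gC n (fun i => a + i%:R * h + s)); split=> i im.
  split; first by rewrite -addrA ltrDl ltr_wpDl//; apply: mulr_ge0 => //; exact: ltW.
  by apply: le_trans (gr i _) => //; rewrite lerD2l.
by rewrite ltrD2r ltrD2l ltr_pM2r// ltr_nat.
Qed.

End NV_integral.

(** * The Dirichlet kernel *)

Section ftc_tools.
Context (R : realType).
Notation mu := (@lebesgue_measure R).
Implicit Types (a b s t x K M : R) (F f g : R -> R).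

Lemma FTC_cc a b F f : a <= b -> continuous f ->
  (forall x, is_derive x (1:R) F (f x)) ->
  \int[mu]_(x in `[a, b]) f x = F b - F a.
Proof.
rewrite le_eqVlt => /predU1P[->|ab] cf dF.
  by rewrite set_itv1 Rintegral_set1 subrr.
have cF x : {for x, continuous F}.
  by apply: differentiable_continuous; apply/derivable1_diffP; apply: ex_derive.
rewrite /Rintegral (@continuous_FTC2 _ f F a b)//.
- exact: continuous_subspaceT.
- split; first by move=> x _; apply: ex_derive.
  + exact/cvg_at_right_filter/cF.
  + exact/cvg_at_left_filter/cF.
- by move=> x _; rewrite derive1E; apply: derive_val.
Qed.

Lemma continuous_integrable a b f : continuous f ->
  mu.-integrable `[a, b] (EFin \o f).
Proof.
move=> cf; apply: continuous_compact_integrable; first exact: segment_compact.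
exact: continuous_subspaceT.
Qed.

Lemma continuous_integrable_oc a b f : continuous f ->
  mu.-integrable `]a, b] (EFin \o f).
Proof.
move=> /(@continuous_integrable a b); apply: integrableS => //.
exact: subset_itv_oc_cc.
Qed.

Lemma FTC_oc a b F f : a <= b -> continuous f ->
  (forall x, is_derive x (1:R) F (f x)) ->
  \int[mu]_(x in `]a, b]) f x = F b - F a.
Proof.
move=> ab cf dF; rewrite -(FTC_cc ab cf dF) Rintegral_itv_obnd_cbnd//.
exact: continuous_integrable_oc.
Qed.

Lemma derive_bounded_lip F f K : (forall x, is_derive x (1:R) F (f x)) ->
  (forall x, `|f x| <= K) -> lip F K.
Proof.
move=> dF fK; have K0 : 0 <= K by apply: le_trans (fK 0).
have cF x : {for x, continuous F}.
  by apply: differentiable_continuous; apply/derivable1_diffP; apply: ex_derive.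
suff H x y : x <= y -> `|F x - F y| <= K * `|x - y|.
  move=> x y; have [/H//|/ltW/H] := leP x y.
  by rewrite distrC (distrC y).
move=> xy; have [c _ E] := MVT_segment xy (fun z _ => dF z)
  (continuous_subspaceT cF).
by rewrite distrC E normrM (distrC x) ler_wpM2r.
Qed.

Lemma lip_cos : lip (@cos R) 1.
Proof.
apply: (@derive_bounded_lip _ (fun x => - sin x)) => x.
by rewrite normrN sin_max.
Qed.

Lemma lip_sin : lip (@sin R) 1.
Proof. by apply: (@derive_bounded_lip _ cos) => x; exact: cos_max. Qed.

Lemma lip_scale (k : R -> R) K M : 0 <= K -> lip k K -> lip (fun x => k (M * x)) (K * `|M|).
Proof.
by move=> K0 kK x y; apply: le_trans (kK _ _) _; rewrite -mulrBr normrM mulrA.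
Qed.

Lemma Rintegral_sin a b M : 0 < M -> a <= b ->
  \int[mu]_(x in `]a, b]) sin (M * x) = (cos (M * a) - cos (M * b)) / M.
Proof.
move=> M0 ab; have M1 : M != 0 by rewrite gt_eqF.
pose F (x : R) := - (cos (M * x) / M).
have cf := lip_continuous (lip_scale M ler01 lip_sin).
have dF x : is_derive x (1:R) F (sin (M * x)).
  by apply: is_derive_eq; rewrite /GRing.scale/=; field.
by rewrite (FTC_oc ab cf dF) /F; field.
Qed.

Lemma Rintegral_sin_le a b M : 0 < M -> a <= b ->
  `|\int[mu]_(x in `]a, b]) sin (M * x)| <= 2 / M.
Proof.
move=> M0 ab; rewrite Rintegral_sin// normrM (ger0_norm (ltW (_ : 0 < M^-1))) ?invr_gt0//.
apply: ler_wpM2r; first by rewrite invr_ge0 ltW.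
apply: (le_trans (ler_normB _ _)).
by have := cos_max (M * a); have := cos_max (M * b); lra.
Qed.

(** The absolute values telescope to the value at the first point. *)
Lemma decreasing_NV a b g C :
  (forall s t, a < s -> s <= t -> t <= b -> g t <= g s) ->
  (forall s, a < s -> s <= b -> 0 <= g s) ->
  (forall s, a < s -> s <= b -> g s <= C) -> NV a b g C.
Proof.
move=> gd g0 gC n x xab.
suff -> : `|g (x n)| + net_sum g n x = g (x 0%N).
  by have [h _] := xab; have [? ?] := h 0%N (leq0n _); exact: gC.
elim: n xab => [|n ih] [h1 h2].
  rewrite /net_sum big_ord0 addr0 ger0_norm//.
  by have [? ?] := h1 0%N (leq0n _); exact: g0.
rewrite -ih; last by split=> i im; [apply: h1|apply: h2]; exact: leqW.
rewrite /net_sum big_ord_recr/= addrCA [RHS]addrC; congr (_ + _).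
have [? ?] := h1 n (leqnSn _); have [? ?] := h1 n.+1 (leqnn _).
have gle : g (x n.+1) - g (x n) <= 0 by rewrite subr_le0 gd// ltW// h2.
rewrite (ler0_norm gle) (ger0_norm (g0 (x n.+1) _ _))// (ger0_norm (g0 (x n) _ _))//.
by ring.
Qed.

Lemma Rintegral_decreasing_sin a b M g C : 0 < M -> a <= b ->
  (forall s t, a < s -> s <= t -> t <= b -> g t <= g s) ->
  (forall s, a < s -> s <= b -> 0 <= g s) ->
  (forall s, a < s -> s <= b -> g s <= C) -> 0 <= C ->
  `|\int[mu]_(x in `]a, b]) (g x * sin (M * x))| <= C * (2 / M).
Proof.
move=> M0; rewrite le_eqVlt => /predU1P[->|ab] gd g0 gC C0.
  rewrite set_itvoc0 Rintegral_set0 normr0.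
  by rewrite !mulr_ge0// invr_ge0 ltW.
apply: (NV_integral_le ab (decreasing_NV gd g0 gC) (lip_scale M ler01 lip_sin)).
by move=> x ax xb; exact: Rintegral_sin_le.
Qed.

End ftc_tools.

Section dirichlet_kernel.
Context (R : realType).
Notation mu := (@lebesgue_measure R).
Implicit Types (a b d s t x M N : R) (F f g : R -> R).

(** The Dirichlet kernel 2 sin(M s) / s.  As an integral of cosines it has the
    right value 2 M at s = 0, it is visibly Lipschitz and even, and it is what
    the integral over the frequency box produces. *)
Definition dker M s : R := \int[mu]_(u in `[- M, M]) cos (u * s).

Lemma continuous_cosM s : continuous (fun u : R => cos (u * s)).
Proof.
under eq_fun do rewrite mulrC.
exact: (lip_continuous (lip_scale s ler01 (@lip_cos R))).
Qed.

Lemma dker_sin M s : 0 <= M -> s != 0 -> dker M s = 2 * s^-1 * sin (M * s).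
Proof.
move=> M0 s0; rewrite /dker.
pose F (u : R) := sin (u * s) / s.
have dF x : is_derive x (1:R) F (cos (x * s)).
  by apply: is_derive_eq; rewrite /GRing.scale/=; field.
rewrite (FTC_cc _ (@continuous_cosM s) dF); last by rewrite ge0_cp.
by rewrite /F mulNr sinN; field.
Qed.

Lemma dkerB_le M s t : 0 <= M -> `|dker M s - dker M t| <= 2 * M * M * `|s - t|.
Proof.
move=> M0; have NMM : - M <= M by rewrite ge0_cp.
rewrite /dker -RintegralB//; try exact/continuous_integrable/continuous_cosM.
have cF : continuous (fun u : R => cos (u * s) - cos (u * t)).
  by move=> u; apply: continuousB; exact: continuous_cosM.
rewrite -Rintegral_itv_obnd_cbnd; last exact: continuous_integrable_oc.
rewrite (_ : 2 * M * M * `|s - t| = M * `|s - t| * (M - - M)); last by ring.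
apply: Rintegral_bounded_le => //; first exact: continuous_integrable_oc.
move=> u Mu uM; apply: (le_trans (lip_cos _ _)).
rewrite mul1r -mulrBr normrM ler_wpM2r// ler_norml uM andbT; exact: ltW.
Qed.

Lemma lip_dker M : 0 <= M -> lip (dker M) (2 * M * M).
Proof. by move=> M0 s t; exact: dkerB_le. Qed.

Lemma dker_le M s : 0 <= M -> `|dker M s| <= 2 * M.
Proof.
move=> M0; have NMM : - M <= M by rewrite ge0_cp.
rewrite /dker -Rintegral_itv_obnd_cbnd; last exact/continuous_integrable_oc/continuous_cosM.
rewrite (_ : 2 * M = 1 * (M - - M)); last by ring.
apply: Rintegral_bounded_le => //; first exact/continuous_integrable_oc/continuous_cosM.
by move=> u _ _; exact: cos_max.
Qed.

Lemma dkerN M s : dker M (- s) = dker M s.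
Proof. by apply: eq_Rintegral => u _; rewrite mulrN cosN. Qed.

(** Away from 0 the factor 2 / s joins the decreasing function g, and the
    oscillation of sin(M x) gains a factor 1 / M. *)
Lemma Rintegral_decreasing_dker a b M g C : 0 < M -> 0 < a -> a <= b ->
  (forall s t, a < s -> s <= t -> t <= b -> g t <= g s) ->
  (forall s, a < s -> s <= b -> 0 <= g s) ->
  (forall s, a < s -> s <= b -> g s <= C) -> 0 <= C ->
  `|\int[mu]_(x in `]a, b]) (g x * dker M x)| <= 4 * C / (a * M).
Proof.
move=> M0 a0 ab gd g0 gC C0.
have -> : \int[mu]_(x in `]a, b]) (g x * dker M x) =
    \int[mu]_(x in `]a, b]) ((g x * (2 * x^-1)) * sin (M * x)).
  apply: eq_Rintegral => x /set_mem/=; rewrite in_itv/= => /andP[ax _].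
  by rewrite dker_sin ?mulrA// ?ltW// gt_eqF// (lt_trans a0).
rewrite (_ : 4 * C / (a * M) = (C * (2 * a^-1)) * (2 / M)); last first.
  by field; rewrite !gt_eqF.
apply: Rintegral_decreasing_sin => //.
- move=> s t as_ st tb; have s0 := lt_trans a0 as_; have t0 := lt_le_trans s0 st.
  apply: ler_pM => //.
  + by apply: g0 => //; exact: lt_le_trans st.
  + by rewrite mulr_ge0// invr_ge0 ltW.
  + exact: gd.
  + by rewrite ler_pM2l// lef_pV2.
- move=> s as_ sb; have s0 := lt_trans a0 as_.
  by rewrite mulr_ge0 ?g0// mulr_ge0// invr_ge0 ltW.
- move=> s as_ sb; have s0 := lt_trans a0 as_.
  apply: ler_pM; rewrite ?g0 ?gC//.
    by rewrite mulr_ge0// invr_ge0 ltW.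
  by rewrite ler_pM2l// lef_pV2// ltW.
- by rewrite !mulr_ge0// invr_ge0 ltW.
Qed.

Lemma dker_tail d x M : 0 < M -> 0 < d -> d <= x ->
  `|\int[mu]_(s in `]d, x]) dker M s| <= 4 / (d * M).
Proof.
move=> M0 d0 dx; have := @Rintegral_decreasing_dker d x M (fun=> 1) 1 M0 d0 dx.
rewrite mulr1; under eq_Rintegral do rewrite mul1r; exact.
Qed.

(** On ]0, 1 / M] the kernel is at most 2 M, which contributes at most 2; beyond
    1 / M the tail estimate contributes at most 4, for every M. *)
Lemma dker_int_le x M : 0 < M -> 0 <= x ->
  `|\int[mu]_(s in `]0, x]) dker M s| <= 6.
Proof.
move=> M0 x0; have iD a b := @lip_integrable R a b _ _ (lip_dker (ltW M0)).
have near0 y : 0 <= y -> y <= M^-1 -> `|\int[mu]_(s in `]0, y]) dker M s| <= 2.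
  move=> y0 yM; apply: (@le_trans _ _ (2 * M * (y - 0))).
    by apply: Rintegral_bounded_le => // s _ _; exact/dker_le/ltW.
  rewrite subr0 -mulrA ger_pMr// mulrC -ler_pdivlMr// mul1r; exact: yM.
have [xM|Mx] := leP x M^-1.
  by apply: le_trans (near0 x x0 xM) _; lra.
have M1 : 0 < M^-1 by rewrite invr_gt0.
rewrite (Rintegral_cat (ltW M1) (ltW Mx))//.
apply: (le_trans (ler_normD _ _)).
have := near0 _ (ltW M1) (lexx _); have := dker_tail M0 M1 (ltW Mx).
rewrite mulVf ?gt_eqF// divr1; lra.
Qed.

End dirichlet_kernel.

(** * The Riemann-Lebesgue lemma on the line and on the plane *)

Section dominated.
Context d (T : measurableType d) (R : realType) (mu : {measure set T -> \bar R}).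

Lemma Rdominated_cvg0 (f_ : nat -> T -> R) (g : T -> R) :
  (forall n, measurable_fun setT (f_ n)) ->
  {ae mu, forall x, f_ n x @[n --> \oo] --> 0} ->
  mu.-integrable setT (EFin \o g) ->
  {ae mu, forall x n, `|f_ n x| <= g x} ->
  \int[mu]_x f_ n x @[n --> \oo] --> 0.
Proof.
move=> mf f0 ig fg.
have [] := @dominated_convergence _ T R mu setT measurableT
  (fun n => EFin \o f_ n) (cst 0%E) (EFin \o g).
- by move=> n; exact/measurable_EFinP.
- exact: measurable_cst.
- by apply: filterS f0 => x fx _; apply: cvg_EFin fx; exact: nearW.
- exact: ig.
- by apply: filterS fg => x fx n _; rewrite /= lee_fin.
move=> _ _; rewrite integral0 => /fine_cvg; exact.
Qed.

Lemma le_Rintegrable (f g : T -> R) (D : set T) : measurable D ->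
  measurable_fun D f ->
  (forall x, D x -> `|f x| <= `|g x|) -> mu.-integrable D (EFin \o g) ->
  mu.-integrable D (EFin \o f).
Proof.
move=> mD mf fg; apply: le_integrable => //; first exact/measurable_EFinP.
Qed.

Lemma indic_integrable (f : T -> R) (D : set T) : measurable D ->
  mu.-integrable D (EFin \o f) ->
  mu.-integrable setT (EFin \o (fun x => \1_D x * f x)).
Proof. by move=> mD fi; have [h _] := integrable_indicP mu f mD; exact: h. Qed.

Lemma integrable_indic_restr (f : T -> R) (D : set T) : measurable D ->
  mu.-integrable setT (EFin \o (fun x => \1_D x * f x)) ->
  mu.-integrable D (EFin \o f).
Proof. by move=> mD fi; have [_ h] := integrable_indicP mu f mD; exact: h. Qed.

Lemma RintegrableB (f g : T -> R) (D : set T) : measurable D ->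
  mu.-integrable D (EFin \o f) -> mu.-integrable D (EFin \o g) ->
  mu.-integrable D (EFin \o (fun x => f x - g x)).
Proof. by move=> mD fi gi; apply: eq_integrable (integrableB mD fi gi) => //. Qed.

Lemma RintegrableD (f g : T -> R) (D : set T) : measurable D ->
  mu.-integrable D (EFin \o f) -> mu.-integrable D (EFin \o g) ->
  mu.-integrable D (EFin \o (fun x => f x + g x)).
Proof. by move=> mD fi gi; apply: eq_integrable (integrableD mD fi gi) => //. Qed.

Lemma RintegrableZ (f : T -> R) (c : R) (D : set T) : measurable D ->
  mu.-integrable D (EFin \o f) ->
  mu.-integrable D (EFin \o (fun x => c * f x)).
Proof. by move=> mD fi; apply: eq_integrable (integrableZl mD c fi) => //. Qed.

(** Multiplication by a bounded kernel, the two facts always being needed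
    together. *)
Lemma Rintegral_bounded_factor (f k : T -> R) (D : set T) : measurable D ->
  mu.-integrable D (EFin \o f) -> measurable_fun D k -> (forall x, `|k x| <= 1) ->
  mu.-integrable D (EFin \o (fun x => f x * k x)) /\
  `|\int[mu]_(x in D) (f x * k x)| <= \int[mu]_(x in D) `|f x|.
Proof.
move=> mD iF mk k1.
have mF : measurable_fun D f by have /measurable_int/measurable_EFinP := iF.
have fk x : `|f x * k x| <= `|f x| by rewrite normrM ler_piMr.
have iFk : mu.-integrable D (EFin \o (fun x => f x * k x)).
  by apply: le_Rintegrable iF => //; exact: measurable_funM.
split=> //; apply: le_trans (le_normr_Rintegral _ iFk) _ => //.
apply: le_Rintegral => //; exact: integrable_norm.
Qed.

End dominated.

Section riemann_lebesgue.
Context (R : realType).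
Notation mu := (@lebesgue_measure R).
Notation mu2 := (leb2 R).
Implicit Types (a b e h s t x M N : R) (F f g : R -> R).

(** Heine's theorem, in a form where only one of the two points has to lie in
    the interval. *)
Lemma uniform_continuity_itv f a b e : continuous f -> 0 < e ->
  exists2 d : R, 0 < d & forall x y, a <= x -> x <= b -> `|x - y| < d ->
    `|f x - f y| <= e.
Proof.
move=> cf e0.
have /compact_near_coveringP ncK := @segment_compact R a b.
pose P (d : R) (x : R) := forall y, `|x - y| < d -> `|f x - f y| <= e.
have H : \forall d \near (0:R)^'+, `[a, b] `<=` P d.
  apply: (ncK R (0:R)^'+ P) => x _.
  have e2 : 0 < e / 2 by rewrite divr_gt0.
  have /cvgrPdist_lt/(_ _ e2)[eta /= eta0 etaP] := cf x.
  exists (ball x (eta / 2), [set d | d < eta / 2]) => /=.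
    split; first by apply: nbhsx_ballx; rewrite divr_gt0.
    by apply: nbhs_right_lt; rewrite divr_gt0.
  move=> [x' d] /= [xx' dd] y x'y.
  have A1 : `|f x - f x'| < e / 2.
    by apply: etaP; apply: lt_le_trans xx' _; rewrite ler_pdivrMr// ler_peMr//; [exact: ltW|lra].
  have A2 : `|f x - f y| < e / 2.
    apply: etaP; rewrite /ball_/= -(subrK x' x) -addrA.
    apply: le_lt_trans (ler_normD _ _) _.
    rewrite (splitr eta); apply: ltrD => //; exact: lt_trans dd.
  rewrite -(subrK (f x) (f x')) -addrA; apply: le_trans (ler_normD _ _) _.
  by rewrite (splitr e) distrC lerD// ltW.
have [d [d0 dP]] : exists d, 0 < d /\ `[a, b] `<=` P d.
  have : \forall d \near (0:R)^'+, 0 < d /\ `[a, b] `<=` P d.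
    by near=> d; split; [near: d; exact: nbhs_right_gt|near: d].
  by move=> /filter_ex[d dP]; exists d.
exists d => // x y ax xb xy; apply: (dP x) => //.
by rewrite /= in_itv/= ax.
Unshelve. all: by end_near. Qed.

Lemma continuous_shift f (c : R) : continuous f -> continuous (fun t : R => f (c + t)).
Proof.
move=> cf t; apply: (@continuous_comp _ _ _ (fun t : R => c + t) f); last exact: cf.
by apply: cvgD; [exact: cvg_cst|exact: cvg_id].
Qed.

Lemma continuous_mulR f g : continuous f -> continuous g ->
  continuous (fun t : R => f t * g t).
Proof. by move=> cf cg t; apply: cvgM; [exact: cf|exact: cg]. Qed.

Lemma continuous_subR f g : continuous f -> continuous g ->
  continuous (fun t : R => f t - g t).
Proof. by move=> cf cg t; apply: cvgB; [exact: cf|exact: cg]. Qed.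

Lemma continuous_cstR (c : R) : continuous (fun _ : R => c).
Proof. by move=> t; exact: cvg_cst. Qed.

(** Freeze f at the left end of each cell of a grid on which f oscillates little;
    the integral of the sine over a cell is at most 2 / M, and the number of
    cells does not depend on M. *)
Lemma RL_continuous f a b e : a < b -> continuous f -> 0 < e ->
  \forall M \near +oo, `|\int[mu]_(x in `]a, b]) (f x * sin (M * x))| <= e.
Proof.
move=> ab cf e0.
have ba : 0 < b - a by rewrite subr_gt0.
(* The oscillation of f on a cell may not exceed e'; the whole interval then
   contributes at most e / 2. *)
pose e' := e / 2 / (b - a).
have e'0 : 0 < e' by rewrite !divr_gt0.
have [d d0 dP] := @uniform_continuity_itv f a b e' cf e'0.
have [n nd] : exists n : nat, (b - a) / d < n.+1%:R.
  by exists (Num.truncn ((b - a) / d)); exact: truncnS_gt.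
set m := n.+1; pose h := (b - a) / m%:R.
have m0 : 0 < m%:R :> R by rewrite ltr0n.
have h0 : 0 < h by rewrite divr_gt0.
have hd : h < d by rewrite ltr_pdivrMr// mulrC -ltr_pdivrMr.
have mh : m%:R * h = b - a by rewrite mulrC divfK// gt_eqF.
have bE : b = a + m%:R * h by rewrite mh addrC subrK.
pose S : R := \sum_(i < m) `|f (a + i%:R * h)|.
have S0 : 0 <= S by apply: sumr_ge0.
near=> M.
have M0 : 0 < M by near: M; apply: nbhs_pinfty_gt; rewrite num_real.
have csin : continuous (fun x : R => sin (M * x)).
  exact: (lip_continuous (lip_scale M ler01 (@lip_sin R))).
have cfs : continuous (fun x : R => f x * sin (M * x)).
  exact: continuous_mulR.
have iF' : mu.-integrable `]a, a + m%:R * h] (EFin \o (fun x => f x * sin (M * x))).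
  exact: continuous_integrable_oc.
rewrite [X in `]a, X]](bE) (Rintegral_cells (ltW h0) iF').
apply: le_trans (ler_norm_sum _ _ _) _.
apply: (@le_trans _ _ (\sum_(i < m) (e' * h + `|f (a + i%:R * h)| * (2 / M)))); last first.
  rewrite big_split/= sumr_const card_ord -mulr_suml -/S -[X in X + _]mulr_natl.
  rewrite (_ : m%:R * (e' * h) = e / 2); last first.
    by rewrite mulrCA mh /e' divfK// gt_eqF.
  rewrite [leRHS](splitr e) lerD2l mulrA ler_pdivrMr// [S * 2]mulrC -ler_pdivrMl; last by rewrite divr_gt0.
  by near: M; apply: nbhs_pinfty_ge; rewrite num_real.
apply: ler_sum => i _.
have im : a + i%:R * h <= b.
  by rewrite bE lerD2l ler_wpM2r// ?(ltW h0)// ler_nat ltnW.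
have ia : a <= a + i%:R * h by rewrite lerDl mulr_ge0// ltW.
have csh : continuous (fun t : R => sin (M * (a + i%:R * h + t))).
  exact: (continuous_shift csin).
have cfh : continuous (fun t : R => f (a + i%:R * h + t)).
  exact: (continuous_shift cf).
have cd : continuous (fun t : R => (f (a + i%:R * h + t) - f (a + i%:R * h)) * sin (M * (a + i%:R * h + t))).
  apply: continuous_mulR csh.
  exact: (continuous_subR cfh (@continuous_cstR _)).
have -> : \int[mu]_(s in `]0, h]) (f (a + i%:R * h + s) * sin (M * (a + i%:R * h + s))) =
  \int[mu]_(s in `]0, h]) ((f (a + i%:R * h + s) - f (a + i%:R * h)) * sin (M * (a + i%:R * h + s))) +
  f (a + i%:R * h) * \int[mu]_(s in `]0, h]) sin (M * (a + i%:R * h + s)).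
  rewrite -RintegralZl//; last exact: continuous_integrable_oc.
  rewrite -RintegralD//; last 2 first.
  - exact: continuous_integrable_oc.
  - apply: continuous_integrable_oc; apply: continuous_mulR csh.
    exact: continuous_cstR.
  by apply: eq_Rintegral => s _; ring.
apply: le_trans (ler_normD _ _) _; apply: lerD.
  rewrite -[X in e' * X]subr0; apply: Rintegral_bounded_le; first exact: ltW.
    exact: continuous_integrable_oc.
  move=> t t0 th; rewrite normrM -[leRHS]mulr1; apply: ler_pM => //.
    rewrite distrC; apply: dP => //.
    by rewrite opprD addrA subrr add0r normrN gtr0_norm// (le_lt_trans th).
  exact: sin_max.
rewrite normrM ler_wpM2l//.
have := @Rintegral_shift _ 0 h (a + i%:R * h) (fun x => sin (M * x)).
move=> /(_ (continuous_integrable_oc _ _ csin))[_ ->].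
by apply: Rintegral_sin_le => //; rewrite lerD2l ltW.
Unshelve. all: by end_near. Qed.

(** Dominated convergence, the intervals exhausting the line. *)
Lemma integrable_tail F e : mu.-integrable setT (EFin \o F) -> 0 < e ->
  exists2 n : nat, (0 < n)%N &
    \int[mu]_x (\1_(~` `]- n%:R, n%:R]%classic) x * `|F x|) <= e.
Proof.
move=> iF e0.
have iA := integrable_norm iF.
pose E n : set (measurableTypeR R) := ~` `]- n%:R, n%:R]%classic.
have mE n : measurable (E n) by apply: measurableC.
have /cvgrPdist_le/(_ _ e0) : \int[mu]_x (\1_(E n) x * `|F x|) @[n --> \oo] --> 0.
  apply: (@Rdominated_cvg0 _ _ _ mu (fun n x => \1_(E n) x * `|F x|) (fun x => `|F x|)).
  - move=> n; apply: measurable_funM; first exact: measurable_indic.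
    by have /measurable_int/measurable_EFinP := iA.
  - apply: aeW => x; apply: cvg_near_cst; near=> n.
    rewrite indicE memNset ?mul0r//= => nx; apply: nx.
    have xn : `|x| < n%:R by near: n; exact: nbhs_infty_gtr.
    by move: xn; rewrite /= in_itv/= ltr_norml => /andP[-> /ltW].
  - exact: iA.
  - apply: aeW => x n; rewrite indicE.
    by rewrite normrM normr_id ler_piMl//; case: (_ \in _); rewrite ?normr1 ?normr0.
move=> H; have [n [n0]] := filter_ex (filterI (nbhs_infty_gt 0) H).
rewrite sub0r normrN => nE; exists n => //.
exact: le_trans (ler_norm _) nE.
Unshelve. all: by end_near. Qed.

(** Continuous functions approximate F in mean on a bounded interval outside of
    which the mass of F is small. *)
Lemma riemann_lebesgue F e : mu.-integrable setT (EFin \o F) -> 0 < e ->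
  \forall M \near +oo, `|\int[mu]_x (F x * sin (M * x))| <= e.
Proof.
move=> iF e0.
have e4 : 0 < e / 4 by rewrite divr_gt0.
have [n n0 nE] := integrable_tail iF e4.
pose E : set (measurableTypeR R) := `]- n%:R, n%:R]%classic.
have mE : measurable E by exact: measurable_itv.
have iFE : mu.-integrable E (EFin \o F) by apply: integrableS iF.
have muE : (mu E < +oo)%E.
  by rewrite /E /= lebesgue_measure_itv/=; case: ifP => _; rewrite ?ltry// -EFinD ltry.
have [G_ [cG iG GF]] := approximation_continuous_integrable mE muE iFE.
have [k kE] : exists k, \int[mu]_(x in E) `|F x - G_ k x| <= e / 4.
  have /fine_cvg/cvgrPdist_le/(_ _ e4) := GF.
  move=> /filter_ex[k]; rewrite sub0r normrN => kE; exists k.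
  exact: le_trans (ler_norm _) kE.
have nn : - n%:R < n%:R :> R by rewrite gtrN// ltr0n.
have := RL_continuous nn (cG k) e4; apply: filterS => M GM.
have csin := lip_continuous (lip_scale M ler01 (@lip_sin R)).
have msin (D : set R) : measurable_fun D (fun x => sin (M * x)).
  by apply: measurable_funTS; exact: continuous_measurable_fun.
have sin1 x : `|sin (M * x)| <= 1 by exact: sin_max.
have iD : mu.-integrable E (EFin \o (fun x => F x - G_ k x)).
  exact: RintegrableB.
have iF' : mu.-integrable setT (EFin \o (fun x => \1_(~` E) x * F x)).
  apply: indic_integrable; first exact: measurableC.
  by apply: integrableS iF => //; exact: measurableC.
have [iDs Ds] := Rintegral_bounded_factor mE iD (msin _) sin1.
have [iFs Fs] := Rintegral_bounded_factor measurableT iF' (msin _) sin1.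
have [iFs' _] := Rintegral_bounded_factor mE iFE (msin _) sin1.
have [iGs' _] := Rintegral_bounded_factor mE (iG k) (msin _) sin1.
have -> : \int[mu]_x (F x * sin (M * x)) =
  \int[mu]_(x in E) (G_ k x * sin (M * x)) +
  \int[mu]_(x in E) ((F x - G_ k x) * sin (M * x)) +
  \int[mu]_x (\1_(~` E) x * F x * sin (M * x)).
  rewrite -RintegralD// [X in _ = X + _]Rintegral_indic -RintegralD//; last first.
    by apply: indic_integrable => //; exact: RintegrableD.
  apply: eq_Rintegral => x _; rewrite !indicE in_setC.
  by case: (x \in E) => /=; ring.
apply: le_trans (ler_normD _ _) _.
have -> : e = e / 4 + e / 4 + e / 2 by field.
apply: lerD.
  apply: le_trans (ler_normD _ _) _; apply: lerD; first exact: GM.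
  exact: le_trans Ds kE.
apply: le_trans Fs _; apply: le_trans (_ : e / 4 <= _); last by lra.
apply: le_trans nE; rewrite le_eqVlt; apply/orP; left; apply/eqP.
by apply: eq_Rintegral => x _; rewrite normrM ger0_norm// indicE.
Qed.

(** For almost every x the section integrates to 0 in the limit, by the
    one-dimensional lemma; dominated convergence then shows that the integral
    over x of the absolute values of these section integrals tends to 0.  This
    quantity does not involve k, whence the uniformity in k, which is what
    allows M to go to infinity independently of N. *)
Lemma riemann_lebesgue2 (F : R * R -> R) e : mu2.-integrable setT (EFin \o F) -> 0 < e ->
  \forall N \near +oo, forall k : R -> R, measurable_fun setT k ->
    (forall x, `|k x| <= 1) ->
    `|\int[mu2]_z (F z * (k z.1 * sin (N * z.2)))| <= e.
Proof.
move=> iF e0.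
have msinN N : measurable_fun setT (fun x : R => sin (N * x)).
  apply: continuous_measurable_fun.
  exact: (lip_continuous (lip_scale N ler01 (@lip_sin R))).
have msin2 N : measurable_fun setT (fun z : R * R => sin (N * z.2)).
  exact: (measurableT_comp (msinN N) measurable_snd).
have iFs N := (Rintegral_bounded_factor measurableT iF (msin2 N) (fun z => sin_max _)).1.
(* The part of the integral that no factor k of absolute value at most 1 can
   increase. *)
pose r N := \int[mu]_x `|\int[mu]_y (F (x, y) * sin (N * y))|.
have rE N : mu.-integrable setT (EFin \o (fun x => \int[mu]_y (F (x, y) * sin (N * y)))).
  exact: integrable_Rfubini1 (iFs N).
have iA := integrable_Rfubini1 (integrable_norm iF).
have r0 : r N @[N --> +oo] --> 0.
  apply/cvg_pinftyP => u uoo.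
  apply: (@Rdominated_cvg0 _ _ _ mu _ (fun x => \int[mu]_y `|F (x, y)|)).
  - move=> n; apply: measurableT_comp => //.
    by have /measurable_int/measurable_EFinP := rE (u n).
  - apply: filterS (ae_integrable1 iF) => x ix.
    apply/cvgrPdist_le => e1 e10.
    have H := uoo _ (riemann_lebesgue ix e10); near=> n.
    by rewrite sub0r normrN normr_id; near: n; exact: H.
  - exact: iA.
  - apply: filterS (ae_integrable1 iF) => x ix n; rewrite normr_id.
    by have [] := Rintegral_bounded_factor measurableT ix (msinN (u n)) (fun y => sin_max _).
move/cvgrPdist_le : r0 => /(_ _ e0); apply: filterS => N rN k mk k1.
have mk2 : measurable_fun setT (fun z : R * R => k z.1).
  exact: (measurableT_comp mk measurable_fst).
have [iH _] := Rintegral_bounded_factor measurableT (iFs N) mk2 (fun z => k1 z.1).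
have iH' : mu2.-integrable setT (EFin \o (fun z => F z * (k z.1 * sin (N * z.2)))).
  apply: eq_integrable iH => // z _ /=; congr EFin; ring.
rewrite (Rintegral_fubini1 iH').
have -> : \int[mu]_x \int[mu]_y (F (x, y) * (k x * sin (N * y))) =
  \int[mu]_x ((\int[mu]_y (F (x, y) * sin (N * y))) * k x).
  apply: ae_Rintegral_eq; apply: filterS (ae_integrable1 (iFs N)) => x ix.
  by rewrite -RintegralZr//; apply: eq_Rintegral => y _ /=; ring.
apply: le_trans (Rintegral_bounded_factor measurableT (rE N) mk k1).2 _.
by move: rN; rewrite sub0r normrN; apply: le_trans; exact: ler_norm.
Unshelve. all: by end_near. Qed.

End riemann_lebesgue.

(** * Dirichlet's integral *)

Section rectangles.
Context (R : realType).
Notation mu := (@lebesgue_measure R).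
Notation mu2 := (leb2 R).
Implicit Types (Bd : R) (F : R * R -> R) (A B : set (measurableTypeR R)).

Lemma measurable_invr : measurable_fun setT (fun x : R => x^-1).
Proof.
rewrite -(setvU [set (0:R)]); apply/measurable_funU => //.
  by apply: measurableC.
split; last exact: measurable_fun_set1.
apply: open_continuous_measurable_fun.
  by have := @open_neq R 0; rewrite (_ : [set x | x != 0] = ~` [set 0])//; apply/seteqP; split => x /= /eqP.
by move=> x /set_mem/= /eqP x0; apply: cvgV => //; exact: cvg_id.
Qed.

Lemma integrable_rect A B F Bd : measurable A -> measurable B ->
  (mu A < +oo)%E -> (mu B < +oo)%E -> measurable_fun setT F ->
  (forall z, A z.1 -> B z.2 -> `|F z| <= Bd) ->
  mu2.-integrable setT (EFin \o (fun z => \1_A z.1 * \1_B z.2 * F z)).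
Proof.
move=> mA mB Aoo Boo mF FB.
have mAB : measurable (A `*` B) by exact: measurableX.
have -> : (fun z => \1_A z.1 * \1_B z.2 * F z) = (fun z => \1_(A `*` B) z * F z).
  apply/funext => -[x y]; congr (_ * _); rewrite !indicE in_setX/=.
  by case: (x \in A); case: (y \in B); rewrite ?mulr1 ?mulr0.
apply: indic_integrable => //; apply: measurable_bounded_integrable => //.
- apply: (@le_lt_trans _ _ (mu A * mu B)%E).
    by rewrite le_eqVlt; apply/orP; left; apply/eqP; exact: product_measure1E.
  by apply: lte_mul_pinfty => //; rewrite ge0_fin_numE.
- exact: measurable_funTS.
- exists Bd; split; first exact: num_real.
  by move=> r Br z [z1 z2]; apply: le_trans (ltW Br); exact: FB.
Qed.

(** Iterated integrals over a rectangle; the indicators carry the rectangle so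
    that Fubini's theorem is applied on the whole plane. *)
Lemma Rintegral_rect1 A B F :
  mu2.-integrable setT (EFin \o (fun z => \1_A z.1 * \1_B z.2 * F z)) ->
  \int[mu2]_z (\1_A z.1 * \1_B z.2 * F z) =
  \int[mu]_(x in A) \int[mu]_(y in B) F (x, y).
Proof.
move=> iF; rewrite (Rintegral_fubini1 iF) [RHS]Rintegral_indic.
apply: eq_Rintegral => x _ /=; rewrite indicE; case: (x \in A).
  by rewrite [RHS]mul1r [RHS]Rintegral_indic; apply: eq_Rintegral => y _; rewrite mul1r.
rewrite [RHS]mul0r -[RHS](@mul0r _ (fine (mu setT))) -Rintegral_cst//.
by apply: eq_Rintegral => y _; rewrite !mul0r.
Qed.

Lemma Rintegral_rect2 A B F :
  mu2.-integrable setT (EFin \o (fun z => \1_A z.1 * \1_B z.2 * F z)) ->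
  \int[mu2]_z (\1_A z.1 * \1_B z.2 * F z) =
  \int[mu]_(y in B) \int[mu]_(x in A) F (x, y).
Proof.
move=> iF; rewrite (Rintegral_fubini2 iF) [RHS]Rintegral_indic.
apply: eq_Rintegral => y _ /=; rewrite [\1_B y]indicE; case: (y \in B).
  by rewrite [RHS]mul1r [RHS]Rintegral_indic; apply: eq_Rintegral => x _; rewrite mulr1.
rewrite [RHS]mul0r -[RHS](@mul0r _ (fine (mu setT))) -Rintegral_cst//.
by apply: eq_Rintegral => x _; rewrite mulr0 mul0r.
Qed.

End rectangles.

Section dirichlet_integral.
Context (R : realType).
Notation mu := (@lebesgue_measure R).
Implicit Types (d e s t u x M N : R).

Lemma mu_itv_oc_lty (a b : R) : (mu `]a, b] < +oo)%E.
Proof.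
by rewrite /= lebesgue_measure_itv/=; case: ifP => _; rewrite ?ltry// -EFinD ltry.
Qed.

Lemma mu_itv_cc_lty (a b : R) : (mu `[a, b] < +oo)%E.
Proof.
by rewrite /= lebesgue_measure_itv/=; case: ifP => _; rewrite ?ltry// -EFinD ltry.
Qed.

Lemma den_gt0 u : 0 < 1 + u ^+ 2. Proof. by rewrite ltr_wpDr// sqr_ge0. Qed.

Lemma Rintegral_expcos u M : 0 <= M ->
  \int[mu]_(s in `]0, M]) (expR (- s) * cos (u * s)) =
  (1 + expR (- M) * (u * sin (u * M) - cos (u * M))) * (1 + u ^+ 2)^-1.
Proof.
move=> M0; have u0 : 1 + u ^+ 2 != 0 by rewrite gt_eqF// den_gt0.
pose F (s : R) := expR (- s) * (u * sin (u * s) - cos (u * s)) * (1 + u ^+ 2)^-1.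
have cf : continuous (fun s : R => expR (- s) * cos (u * s)).
  apply: continuous_mulR.
    move=> s; apply: continuous_comp; last exact: continuous_expR.
    exact: opp_continuous.
  exact: (lip_continuous (lip_scale u ler01 (@lip_cos R))).
have dF (s : R) : is_derive s (1:R) F (expR (- s) * cos (u * s)).
  by apply: is_derive_eq; rewrite /GRing.scale/=; field.
rewrite (FTC_oc M0 cf dF) /F oppr0 expR0 !mulr0 sin0 cos0; field.
exact: u0.
Qed.

Lemma continuous_den : continuous (fun u : R => (1 + u ^+ 2)^-1).
Proof.
move=> u; apply: cvgV; first by rewrite gt_eqF// den_gt0.
apply: cvgD; first exact: cvg_cst.
exact: exprn_continuous.
Qed.

(** Exchange the integrals over s and u: the integral of exp(-s) cos(u s) over s
    in ]0, M] is 1 / (1 + u^2) up to terms of size exp(-M), and 1 / (1 + u^2) has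
    the primitive atan. *)
Lemma Rintegral_expdker M : 0 < M ->
  `|\int[mu]_(s in `]0, M]) (expR (- s) * dker M s) - 2 * atan M| <=
  4 * M * expR (- M).
Proof.
move=> M0.
pose A : set (measurableTypeR R) := `]0, M]%classic.
pose B : set (measurableTypeR R) := `[- M, M]%classic.
pose F (z : R * R) := expR (- z.1) * cos (z.2 * z.1).
have mF : measurable_fun setT F.
  apply: measurable_funM.
    apply: (measurableT_comp (continuous_measurable_fun (@continuous_expR R))).
    by apply: measurableT_comp => //; exact: measurable_fst.
  apply: (measurableT_comp (continuous_measurable_fun (@continuous_cos R))).
  by apply: measurable_funM; [exact: measurable_snd|exact: measurable_fst].
have mA : measurable A by exact: measurable_itv.
have mB : measurable B by exact: measurable_itv.
have F1 (z : measurableTypeR R * measurableTypeR R) : A z.1 -> B z.2 -> `|F z| <= 1.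
  case: z => s u; rewrite /A /B /F/= !in_itv/= => /andP[s0 _] _.
  rewrite normrM -[leRHS]mulr1 ler_pM// ?cos_max//.
  by rewrite ger0_norm ?expR_ge0// expR_le1 oppr_le0 ltW.
have iF := integrable_rect mA mB (mu_itv_oc_lty 0 M) (mu_itv_cc_lty (- M) M) mF F1.
have -> : \int[mu]_(s in `]0, M]) (expR (- s) * dker M s) =
  \int[mu]_(u in B) ((1 + expR (- M) * (u * sin (u * M) - cos (u * M))) * (1 + u ^+ 2)^-1).
  transitivity (\int[mu]_(s in A) \int[mu]_(u in B) F (s, u)).
    apply: eq_Rintegral => s _; rewrite /F/= RintegralZl//.
    exact/continuous_integrable/continuous_cosM.
  rewrite -(Rintegral_rect1 iF) (Rintegral_rect2 iF); apply: eq_Rintegral => u _.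
  by rewrite /F/= Rintegral_expcos// ltW.
have NMM : - M <= M by rewrite ge0_cp// ltW.
have csin : continuous (fun u : R => u * sin (u * M)).
  apply: continuous_mulR; first by move=> ?; exact: cvg_id.
  under eq_fun do rewrite mulrC.
  exact: (lip_continuous (lip_scale M ler01 (@lip_sin R))).
have ccos := @continuous_cosM R M.
have cE : continuous (fun u : R => (u * sin (u * M) - cos (u * M)) * (1 + u ^+ 2)^-1).
  by apply: continuous_mulR (@continuous_den); exact: continuous_subR.
have -> : \int[mu]_(u in B) ((1 + expR (- M) * (u * sin (u * M) - cos (u * M))) * (1 + u ^+ 2)^-1) =
   2 * atan M + expR (- M) * \int[mu]_(u in B) ((u * sin (u * M) - cos (u * M)) * (1 + u ^+ 2)^-1).
  rewrite -RintegralZl//; last exact: continuous_integrable.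
  have -> : 2 * atan M = \int[mu]_(u in B) (1 + u ^+ 2)^-1.
    rewrite (FTC_cc NMM (@continuous_den) (@is_derive1_atan R)) atanN; ring.
  rewrite -RintegralD//; last 2 first.
  - exact: (continuous_integrable _ _ (@continuous_den)).
  - apply: continuous_integrable; apply: continuous_mulR cE.
    exact: continuous_cstR.
  by apply: eq_Rintegral => u _; ring.
rewrite addrAC subrr add0r normrM (ger0_norm (expR_ge0 _)) mulrC ler_wpM2r ?expR_ge0//.
rewrite /B -Rintegral_itv_obnd_cbnd; last exact: continuous_integrable_oc.
rewrite (_ : 4 * M = 2 * (M - - M)); last by ring.
apply: Rintegral_bounded_le => //; first exact: continuous_integrable_oc.
move=> u _ _; rewrite normrM (ger0_norm (ltW (_ : 0 < (1 + u ^+ 2)^-1))) ?invr_gt0 ?den_gt0//.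
rewrite ler_pdivrMr ?den_gt0//; apply: le_trans (ler_normB _ _) _.
have h1 : `|u * sin (u * M)| <= `|u| by rewrite normrM ler_piMr// sin_max.
have h2 := cos_max (u * M).
have h3 : 0 <= (`|u| - 1) ^+ 2 by exact: sqr_ge0.
have h4 : `|u| ^+ 2 = u ^+ 2 by rewrite real_normK// num_real.
rewrite -h4; have h5 := normr_ge0 u; nra.
Qed.

(** Dirichlet's integral by damping.  The kernel minus exp(-s) times the kernel
    is (1 - exp(-s)) (2 / s) sin(M s), an integrable function times a sine, so
    that its integral tends to 0.  The damped kernel integrates over ]0, M] to
    2 atan M up to a small error, and 2 atan M tends to pi; its part over ]d, M]
    is a tail with a decreasing weight, of size 1 / M. *)
Lemma dker_limit d e : 0 < d -> 0 < e ->
  \forall M \near +oo, `|\int[mu]_(s in `]0, d]) dker M s - pi| <= e.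
Proof.
move=> d0 e0; have e4 : 0 < e / 4 by rewrite divr_gt0.
(* G sin(M s) is the undamped minus the damped kernel on ]0, d]; G is bounded
   by 2 because 1 - exp(-s) <= s. *)
pose G s := \1_(`]0, d]%classic : set (measurableTypeR R)) s * ((1 - expR (- s)) * (2 * s^-1)).
have cex : continuous (fun s : R => expR (- s)).
  by move=> s; apply: continuous_comp; [exact: opp_continuous|exact: continuous_expR].
have mexp := continuous_measurable_fun cex.
have iG : mu.-integrable setT (EFin \o G).
  apply: indic_integrable => //; apply: (@integrable_bounded _ _ _ _ 2).
    apply: measurable_funTS; apply: measurable_funM; first exact: measurable_funB.
    by apply: measurable_funM => //; exact: measurable_invr.
  move=> s s0 sd; rewrite ger0_norm; last first.
    rewrite mulr_ge0// ?subr_ge0 ?expR_le1 ?oppr_le0 ?(ltW s0)//.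
    by rewrite mulr_ge0// invr_ge0 ltW.
  rewrite mulrCA ger_pMr// ler_pdivrMr// mul1r.
  by have := expR_ge1Dx (- s); lra.
have RL := riemann_lebesgue iG e4.
have /cvgrPdist_le/(_ (e / 8)) : (@atan R) x @[x --> +oo] --> pi / 2 by exact: cvgy_atan.
have e8 : 0 < e / 8 by rewrite divr_gt0.
move=> /(_ e8) AT.
near=> M.
have M0 : 0 < M by near: M; apply: nbhs_pinfty_gt; rewrite num_real.
have dM : d <= M by near: M; apply: nbhs_pinfty_ge; rewrite num_real.
have H1 := Rintegral_expdker M0.
have H2 : `|pi / 2 - atan M| <= e / 8 by near: M.
have H3 : `|\int[mu]_x (G x * sin (M * x))| <= e / 4 by near: M.
have H4 : `|\int[mu]_(x in `]d, M]) (expR (- x) * dker M x)| <= e / 4.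
  apply: (@le_trans _ _ (4 * 1 / (d * M))).
    apply: Rintegral_decreasing_dker => //.
    - by move=> s t _ st _; rewrite ler_expR lerN2.
    - by move=> s ds _; rewrite expR_le1 oppr_le0 ltW// (lt_trans d0).
  rewrite mulr1 ler_pdivrMr ?mulr_gt0// mulrA -ler_pdivrMl; last by rewrite mulr_gt0.
  by near: M; apply: nbhs_pinfty_ge; rewrite num_real.
have H5 : 4 * M * expR (- M) <= e / 4.
  rewrite expRN ler_pdivrMr ?expR_gt0//.
  have : 1 + M ^+ 2 / 2`!%:R <= expR M by apply: expR_ge1Dxn; exact: ltW.
  rewrite (_ : 2`!%:R = 2)// => E1.
  have E2 : 32 / e <= M by near: M; apply: nbhs_pinfty_ge; rewrite num_real.
  have E3 : 32 <= e * M by rewrite mulrC -ler_pdivrMr.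
  have E4 : e / 4 * (M ^+ 2 / 2) <= e / 4 * expR M by rewrite ler_wpM2l ?(ltW e4)//; lra.
  by apply: le_trans E4; rewrite expr2; nra.
have L := lip_dker (ltW M0).
have ie a b : mu.-integrable `]a, b] (EFin \o (fun s => expR (- s) * dker M s)).
  by apply: continuous_integrable_oc; exact: continuous_mulR (lip_continuous L).
have iD a b : mu.-integrable `]a, b] (EFin \o (fun s => dker M s)).
  by apply: continuous_integrable_oc; exact: (lip_continuous L).
have E : \int[mu]_(s in `]0, d]) dker M s =
   \int[mu]_(s in `]0, M]) (expR (- s) * dker M s)
   - \int[mu]_(x in `]d, M]) (expR (- x) * dker M x)
   + \int[mu]_x (G x * sin (M * x)).
  rewrite (Rintegral_cat (ltW d0) dM)// addrK.
  have -> : \int[mu]_x (G x * sin (M * x)) =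
     \int[mu]_(x in `]0, d]) (dker M x - expR (- x) * dker M x).
    rewrite [RHS]Rintegral_indic; apply: eq_Rintegral => x _; rewrite /G !indicE.
    have [/set_mem/=|_] := boolP (x \in _); last by rewrite !mul0r.
    rewrite in_itv/= => /andP[x0 _].
    by rewrite dker_sin ?ltW// ?gt_eqF//=; ring.
  by rewrite RintegralB//; ring.
rewrite E; move: H1 H2 H3 H4; rewrite !ler_norml => /andP[? ?] /andP[? ?] /andP[? ?] /andP[? ?].
by apply/andP; split; lra.
Unshelve. all: by end_near. Qed.

End dirichlet_integral.

(** * Curves of bounded variation and the limit at a corner *)

#[global] Instance pinfty2_proper (R : realType) : ProperFilter (pinfty2 R).
Proof. exact: filter_prod_proper. Qed.

#[global] Instance corner_proper (R : realType) : ProperFilter (corner R).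
Proof. exact: filter_prod_proper. Qed.

(** Difference of two integrals from 0. *)
Lemma dker_int_le12 (R : realType) (N c t : R) : 0 < N -> 0 <= c -> c <= t ->
  `|\int[lebesgue_measure]_(u in `]c, t]) dker N u| <= 12.
Proof.
move=> N0 c0 ct.
have A6 := dker_int_le N0 (le_trans c0 ct); have B6 := dker_int_le N0 c0.
rewrite (Rintegral_cat c0 ct (lip_integrable 0 t (lip_dker (ltW N0)))) in A6.
have aux (u v : R) : `|u| <= 6 -> `|u + v| <= 6 -> `|v| <= 12.
  by rewrite !ler_norml => /andP[? ?] /andP[? ?]; apply/andP; split; lra.
exact: aux B6 A6.
Qed.

Lemma mul_pi2_approx (R : realType) (L u v q : R) :
  `|u| <= 6 -> `|u - pi| <= q -> `|v - pi| <= q ->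
  `|L * u * v - pi ^+ 2 * L| <= `|L| * (10 * q).
Proof.
move=> u6 uq vq.
have -> : L * u * v - pi ^+ 2 * L = L * (u * (v - pi) + pi * (u - pi)) by ring.
rewrite normrM; apply: ler_wpM2l => //; apply: le_trans (ler_normD _ _) _.
rewrite !normrM.
have pi4 : `|pi : R| <= 4.
  rewrite ger0_norm ?pi_ge0//; have [/andP[_ h] _] := @pihalf_02_cos_pihalf R.
  by move: h; rewrite ler_pdivrMr//; lra.
have -> : 10 * q = 6 * q + 4 * q by ring.
by apply: lerD; apply: ler_pM.
Qed.

Lemma sum4_approx (R : realType) (i1 i2 i3 u v e : R) :
  `|i1| <= e / 2 -> `|i2| <= e / 8 -> `|i3| <= e / 8 -> `|u - v| <= e / 4 ->
  `|i1 + i2 + i3 + u - v| <= e.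
Proof.
rewrite !ler_norml => /andP[? ?] /andP[? ?] /andP[? ?] /andP[? ?].
by apply/andP; split; lra.
Qed.

Section bv_curves.
Context (R : realType).
Notation mu := (@lebesgue_measure R).
Implicit Types (a b c d e s t r A C L K M N : R) (f g k : R -> R) (D : R -> R -> R)
  (x y : nat -> R) (phi psi : R -> R -> R).

Lemma strict_net_cat a b c n x m y : b < c ->
  strict_net a b n x -> strict_net b c m y ->
  exists z, strict_net a c (n.+1 + m) z /\
    forall D, \sum_(i < n.+1 + m) D (z i) (z i.+1) =
      \sum_(i < n) D (x i) (x i.+1) + D (x n) (y 0%N) +
      \sum_(i < m) D (y i) (y i.+1).
Proof.
move=> bc [x1 x2] [y1 y2].
pose z i := if (i <= n)%N then x i else y (i - n.+1)%N.
have zx i : (i <= n)%N -> z i = x i by rewrite /z => ->.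
have zy i : z (n.+1 + i)%N = y i.
  by rewrite /z addSn ltnNge leq_addr/= -addSn addKn.
have zn : z n.+1 = y 0%N by rewrite -zy addn0.
exists z; split; last first.
  move=> D; rewrite big_split_ord/=; congr (_ + _).
    rewrite big_ord_recr/= zx// zn; congr (_ + _).
    by apply: eq_bigr => i _; rewrite !zx// ltnW.
  by apply: eq_bigr => i _; rewrite -addnS !zy.
split=> i im.
  have [ni|ni] := leqP i n.
    by rewrite zx//; have [h1 h2] := x1 i ni; split=> //; rewrite (le_trans h2)// ltW.
  have -> : i = (n.+1 + (i - n.+1))%N by rewrite subnKC.
  have /y1 : (i - n.+1 <= m)%N by rewrite leq_subLR.
  rewrite zy => -[h1 h2]; split=> //; apply: lt_trans h1.
  have [h3 h4] := x1 0%N (leq0n _).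
  exact: lt_le_trans h4.
have [ni|ni] := ltnP i n.
  by rewrite !zx//; [exact: x2|exact: ltnW].
move: ni; rewrite leq_eqVlt => /predU1P[<-|ni].
  rewrite zx// zn.
  by have [_ h1] := x1 n (leqnn _); have [h2 _] := y1 0%N (leq0n _); exact: le_lt_trans h2.
have -> : i = (n.+1 + (i - n.+1))%N by rewrite subnKC.
rewrite -addnS !zy; apply: y2.
by rewrite ltn_subLR.
Qed.

(** Take a net whose sum is within r of the supremum: a net to the left of its
    first point can be put in front of it, and the combined sum still does not
    exceed the supremum. *)
Lemma small_variation D e C r : 0 < e -> 0 < r ->
  (forall s t, 0 < s -> s < t -> t <= e -> 0 <= D s t) ->
  (forall n x, strict_net 0 e n x -> \sum_(i < n) D (x i) (x i.+1) <= C) ->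
  exists d, [/\ 0 < d, d < e &
    forall n x, strict_net 0 d n x -> \sum_(i < n) D (x i) (x i.+1) <= r].
Proof.
move=> e0 r0 D0 DC.
pose S : set R := [set v | exists n x, strict_net 0 e n x /\ v = \sum_(i < n) D (x i) (x i.+1)].
have S0 : S !=set0.
  exists 0, 0%N, (fun=> e); rewrite big_ord0; split=> //.
have Sub : has_ubound S by exists C => _ [n [x [xe ->]]]; exact: DC.
have [_ [n [x [xe ->]]] nx] := sup_adherent r0 (conj S0 Sub).
have [x1 x2] := xe; have [x00 x0e] := x1 0%N (leq0n _).
(* Half of the first point, so that nets before it end strictly before x 0. *)
exists (x 0%N / 2); split.
- by rewrite divr_gt0.
- by rewrite ltr_pdivrMr//; lra.
move=> m y ye.
have xe' : strict_net (x 0%N / 2) e n x.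
  split=> // i im; have [_ xie] := x1 i im; split=> // {xie}.
  apply: (@lt_le_trans _ _ (x 0%N)); first by rewrite ltr_pdivrMr//; lra.
  elim: i im => // i ih im; apply: le_trans (ih (ltnW im)) _.
  exact/ltW/x2.
have h2 : x 0%N / 2 < e by rewrite ltr_pdivrMr//; lra.
have [z [ze zE]] := strict_net_cat h2 ye xe'.
have : \sum_(i < m.+1 + n) D (z i) (z i.+1) <= sup S.
  by apply: ub_le_sup => //; exists (m.+1 + n)%N, z.
rewrite zE.
have : 0 <= D (y m) (x 0%N).
  have [y1 _] := ye; have [y2 y3] := y1 m (leqnn _).
  apply: D0 => //; apply: le_lt_trans y3 _.
  by rewrite ltr_pdivrMr//; lra.
lra.
Qed.

Lemma strict_net2 a b s t : a < s -> s < t -> t <= b ->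
  strict_net a b 1 (fun i => if i is 0%N then s else t).
Proof.
move=> as_ st tb; split=> [[|[|i]]|[|i]]//= _; split=> //.
  by rewrite (le_trans (ltW st)).
exact: lt_trans st.
Qed.

Lemma NV_sum_le a b g C n x : NV a b g C -> strict_net a b n x -> net_sum g n x <= C.
Proof. by move=> gC /gC; apply: le_trans; rewrite lerDr. Qed.

Lemma NVD a b f g C r : NV a b f C -> NV a b g r -> NV a b (fun t => f t + g t) (C + r).
Proof.
move=> fC gr n x xab; have := fC n x xab; have := gr n x xab.
suff : net_sum (fun t => f t + g t) n x <= net_sum f n x + net_sum g n x.
  by have := ler_normD (f (x n)) (g (x n)); lra.
rewrite -big_split; apply: ler_sum => i _ /=.
by rewrite opprD addrACA; exact: ler_normD.
Qed.

Lemma NVN a b g C : NV a b g C -> NV a b (fun t => - g t) C.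
Proof.
move=> gC n x xab; rewrite normrN (_ : net_sum _ n x = net_sum g n x); first exact: gC.
by apply: eq_bigr => i _; rewrite -opprD normrN.
Qed.

Lemma NV_cst a b c : NV a b (fun=> c) `|c|.
Proof.
move=> n x _; rewrite /net_sum big1 ?addr0// => i _; by rewrite subrr normr0.
Qed.

Lemma NV_eq a b f g C : (forall t, f t = g t) -> NV a b f C -> NV a b g C.
Proof. by move=> /funext ->. Qed.

(** The inner integral, as a function of s, has bounded variation: its increments
    are integrals of the increments of psi, which are bounded by Abel summation
    in t. *)
Lemma NV_section a b c d psi k K D r0 r1 A : c < d ->
  lip k K -> (forall t, c <= t -> t <= d -> `|\int[mu]_(u in `]c, t]) k u| <= A) ->
  (forall s, a < s -> s <= b -> NV c d (psi s) r0) ->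
  (forall s s', a < s -> s < s' -> s' <= b -> NV c d (fun t => psi s' t - psi s t) (D s s')) ->
  (forall n x, strict_net a b n x -> \sum_(i < n) D (x i) (x i.+1) <= r1) ->
  NV a b (fun s => \int[mu]_(t in `]c, d]) (psi s t * k t)) ((r0 + r1) * A).
Proof.
move=> cd kK kA psi0 psiD D1 n x xab; have [x1 x2] := xab.
have A0 : 0 <= A by apply: le_trans (kA c (lexx _) (ltW cd)).
rewrite mulrDl; apply: lerD.
  have [h1 h2] := x1 n (leqnn _).
  exact: (NV_integral_le cd (psi0 _ h1 h2) kK kA).
apply: le_trans (ler_wpM2r A0 (D1 n x xab)).
rewrite mulr_suml; apply: ler_sum => i _.
have [h1 h2] := x1 i (ltnW (ltn_ord i)); have [h3 h4] := x1 i.+1 (ltn_ord i).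
rewrite -RintegralB//; try exact: NV_integrable (psi0 _ _ _) kK.
rewrite (_ : \int[mu]_(t in _) _ =
    \int[mu]_(t in `]c, d]) ((psi (x i.+1) t - psi (x i) t) * k t)); last first.
  by apply: eq_Rintegral => t _; rewrite mulrBl.
apply: (NV_integral_le cd _ kK kA); apply: psiD => //; exact: x2.
Qed.

(** Abel summation in t and then in s. *)
Lemma NV_double a b c d psi k1 k2 K1 K2 D r0 r1 A1 A2 : a < b -> c < d ->
  lip k1 K1 -> (forall t, a <= t -> t <= b -> `|\int[mu]_(u in `]a, t]) k1 u| <= A1) ->
  lip k2 K2 -> (forall t, c <= t -> t <= d -> `|\int[mu]_(u in `]c, t]) k2 u| <= A2) ->
  (forall s, a < s -> s <= b -> NV c d (psi s) r0) ->
  (forall s s', a < s -> s < s' -> s' <= b -> NV c d (fun t => psi s' t - psi s t) (D s s')) ->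
  (forall n x, strict_net a b n x -> \sum_(i < n) D (x i) (x i.+1) <= r1) ->
  `|\int[mu]_(s in `]a, b]) ((\int[mu]_(t in `]c, d]) (psi s t * k2 t)) * k1 s)| <=
    (r0 + r1) * A2 * A1.
Proof.
move=> ab cd k1K k1A k2K k2A p0 pD D1.
exact: (NV_integral_le ab (NV_section cd k2K k2A p0 pD D1) k1K k1A).
Qed.

End bv_curves.

Section corner.
Context (R : realType).
Notation mu := (@lebesgue_measure R).
Variables (e1 e2 C : R) (phi : R -> R -> R) (D : R -> R -> R).
Hypothesis e10 : 0 < e1.
Hypothesis e20 : 0 < e2.

(** A function on ]0, e1] x ]0, e2] seen as a curve of bounded variation in the
    space of functions of t of bounded variation: D s s' bounds the norm of the
    increment from s to s', and C bounds the length of the curve.  This is the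
    form in which bounded variation on a rectangle is used, because it is stable
    under restriction and under integration in t. *)
Definition bv_curve :=
  [/\ forall s, 0 < s -> s <= e1 -> exists r, NV 0 e2 (phi s) r,
      forall s s', 0 < s -> s < s' -> s' <= e1 ->
        NV 0 e2 (fun t => phi s' t - phi s t) (D s s') &
      forall n x, strict_net 0 e1 n x -> \sum_(i < n) D (x i) (x i.+1) <= C].

Hypothesis phiP : bv_curve.

Let D_ge0 s t : 0 < s -> s < t -> t <= e1 -> 0 <= D s t.
Proof. by have [_ h _] := phiP => s0 st te; exact: NV_ge0 e20 (h _ _ s0 st te). Qed.

(** First choose d1 so that the curve is short before d1, then d2 so that the
    single function phi d1 varies little before d2. *)
Lemma corner_box r : 0 < r -> exists d1 d2, [/\ 0 < d1 /\ d1 < e1, 0 < d2 /\ d2 < e2,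
  forall n x, strict_net 0 d1 n x -> \sum_(i < n) D (x i) (x i.+1) <= r,
  forall n y, strict_net 0 d2 n y -> net_sum (phi d1) n y <= r &
  forall s t, 0 < s -> s <= d1 -> 0 < t -> t <= d2 -> `|phi s t - phi d1 d2| <= r + r].
Proof.
move=> r0; have [h1 h2 h3] := phiP.
have [d1 [d10 d1e D1]] := small_variation e10 r0 D_ge0 h3.
have [B Bphi] := h1 d1 d10 (ltW d1e).
have [||d2 [d20 d2e D2]] := @small_variation _ (fun s t => `|phi d1 t - phi d1 s|) e2 B r e20 r0.
- by [].
- by move=> n y ye; exact: NV_sum_le Bphi ye.
exists d1, d2; split=> // s t s0 sd1 t0 td2.
rewrite -(subrK (phi d1 t) (phi s t)) -addrA; apply: le_trans (ler_normD _ _) _.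
apply: lerD.
  move: sd1; rewrite le_eqVlt => /predU1P[->|sd1]; first by rewrite subrr normr0 ltW.
  rewrite distrC; apply: le_trans (_ : D s d1 <= r).
    apply: (NV_le (h2 _ _ s0 sd1 (ltW d1e)) t0).
    exact: le_trans (ltW d2e).
  have := D1 _ _ (strict_net2 s0 sd1 (lexx d1)).
  by rewrite big_ord_recl big_ord0 addr0.
move: td2; rewrite le_eqVlt => /predU1P[->|td2]; first by rewrite subrr normr0 ltW.
have := D2 _ _ (strict_net2 t0 td2 (lexx d2)).
by rewrite big_ord_recl big_ord0 addr0 distrC.
Qed.

Lemma corner_near d1 d2 : 0 < d1 -> 0 < d2 ->
  \forall p \near corner R, [/\ 0 < p.1, p.1 <= d1, 0 < p.2 & p.2 <= d2].
Proof.
move=> d10 d20.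
exists ([set s | 0 < s /\ s <= d1], [set s | 0 < s /\ s <= d2]) => /=.
  by split; (apply: filterI; [exact: nbhs_right_gt|exact: nbhs_right_le]).
by move=> [s t] /= [[? ?] [? ?]].
Qed.

Lemma pinfty2_fst (P : R -> Prop) : (\forall M \near +oo, P M) ->
  \forall p \near pinfty2 R, P p.1.
Proof.
move=> PM; exists (P, setT) => /=; first by split => //; exact: filterT.
by move=> [M N] [].
Qed.

Lemma pinfty2_snd (P : R -> Prop) : (\forall M \near +oo, P M) ->
  \forall p \near pinfty2 R, P p.2.
Proof.
move=> PM; exists (setT, P) => /=; first by split => //; exact: filterT.
by move=> [M N] [].
Qed.

(** The values on a small box at the corner are close to one value, which is
    Cauchy's criterion. *)
Lemma corner_cvg : cvg (phi p.1 p.2 @[p --> corner R]).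
Proof.
apply/cauchy_cvgP/cauchy_exP => e e0.
have r0 : 0 < e / 4 by rewrite divr_gt0.
have [d1 [d2 [[d10 _] [d20 _] _ _ H]]] := corner_box r0.
exists (phi d1 d2).
have := corner_near d10 d20; apply: filterS => -[s t] /= [s0 sd t0 td].
rewrite /ball/= distrC; apply: le_lt_trans (H s t s0 sd t0 td) _; lra.
Qed.

Variable L : R.
Hypothesis phiL : phi p.1 p.2 @[p --> corner R] --> L.
Let psi s t := phi s t - L.

Let psiD s s' : 0 < s -> s < s' -> s' <= e1 ->
  NV 0 e2 (fun t => psi s' t - psi s t) (D s s').
Proof.
move=> s0 ss' se; have [_ h _] := phiP; apply: NV_eq (h s s' s0 ss' se) => t.
by rewrite /psi; ring.
Qed.

(** On the box of [corner_box] the curve, reduced by its limit, is small in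
    norm: phi d1 is, and the other points of the curve are close to phi d1. *)
Let psi_small r : 0 < r -> exists d1 d2, [/\ 0 < d1 /\ d1 < e1, 0 < d2 /\ d2 < e2,
  forall n x, strict_net 0 d1 n x -> \sum_(i < n) D (x i) (x i.+1) <= r &
  forall s, 0 < s -> s <= d1 -> NV 0 d2 (psi s) (7 * r)].
Proof.
move=> r0; have [d1 [d2 [[d10 d1e] [d20 d2e] H1 H2 H3]]] := corner_box r0.
exists d1, d2; split=> // s s0 sd.
have Ld : `|L - phi d1 d2| <= r + r + r.
  have /cvgrPdist_le/(_ _ r0) H4 := phiL.
  have [[u v]] := filter_ex (filterI H4 (corner_near d10 d20)).
  move=> /= [h1 [u0 ud v0 vd]].
  rewrite -(subrK (phi u v) L) -addrA; apply: le_trans (ler_normD _ _) _.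
  by have := H3 u v u0 ud v0 vd; lra.
have N1 : NV 0 d2 (psi d1) (6 * r).
  move=> n y ye.
  have := H2 n y ye; rewrite /psi.
  have -> : net_sum (fun t => phi d1 t - L) n y = net_sum (phi d1) n y.
    by apply: eq_bigr => i _; rewrite opprB addrA subrK.
  have [y1 _] := ye; have [h1 h2] := y1 n (leqnn _).
  have := H3 d1 (y n) d10 (lexx _) h1 h2.
  have : `|phi d1 (y n) - L| <= `|phi d1 (y n) - phi d1 d2| + `|L - phi d1 d2|.
    rewrite (distrC L); have := ler_normD (phi d1 (y n) - phi d1 d2) (phi d1 d2 - L).
    by rewrite addrA subrK.
  by move: Ld; lra.
move: sd; rewrite le_eqVlt => /predU1P[->|sd].
  by move=> n y /N1 h; apply: le_trans h _; rewrite ler_wpM2r ?(ltW r0)//; lra.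
have N2 := NV_sub (lexx _) (ltW d2e) (NVN (psiD s0 sd (ltW d1e))).
have Dr : D s d1 <= r.
  have := H1 _ _ (strict_net2 s0 sd (lexx d1)).
  by rewrite big_ord_recl big_ord0 addr0.
have := NVD N1 N2; move=> N3 n y ye.
have N3' : NV 0 d2 (psi s) (6 * r + D s d1).
  by apply: NV_eq N3 => t; rewrite opprB addrCA subrr addr0.
apply: le_trans (N3' n y ye) _; lra.
Qed.

Let psi_bounded : exists r, forall s, 0 < s -> s <= e1 -> NV 0 e2 (psi s) r.
Proof.
have [h1 h2 h3] := phiP; have [r rP] := h1 e1 e10 (lexx _).
have N1 : NV 0 e2 (psi e1) (r + `|- L|).
  exact: NVD rP (@NV_cst R 0 e2 (- L)).
have C0 : 0 <= C.
  by have := h3 0%N (fun=> e1); rewrite big_ord0; apply; split.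
exists (r + `|- L| + C) => s s0; rewrite le_eqVlt => /predU1P[->|se].
  by move=> n y /N1 h; apply: le_trans h _; rewrite lerDl.
have DC : D s e1 <= C.
  have := h3 _ _ (strict_net2 s0 se (lexx e1)).
  by rewrite big_ord_recl big_ord0 addr0.
have N3 : NV 0 e2 (psi s) (r + `|- L| + D s e1).
  by apply: NV_eq (NVD N1 (NVN (psiD s0 se (lexx _)))) => t; rewrite opprB addrCA subrr addr0.
by move=> n y /N3 h; apply: le_trans h _; rewrite lerD2l.
Qed.

(** Write phi as L plus psi.  The constant contributes L times two Dirichlet
    integrals.  For psi cut the rectangle at d1 and d2: on the small box the
    norm of psi is small and the kernels have bounded primitives, on the other
    pieces psi is bounded in norm and one of the kernels is a tail. *)
Lemma corner_integral (e : R) : 0 < e -> \forall p \near pinfty2 R,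
  `|\int[mu]_(s in `]0, e1]) ((\int[mu]_(t in `]0, e2]) (phi s t * dker p.2 t)) * dker p.1 s)
    - pi ^+ 2 * L| <= e.
Proof.
move=> e0; have [_ _ h3] := phiP.
(* On the small box the norm of psi is at most 7 r and its length at most r,
   and each kernel has primitives bounded by 6: the total is 8 * 36 * r. *)
pose r := e / 2 / (8 * 36).
have r0 : 0 < r by rewrite !divr_gt0//; lra.
have [d1 [d2 [[d10 d1e] [d20 d2e] H1 H2]]] := psi_small r0.
have [B BP] := psi_bounded.
have B0 : 0 <= B + C.
  have C0 : 0 <= C by have := h3 0%N (fun=> e1); rewrite big_ord0; apply; split.
  by rewrite addr_ge0// (NV_ge0 e20 (BP e1 e10 (lexx _))).
(* Accuracy of the two Dirichlet integrals, see mul_pi2_approx; the 1 covers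
   the case L = 0. *)
pose q := e / 4 / (10 * (`|L| + 1)).
have L1 : 0 < `|L| + 1 by rewrite ltr_wpDl.
have q0 : 0 < q by rewrite !divr_gt0//; lra.
have X1 := pinfty2_fst (dker_limit e10 q0).
have X2 := pinfty2_snd (dker_limit e20 q0).
have X3 : \forall p \near pinfty2 R, 0 < p.1 /\ (B + C) * 24 / d1 / (e / 8) <= p.1.
  by apply: (@pinfty2_fst (fun M => 0 < M /\ _ <= M)); apply: filterI;
    [apply: nbhs_pinfty_gt; rewrite num_real|apply: nbhs_pinfty_ge; rewrite num_real].
have X4 : \forall p \near pinfty2 R, 0 < p.2 /\ (B + C) * 24 / d2 / (e / 8) <= p.2.
  by apply: (@pinfty2_snd (fun M => 0 < M /\ _ <= M)); apply: filterI;
    [apply: nbhs_pinfty_gt; rewrite num_real|apply: nbhs_pinfty_ge; rewrite num_real].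
apply: (filterS _ (filterI (filterI X1 X2) (filterI X3 X4))) => -[M N] /=.
move=> [[Y1 Y2] [[M0 Y3] [N0 Y4]]].
have kM := lip_dker (ltW M0); have kN := lip_dker (ltW N0).
pose h a b s := \int[mu]_(t in `]a, b]) (psi s t * dker N t).
pose I a b c d := \int[mu]_(s in `]a, b]) (h c d s * dker M s).
have A6 P x (P0 : 0 < P) : 0 <= x -> `|\int[mu]_(s in `]0, x]) dker P s| <= 6.
  exact: dker_int_le.
have psi_int a b s : 0 <= a -> b <= e2 -> 0 < s -> s <= e1 ->
    mu.-integrable `]a, b] (EFin \o (fun t => psi s t * dker N t)).
  by move=> a0 be s0 se; exact: NV_integrable (NV_sub a0 be (BP s s0 se)) kN.
have psiD' a b s s' : 0 <= a -> b <= e2 -> 0 < s -> s < s' -> s' <= e1 ->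
    NV a b (fun t => psi s' t - psi s t) (D s s').
  by move=> a0 be s0 ss se; exact: NV_sub a0 be (psiD s0 ss se).
have h3' a b n x : 0 <= a -> b <= e1 -> strict_net a b n x ->
    \sum_(i < n) D (x i) (x i.+1) <= C.
  by move=> a0 be xab; apply: h3; exact: strict_net_sub a0 be xab.
have hN a b c d : 0 <= a -> b <= e1 -> 0 <= c -> c < d -> d <= e2 ->
    exists Q, NV a b (h c d) Q.
  move=> a0 be c0 cd de; exists ((B + C) * 12).
  apply: (NV_section cd kN _ _ (fun s s' as_ ss sb => psiD' c d s s' c0 de (le_lt_trans a0 as_) ss (le_trans sb be))).
  - by move=> t ct td; exact: dker_int_le12.
  - by move=> s as_ sb; apply: NV_sub c0 de (BP _ _ _); [exact: le_lt_trans as_|exact: le_trans be].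
  - by move=> n x; exact: h3'.
have E1 : \int[mu]_(s in `]0, e1])
     ((\int[mu]_(t in `]0, e2]) (phi s t * dker N t)) * dker M s) =
   I 0 d1 0 d2 + I 0 d1 d2 e2 + I d1 e1 0 e2 +
   L * (\int[mu]_(s in `]0, e1]) dker M s) * (\int[mu]_(t in `]0, e2]) dker N t).
  have ih a b c d : 0 <= a -> b <= e1 -> 0 <= c -> c < d -> d <= e2 ->
      mu.-integrable `]a, b] (EFin \o (fun s => h c d s * dker M s)).
    by move=> a0 be c0 cd de; have [Q QP] := hN a b c d a0 be c0 cd de; exact: NV_integrable QP kM.
  transitivity (I 0 e1 0 e2 + L * (\int[mu]_(s in `]0, e1]) dker M s) * (\int[mu]_(t in `]0, e2]) dker N t)).
    rewrite mulrAC -RintegralZl//; last exact: lip_integrable kM.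
    rewrite -RintegralD//; last 2 first.
    - by apply: ih.
    - by apply: RintegrableZ => //; exact: lip_integrable kM.
    apply: eq_Rintegral => s /set_mem/=; rewrite in_itv/= => /andP[s0 se].
    rewrite /h -mulrDl; congr (_ * _).
    rewrite -RintegralZl//; last exact: lip_integrable kN.
    rewrite -RintegralD//; last 2 first.
    - exact: psi_int.
    - by apply: RintegrableZ => //; exact: lip_integrable kN.
    by apply: eq_Rintegral => t _; rewrite /psi; ring.
  congr (_ + _); rewrite /I (Rintegral_cat (ltW d10) (ltW d1e)); last by apply: ih.
  congr (_ + _).
  rewrite -RintegralD//; last 2 first.
  - by apply: ih => //; [exact: ltW|exact: ltW].
  - by apply: ih => //; [exact: ltW|exact: ltW].
  apply: eq_Rintegral => s /set_mem/=; rewrite in_itv/= => /andP[s0 se].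
  rewrite -mulrDl; congr (_ * _); rewrite /h (Rintegral_cat (ltW d20) (ltW d2e))//.
  by apply: psi_int => //; rewrite (le_trans se)// ltW.
rewrite E1.
have B1 : `|I 0 d1 0 d2| <= (7 * r + r) * 6 * 6.
  apply: (NV_double d10 d20 kM _ kN _ H2 _ H1).
  - by move=> t t0 _; exact: A6.
  - by move=> t t0 _; exact: A6.
  - move=> s s' s0 ss se; apply: psiD' => //; first exact: ltW.
    by rewrite (le_trans se)// ltW.
have B2 : `|I 0 d1 d2 e2| <= (B + C) * (4 / (d2 * N)) * 6.
  apply: (@NV_double _ 0 d1 d2 e2 psi _ _ _ _ D B C _ _ d10 d2e kM _ kN).
  - by move=> t t0 _; exact: A6.
  - by move=> t t0 _; exact: dker_tail.
  - move=> s s0 se; apply: NV_sub (ltW d20) (lexx _) (BP _ _ _) => //.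
    by rewrite (le_trans se)// ltW.
  - move=> s s' s0 ss se; apply: psiD' => //; first exact: ltW.
    by rewrite (le_trans se)// ltW.
  - by move=> n x; apply: h3' => //; exact: ltW.
have B3 : `|I d1 e1 0 e2| <= (B + C) * 6 * (4 / (d1 * M)).
  apply: (@NV_double _ d1 e1 0 e2 psi _ _ _ _ D B C _ _ d1e e20 kM _ kN).
  - by move=> t t0 _; exact: dker_tail.
  - by move=> t t0 _; exact: A6.
  - by move=> s s0 se; apply: BP => //; rewrite (lt_trans d10).
  - by move=> s s' s0 ss se; apply: psiD' => //; rewrite (lt_trans d10).
  - by move=> n x; apply: h3' => //; exact: ltW.
have B1' : (7 * r + r) * 6 * 6 = e / 2 by rewrite /r; field.
have tail P d (P0 : 0 < P) (d0 : 0 < d) : (B + C) * 24 / d / (e / 8) <= P ->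
    (B + C) * 24 / (d * P) <= e / 8.
  have -> : (B + C) * 24 / (d * P) = (B + C) * 24 / d / P.
    by field; rewrite !gt_eqF.
  have e8 : 0 < e / 8 by rewrite divr_gt0.
  by rewrite (ler_pdivrMr _ _ e8) (ler_pdivrMr _ _ P0) [P * _]mulrC.
have B2' := tail N d2 N0 d20 Y4.
have B3' := tail M d1 M0 d10 Y3.
have B2E : (B + C) * (4 / (d2 * N)) * 6 = (B + C) * 24 / (d2 * N) by ring.
have B3E : (B + C) * 6 * (4 / (d1 * M)) = (B + C) * 24 / (d1 * M) by ring.
rewrite B1' in B1; rewrite B2E in B2; rewrite B3E in B3.
set u := \int[mu]_(s in `]0, e1]) dker M s in Y1 *.
set v := \int[mu]_(t in `]0, e2]) dker N t in Y2 *.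
have B4 : `|L * u * v - pi ^+ 2 * L| <= e / 4.
  have u6 : `|u| <= 6 by apply: A6 => //; exact: ltW.
  apply: le_trans (mul_pi2_approx L u6 Y1 Y2) _.
  rewrite /q invfM [10 * _]mulrCA mulVKf ?lt0r_neq0// mulrCA ger_pMr ?divr_gt0//.
  by rewrite ler_pdivrMr// mul1r lerDl.
exact: sum4_approx B1 (le_trans B2 B2') (le_trans B3 B3') B4.
Qed.

End corner.

(** * Bounded variation on a rectangle gives a curve of bounded variation *)

Section partitions_to_nets.
Context (R : realType).
Implicit Types (a b c s t C : R) (x : nat -> R) (p : R -> R -> R).

Definition closed_net a b n x :=
  (forall i, (i <= n)%N -> a <= x i /\ x i <= b) /\
  (forall i, (i < n)%N -> x i < x i.+1).

(** For an interval function p, partitions in the sense of itv_partition: they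
    contain both end points, unlike the nets used for [bv_curve]. *)
Definition partition_bounded a b p C := forall u, itv_partition a b u ->
  \sum_(0 <= i < size u) p (nth b (a :: u) i) (nth b (a :: u) i.+1) <= C.

Lemma exact_net_sum a b p C n x : partition_bounded a b p C ->
  (forall i, (i < n)%N -> x i < x i.+1) -> x 0%N = a -> x n = b ->
  \sum_(i < n) p (x i) (x i.+1) <= C.
Proof.
move=> pC x2 xa xb; pose u := mkseq (fun i => x i.+1) n.
have uE i : (i <= n)%N -> nth b (a :: u) i = x i.
  by case: i => [|i] im //=; rewrite nth_mkseq.
have su : size u = n by rewrite size_mkseq.
have up : itv_partition a b u.
  split; last first.
    by apply/eqP; rewrite (last_nth b) su uE.
  apply/(pathP b) => i; rewrite su => im.
  by rewrite uE ?(ltnW im)// nth_mkseq// x2.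
have := pC u up; rewrite su big_mkord; apply: le_trans.
rewrite le_eqVlt; apply/orP; left; apply/eqP; apply: eq_bigr => i _.
by rewrite !uE// ltnW.
Qed.

(** A net can be completed by the end points a and b, which only adds
    nonnegative terms. *)
Lemma closed_net_sum a b p C n x : (forall s t, 0 <= p s t) ->
  partition_bounded a b p C -> closed_net a b n x ->
  \sum_(i < n) p (x i) (x i.+1) <= C.
Proof.
move=> p0 pC.
have step1 m y : closed_net a b m y -> y 0%N = a -> \sum_(i < m) p (y i) (y i.+1) <= C.
  move=> [y1 y2] ya; have [_ ] := y1 m (leqnn _); rewrite le_eqVlt => /predU1P[yb|yb].
    exact: exact_net_sum pC y2 ya yb.
  pose z := net_snoc y m b.
  have zy i : (i <= m)%N -> z i = y i by rewrite /z /net_snoc => ->.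
  have zb : z m.+1 = b by rewrite /z /net_snoc ltnn.
  have : \sum_(i < m.+1) p (z i) (z i.+1) <= C.
    apply: (exact_net_sum pC _ _ zb); last by rewrite zy.
    move=> i; rewrite ltnS leq_eqVlt => /predU1P[->|im]; first by rewrite zb zy.
    by rewrite !zy//; [exact: y2|exact: ltnW].
  apply: le_trans; rewrite big_ord_recr/=.
  apply: (@le_trans _ _ (\sum_(i < m) p (z i) (z i.+1))); last by rewrite lerDl.
  by rewrite le_eqVlt; apply/orP; left; apply/eqP; apply: eq_bigr => i _; rewrite !zy// ltnW.
move=> xab; have [x1 x2] := xab; have [] := x1 0%N (leq0n _).
rewrite le_eqVlt => /predU1P[xa|ax] x0b; first exact: step1.
pose z i := if i is j.+1 then x j else a.
have : \sum_(i < n.+1) p (z i) (z i.+1) <= C.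
  apply: step1 => //; split=> [[|i]|[|i]]//= im; [|exact: x1|exact: x2].
  by rewrite lexx (le_trans (ltW ax)).
by apply: le_trans; rewrite big_ord_recl/= lerDr.
Qed.

(** For a reflection the points come in the reverse order, which a symmetric p
    does not see. *)
Lemma refl_net_sum a b p C c (sg : bool) e n x : (forall s t, 0 <= p s t) ->
  (forall s t, p s t = p t s) -> partition_bounded a b p C ->
  (forall s, 0 < s -> s <= e -> a <= refl_shift c sg s /\ refl_shift c sg s <= b) ->
  strict_net 0 e n x ->
  \sum_(i < n) p (refl_shift c sg (x i)) (refl_shift c sg (x i.+1)) <= C.
Proof.
move=> p0 pS pC ce [x1 x2]; case: sg ce => ce.
  (* A reflection reverses the order, so the net is read backwards. *)
  pose z i := refl_shift c true (x (n - i)%N).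
  have -> : \sum_(i < n) p (refl_shift c true (x i)) (refl_shift c true (x i.+1)) =
     \sum_(i < n) p (z i) (z i.+1).
    rewrite (reindex_inj rev_ord_inj)/=; apply: eq_bigr => i _.
    by rewrite pS /z subnSK.
  apply: (closed_net_sum p0 pC); split=> i im.
    by have [h1 h2] := x1 (n - i)%N (leq_subr _ _); exact: ce.
  have h : x (n - i.+1)%N < x (n - i)%N.
    by rewrite -(subnSK im); apply: x2; rewrite ltn_subrL/= (leq_trans _ im).
  by rewrite /z /refl_shift expr1 !mulN1r ltrD2l ltrN2.
apply: (closed_net_sum (x := fun i => refl_shift c false (x i)) p0 pC); split=> i im.
  by have [h1 h2] := x1 i im; exact: ce.
by rewrite /refl_shift expr0 !mul1r ltrD2l x2.
Qed.

End partitions_to_nets.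

Section total_variation_nets.
Context (R : realType).
Implicit Types (a b c s t C e r : R) (g h : R -> R) (x : nat -> R) (u v : seq R).

Definition rTV a b g : R := fine (total_variation a b g).

Lemma variation_rTV a b g u : bounded_variation a b g -> a <= b ->
  itv_partition a b u -> variation a b g u <= rTV a b g.
Proof.
move=> gBV ab abu; rewrite -lee_fin /rTV fineK; last exact/bounded_variationP.
by apply: ereal_sup_ubound; exists (variation a b g u) => //; exists u.
Qed.

Lemma rTV_ge0 a b g : a <= b -> 0 <= rTV a b g.
Proof. by move=> ab; apply: fine_ge0; exact: total_variation_ge0. Qed.

Lemma rTVN a b g : rTV a b (fun t => - g t) = rTV a b g.
Proof. by rewrite /rTV -[in RHS]total_variationN. Qed.

Lemma rTV_approx a b g e : bounded_variation a b g -> a < b -> 0 < e ->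
  exists2 u, itv_partition a b u & rTV a b g - e < variation a b g u.
Proof.
move=> gBV ab e0; have /(bounded_variationP _ (ltW ab)) fTV := gBV.
have [_ [_ [u abu <-] <-]] := ub_ereal_sup_adherent e0 fTV.
rewrite -/(total_variation a b g) -[total_variation a b g]fineK// -EFinB lte_fin => h.
by exists u.
Qed.

Lemma partition_mem a b u z : itv_partition a b u -> z \in u -> a < z /\ z <= b.
Proof.
move=> abu zu; have [pu /eqP lu] := abu; split.
  by have /allP := lt_path_min pu; exact.
have := itv_partition_nth_le (m := (index z u).+1) _ abu.
by rewrite /= nth_index//; apply; rewrite ltnS index_mem.
Qed.

(** Merge the two partitions, setting aside the end point b, which both have. *)
Lemma common_refinement a b u v : a < b ->
  itv_partition a b u -> itv_partition a b v ->
  exists w, [/\ itv_partition a b w, subseq u w & subseq v w].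
Proof.
move=> ab abu abv.
(* All points of both partitions other than b. *)
pose w0 := sort <=%R (undup [seq z <- u ++ v | z < b]).
have w0s : sorted <%R w0 by rewrite sort_lt_sorted undup_uniq.
have w0m z : (z \in w0) = (z < b) && ((z \in u) || (z \in v)).
  by rewrite mem_sort mem_undup mem_filter mem_cat.
pose w := rcons w0 b.
have abw : itv_partition a b w.
  split; last by rewrite last_rcons.
  rewrite rcons_path; apply/andP; split.
    rewrite lt_path_sortedE w0s andbT; apply/allP => z.
    by rewrite w0m => /andP[_ /orP[/(partition_mem abu)|/(partition_mem abv)] []].
  have := mem_last a w0; rewrite inE => /predU1P[->//|].
  by rewrite w0m => /andP[].
have ws : sorted <%R w by have [/path_sorted] := abw.
have sub q : itv_partition a b q -> {subset q <= w} -> subseq q w.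
  move=> abq qw; have [/path_sorted qs _] := abq.
  rewrite (_ : q = [seq z <- w | z \in q]); first exact: filter_subseq.
  apply: lt_sorted_eq => //; first by apply: sorted_filter => //; exact: lt_trans.
  by move=> z; rewrite mem_filter; case: (boolP (z \in q)) => //= /qw ->.
exists w; split => //; apply: sub => // z zu; rewrite mem_rcons inE w0m zu ?orbT andbT.
  by have [_] := partition_mem abu zu; rewrite le_eqVlt.
by have [_] := partition_mem abv zu; rewrite le_eqVlt.
Qed.

(** A partition that nearly attains the total variation of finitely many
    functions at once: refine, which can only increase the variation. *)
Lemma rTV_approx_all a b n (G : nat -> R -> R) e : a < b -> 0 < e ->
  (forall i, (i < n)%N -> bounded_variation a b (G i)) ->
  exists2 u, itv_partition a b u &
    forall i, (i < n)%N -> rTV a b (G i) - e < variation a b (G i) u.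
Proof.
move=> ab e0; elim: n => [|n ih] GBV.
  by exists [:: b] => //; exact: itv_partition1.
have [i im|u abu uP] := ih; first by apply: GBV; exact: leqW.
have [v abv vP] := rTV_approx (GBV n (leqnn _)) ab e0.
have [w [abw uw vw]] := common_refinement ab abu abv.
exists w => // i; rewrite ltnS leq_eqVlt => /predU1P[->|im].
  by apply: lt_le_trans vP _; exact: variation_subseq.
by apply: lt_le_trans (uP i im) _; exact: variation_subseq.
Qed.

(** The total variations of several functions need not be attained along the
    same partition, but nearly are along a common one. *)
Lemma rTV_sum_le a b n (G : nat -> R -> R) C : a < b ->
  (forall i, (i < n)%N -> bounded_variation a b (G i)) ->
  (forall u, itv_partition a b u -> \sum_(i < n) variation a b (G i) u <= C) ->
  \sum_(i < n) rTV a b (G i) <= C.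
Proof.
move=> ab GBV GC; apply/ler_addgt0Pr => e e0.
have e'0 : 0 < e / n.+1%:R by rewrite divr_gt0.
have [u abu uP] := rTV_approx_all ab e'0 GBV.
apply: (@le_trans _ _ (\sum_(i < n) (variation a b (G i) u + e / n.+1%:R))).
  by apply: ler_sum => i _; rewrite -lerBlDr ltW// uP.
rewrite big_split/= sumr_const card_ord; apply: lerD; first exact: GC.
by rewrite -[leLHS]mulr_natr mulrAC ler_pdivrMr// ler_pM2l// ler_nat.
Qed.

Lemma partition_bounded_rTV a b g : bounded_variation a b g -> a <= b ->
  partition_bounded a b (fun s t => `|g t - g s|) (rTV a b g).
Proof. by move=> gBV ab u abu; exact: variation_rTV gBV ab abu. Qed.

Lemma rTV_NV a b g t0 c (sg : bool) e : bounded_variation a b g -> a <= b ->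
  a <= t0 -> t0 <= b ->
  (forall s, 0 < s -> s <= e -> a <= refl_shift c sg s /\ refl_shift c sg s <= b) ->
  NV 0 e (fun s => g (refl_shift c sg s)) (`|g t0| + 2 * rTV a b g).
Proof.
move=> gBV ab at0 t0b ce n x xe.
have pB := partition_bounded_rTV gBV ab.
have p0 s t : 0 <= `|g t - g s| by [].
have pS s t : `|g t - g s| = `|g s - g t| by rewrite distrC.
have H := refl_net_sum p0 pS pB ce xe.
have [x1 _] := xe; have [h1 h2] := x1 n (leqnn _); have [h3 h4] := ce _ h1 h2.
set z := refl_shift c sg (x n) in h3 h4 *.
have H2 s t : a <= s -> s < t -> t <= b -> `|g t - g s| <= rTV a b g.
  move=> as_ st tb.
  have := @closed_net_sum R a b (fun s t => `|g t - g s|) _ 1 (fun i => if i is 0%N then s else t) p0 pB.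
  rewrite big_ord_recl big_ord0 addr0; apply; split=> [[|[|i]]|[|i]]//= _; split=> //.
    by rewrite (le_trans (ltW st)).
  by rewrite (le_trans _ (ltW st)).
have H3 : `|g z - g t0| <= rTV a b g.
  have [zt|tz|->] := ltgtP z t0.
  - by rewrite distrC; exact: H2.
  - exact: H2.
  - by rewrite subrr normr0 rTV_ge0.
have H4 : `|g z| <= `|g t0| + `|g z - g t0|.
  by rewrite -{1}(subrK (g t0) (g z)) addrC; exact: ler_normD.
have -> : `|g t0| + 2 * rTV a b g = `|g t0| + rTV a b g + rTV a b g by ring.
apply: lerD => //; apply: le_trans H4 _; exact: lerD.
Qed.

End total_variation_nets.

Section BVF_to_curve.
Context (R : realType).
Variables (a1 b1 a2 b2 : R) (F : R * R -> R).
Hypothesis ab1 : a1 < b1.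
Hypothesis ab2 : a2 < b2.
Hypothesis FBV : BVF a1 b1 a2 b2 F.

Let incr s s' := fun t => F (s', t) - F (s, t).

Let variation2E (u v : seq R) : variation2 a1 b1 a2 b2 F u v =
  \sum_(0 <= i < size u) variation a2 b2
    (incr (nth b1 (a1 :: u) i) (nth b1 (a1 :: u) i.+1)) v.
Proof.
apply: eq_bigr => i _; apply: eq_bigr => j _; congr `|_|.
by rewrite /incr/=; ring.
Qed.

(** Sums of the increments of F over a fixed partition in t form an interval
    function of s, and the two-dimensional bound says that it is bounded over
    partitions in s.  [rTV_sum_le] upgrades this from sums over a fixed
    partition in t to total variations in t.  The norm of an increment is its
    total variation plus its absolute value at one point t1, for which the
    function of s on the line t = t1 has bounded variation.  C and D0 do not
    depend on the quadrant, so that one pair serves the four of them. *)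
Lemma BVF_bv_curve : exists (C : R) (D0 : R -> R -> R),
  forall x0 y0 e1 e2 (sg1 sg2 : bool),
  (forall s, 0 < s -> s <= e1 -> a1 <= refl_shift x0 sg1 s /\ refl_shift x0 sg1 s <= b1) ->
  (forall s, 0 < s -> s <= e2 -> a2 <= refl_shift y0 sg2 s /\ refl_shift y0 sg2 s <= b2) ->
  bv_curve e1 e2 C (fun s t => F (refl_shift x0 sg1 s, refl_shift y0 sg2 t))
    (fun s s' => D0 (refl_shift x0 sg1 s) (refl_shift x0 sg1 s')).
Proof.
have [[C2 F2] [s1 s1in BVs1] [t1 t1in [C1 BVt1]]] := FBV.
move: s1in t1in; rewrite !in_itv/= => /andP[as1 s1b] /andP[at1 t1b].
have var0 s s' v : 0 <= variation a2 b2 (incr s s') v by exact: variation_ge0.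
have pV v : itv_partition a2 b2 v ->
    partition_bounded a1 b1 (fun s s' => variation a2 b2 (incr s s') v) C2.
  by move=> abv u abu; rewrite -variation2E; exact: F2.
have incrBV s s' : a1 <= s -> s < s' -> s' <= b1 -> bounded_variation a2 b2 (incr s s').
  move=> as_ ss' sb; exists C2 => _ [v abv <-].
  have := closed_net_sum (n := 1) (x := fun i => if i is 0%N then s else s')
    (fun s t => var0 s t v) (pV v abv).
  rewrite big_ord_recl big_ord0 addr0; apply; split=> [[|[|i]]|[|i]]//= _; split=> //.
    by rewrite (le_trans (ltW ss')).
  by rewrite (le_trans _ (ltW ss')).
have incrN s s' : incr s' s = (fun t => - incr s s' t).
  by apply/funext => t; rewrite /incr opprB.
have FBVs s : a1 <= s -> s <= b1 -> bounded_variation a2 b2 (fun t => F (s, t)).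
  move=> as_ sb; have [ss1|s1s|->//] := ltgtP s s1.
    rewrite (_ : (fun t => _) = (fun t => F (s1, t)) \+ (\- incr s s1)).
      by apply: bounded_variationD => //; apply: bounded_variationN; exact: incrBV.
    by apply/funext => t; rewrite /incr/=; ring.
  rewrite (_ : (fun t => _) = (fun t => F (s1, t)) \+ incr s1 s).
    by apply: bounded_variationD => //; exact: incrBV.
  by apply/funext => t; rewrite /incr/=; ring.
have incrBV' s s' : a1 <= s -> s <= b1 -> a1 <= s' -> s' <= b1 ->
    bounded_variation a2 b2 (incr s s').
  move=> as_ sb as' sb'; rewrite (_ : incr s s' = (fun t => F (s', t)) \+ (\- (fun t => F (s, t)))).
    apply: bounded_variationD => //; first exact: FBVs.
    by apply: bounded_variationN; exact: FBVs.
  by apply/funext => t; rewrite /incr.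
(* q measures the increment from s to s' by its variation in t, q1 below by
   its size at the single point t1. *)
pose q s s' := rTV a2 b2 (incr s s').
have q0 s s' : 0 <= q s s' by apply: rTV_ge0; exact: ltW.
have qS s s' : q s s' = q s' s by rewrite /q incrN rTVN.
have qC : partition_bounded a1 b1 q C2.
  move=> u abu; rewrite big_mkord.
  have um i : (i <= size u)%N -> a1 <= nth b1 (a1 :: u) i /\ nth b1 (a1 :: u) i <= b1.
    by move=> im; rewrite itv_partition_nth_ge// itv_partition_nth_le.
  apply: (@rTV_sum_le _ _ _ _ (fun i => incr (nth b1 (a1 :: u) i) (nth b1 (a1 :: u) i.+1))) => //.
    move=> i im; have [h1 h2] := um i (ltnW im); have [h3 h4] := um i.+1 im.
    exact: incrBV'.
  by move=> v abv; have := pV v abv u abu; rewrite big_mkord.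
pose q1 s s' := `|F (s', t1) - F (s, t1)|.
have q1C : partition_bounded a1 b1 q1 C1 by move=> u abu; apply: BVt1; exists u.
exists (C1 + 2 * C2), (fun s s' => q1 s s' + 2 * q s s').
move=> x0 y0 e1 e2 sg1 sg2 ce1 ce2; split.
- move=> s s0 se; have [h1 h2] := ce1 s s0 se.
  eexists; exact: (rTV_NV (FBVs _ h1 h2) (ltW ab2) at1 t1b ce2).
- move=> s s' s0 ss' se'.
  have [h1 h2] := ce1 s s0 (le_trans (ltW ss') se').
  have [h3 h4] := ce1 s' (lt_trans s0 ss') se'.
  exact: (rTV_NV (incrBV' _ _ h1 h2 h3 h4) (ltW ab2) at1 t1b ce2).
- move=> n x xe; rewrite big_split/= -mulr_sumr; apply: lerD.
    apply: (refl_net_sum _ _ q1C ce1 xe) => s t; first exact: normr_ge0.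
    exact: distrC.
  by rewrite ler_pM2l//; exact: (refl_net_sum q0 qS qC ce1 xe).
Qed.

End BVF_to_curve.

(** * Exchanging an integral with a bounded kernel *)

Section tensor.
Context d1 d2 (T1 : measurableType d1) (T2 : measurableType d2) (R : realType).
Variable m1 : {sigma_finite_measure set T1 -> \bar R}.
Variable m2 : {sigma_finite_measure set T2 -> \bar R}.

(** Tonelli: the iterated integral of the absolute value is a product. *)
Lemma integrable_tensor (alpha : T1 -> R) (beta : T2 -> R) :
  m1.-integrable setT (EFin \o alpha) -> m2.-integrable setT (EFin \o beta) ->
  (m1 \x m2)%E.-integrable setT (EFin \o (fun z => alpha z.1 * beta z.2)).
Proof.
move=> ia ib.
have ma : measurable_fun setT alpha by have /measurable_int/measurable_EFinP := ia.
have mb : measurable_fun setT beta by have /measurable_int/measurable_EFinP := ib.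
have mab : measurable_fun setT (EFin \o (fun z : T1 * T2 => alpha z.1 * beta z.2)).
  apply/measurable_EFinP; apply: measurable_funM.
    exact: (measurableT_comp ma measurable_fst).
  exact: (measurableT_comp mb measurable_snd).
apply/(integrable12ltyP m1 m2 mab) => /=.
have ibn := integrable_norm ib.
rewrite (eq_integral (fun x => (`|alpha x| * \int[m2]_y `|beta y|)%:E)); last first.
  move=> x _.
  rewrite (eq_integral (fun y => (`|alpha x|)%:E * (`|beta y|)%:E)%E); last first.
    by move=> y _; rewrite normrM EFinM.
  rewrite integralZl// EFinM; congr (_ * _)%E.
  by rewrite /Rintegral fineK//; exact: integrable_fin_num ibn.
have iA : m1.-integrable setT (EFin \o (fun x => (\int[m2]_y `|beta y|) * `|alpha x|)).
  by apply: RintegrableZ => //; exact: integrable_norm ia.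
have /integrableP[_] := iA; apply: le_lt_trans.
rewrite le_eqVlt; apply/orP; left; apply/eqP; apply: eq_integral => x _ /=.
by rewrite normrM normr_id mulrC ger0_norm// Rintegral_ge0.
Qed.

Variables (A : set T1) (F : T2 -> R) (k : T1 * T2 -> R).
Hypothesis mA : measurable A.
Hypothesis Aoo : (m1 A < +oo)%E.
Hypothesis iF : m2.-integrable setT (EFin \o F).
Hypothesis mk : measurable_fun setT k.
Hypothesis k1 : forall z, `|k z| <= 1.

Lemma integrable_bounded_kernel :
  (m1 \x m2)%E.-integrable setT (EFin \o (fun z => \1_A z.1 * F z.2 * k z)).
Proof.
have i1 : m1.-integrable setT (EFin \o (\1_A : T1 -> R)).
  have i2 : m1.-integrable A (EFin \o (fun=> 1)).
    apply: measurable_bounded_integrable => //.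
    exists 1; split; first exact: num_real.
    by move=> r r1 x _; rewrite normr1 ltW.
  by apply: eq_integrable (indic_integrable mA i2) => // x _ /=; rewrite mulr1.
exact: (Rintegral_bounded_factor measurableT (integrable_tensor i1 iF) mk k1).1.
Qed.

Lemma Rintegral_kernel_outer (g : T2 -> R) x :
  \int[m2]_y (\1_A x * g y) = \1_A x * \int[m2]_y g y.
Proof.
rewrite indicE; case: (x \in A).
  by rewrite mul1r; apply: eq_Rintegral => y _; rewrite mul1r.
rewrite mul0r -[RHS](@mul0r _ (fine (m2 setT))) -Rintegral_cst//.
by apply: eq_Rintegral => y _; rewrite mul0r.
Qed.

Lemma integrable_kernel_integral :
  m1.-integrable A (EFin \o (fun x => \int[m2]_y (F y * k (x, y)))).
Proof.
apply: integrable_indic_restr => //.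
apply: eq_integrable (integrable_Rfubini1 integrable_bounded_kernel) => // x _ /=.
congr EFin; rewrite -Rintegral_kernel_outer.
by apply: eq_Rintegral => y _; rewrite /= mulrA.
Qed.

Lemma kernel_section_integrable y :
  m1.-integrable A (EFin \o (fun x => k (x, y))).
Proof.
apply: measurable_bounded_integrable => //.
  by apply: measurable_funTS; exact: measurableT_comp mk (pair2_measurable y).
exists 1; split; first exact: num_real.
by move=> r r1 x _; apply: le_trans (k1 (x, y)) _; exact: ltW.
Qed.

Lemma kernel_integral_le y : `|\int[m1]_(x in A) k (x, y)| <= fine (m1 A).
Proof.
apply: le_trans (le_normr_Rintegral _ (kernel_section_integrable y)) _ => //.
rewrite -[leRHS]mul1r -Rintegral_cst//; apply: le_Rintegral => //.
- exact: integrable_norm (kernel_section_integrable y).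
- apply: measurable_bounded_integrable => //.
  exists 1; split; first exact: num_real.
  by move=> r r1 x _; rewrite normr1 ltW.
Qed.

(** The kernel is only bounded, so Tonelli is applied to its positive and
    negative parts restricted to A. *)
Lemma measurable_kernel_integral :
  measurable_fun setT (fun y => \int[m1]_(x in A) k (x, y)).
Proof.
pose h z := maxe (EFin (\1_A z.1 * k z)) 0%E.
pose h' z := maxe (EFin (- (\1_A z.1 * k z))) 0%E.
have m0 : measurable_fun setT (fun z : T1 * T2 => \1_A z.1 * k z).
  apply: measurable_funM => //.
  apply: (measurableT_comp _ measurable_fst); exact: measurable_indic.
have mh : measurable_fun setT h.
  by apply: measurable_maxe => //; exact/measurable_EFinP.
have mh' : measurable_fun setT h'.
  by apply: measurable_maxe => //; apply/measurable_EFinP; exact: measurable_funN.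
have h0 z : (0 <= h z)%E by rewrite le_max lexx orbT.
have h0' z : (0 <= h' z)%E by rewrite le_max lexx orbT.
have := measurable_fun_fubini_tonelli_G (m1 := m1) h mh h0.
have := measurable_fun_fubini_tonelli_G (m1 := m1) h' mh' h0'.
move=> G' G.
rewrite (_ : (fun y => _) = fine \o (fubini_G m1 h \- fubini_G m1 h')%E).
  by apply: measurableT_comp => //; exact: emeasurable_funB.
apply/funext => y; rewrite Rintegral_indic /Rintegral /=; congr fine.
rewrite integralE /fubini_G; congr (_ - _)%E; apply: eq_integral => x _.
  by rewrite funeposE.
by rewrite funenegE.
Qed.

(** Fubini for the function F(y) k(x, y) on A times the whole space, integrable
    because A has finite measure and k is bounded. *)
Lemma Rintegral_kernel_swap :
  \int[m1]_(x in A) (\int[m2]_y (F y * k (x, y))) =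
  \int[m2]_y (F y * \int[m1]_(x in A) k (x, y)).
Proof.
rewrite Rintegral_indic.
transitivity (\int[(m1 \x m2)%E]_z (\1_A z.1 * F z.2 * k z)).
  rewrite (Rintegral_fubini1 integrable_bounded_kernel).
  apply: eq_Rintegral => x _; rewrite -Rintegral_kernel_outer.
  by apply: eq_Rintegral => y _; rewrite /= mulrA.
rewrite (Rintegral_fubini2 integrable_bounded_kernel).
apply: eq_Rintegral => y _; rewrite -RintegralZl//; last exact: kernel_section_integrable.
rewrite [RHS]Rintegral_indic; apply: eq_Rintegral => x _ /=; ring.
Qed.

Lemma integrable_kernel_factor :
  m2.-integrable setT (EFin \o (fun y => F y * \int[m1]_(x in A) k (x, y))).
Proof.
have mF : measurable_fun setT F by have /measurable_int/measurable_EFinP := iF.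
apply: (@le_Rintegrable _ _ _ m2 _ (fun y => fine (m1 A) * F y)) => //.
- apply: measurable_funM => //; exact: measurable_kernel_integral.
- move=> y _; rewrite !normrM mulrC ler_wpM2r//.
  apply: le_trans (kernel_integral_le y) _; exact: ler_norm.
- exact: RintegrableZ.
Qed.

End tensor.

(** * Integrals of quaternionic functions *)

Section quaternion_integrals.
Context d (T : measurableType d) (R : realType) (mu : {measure set T -> \bar R}).

(** The basis 1, i, j, k. *)
Definition qe (m : 'I_4) : quat R := \row_(k < 4) (k == m)%:R.

Lemma qcomp_sum (I : Type) (s : seq I) n (F : I -> quat R) :
  qcomp n (\sum_(i <- s) F i) = \sum_(i <- s) qcomp n (F i).
Proof. by apply: (big_morph _ (qcompD n)); rewrite /qcomp mxE. Qed.

Lemma quat_sum_qe (q : quat R) : q = \sum_(m < 4) qcomp m q *: qe m.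
Proof.
apply/rowP => k; rewrite summxE (bigD1 k)//= big1 ?addr0; last first.
  by move=> m mk; rewrite !mxE eq_sym (negbTE mk) mulr0.
by rewrite !mxE eqxx mulr1.
Qed.

(** Each component of a product is linear in the components of the right factor;
    the coefficients are components of p multiplied by basis elements.  This
    reduces quaternionic kernels to real ones. *)
Lemma qcomp_mulr n (p q : quat R) :
  qcomp n (p * q) = \sum_(m < 4) qcomp m q * qcomp n (p * qe m).
Proof.
rewrite {1}(quat_sum_qe q) mulr_sumr qcomp_sum.
by apply: eq_bigr => m _; rewrite -scalerAr qcompZ.
Qed.

Lemma qcomp_mull n (p q : quat R) :
  qcomp n (p * q) = \sum_(m < 4) qcomp m p * qcomp n (qe m * q).
Proof.
rewrite {1}(quat_sum_qe p) mulr_suml qcomp_sum.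
by apply: eq_bigr => m _; rewrite -scalerAl qcompZ.
Qed.

Lemma qe0 : qe 0 = 1.
Proof. by apply/rowP => k; rewrite !mxE; case: k => -[|[|[|[|]]]]. Qed.

Definition qintegrable (h : T -> quat R) :=
  forall n, mu.-integrable setT (EFin \o (fun z => qcomp n (h z))).

Lemma qintegrable_mulrc h w : qintegrable h -> qintegrable (fun z => h z * w).
Proof.
move=> ih n.
have [i _] := @Rintegral_sum _ _ _ mu _ (index_enum 'I_4)
  (fun m z => qcomp n (qe m * w) * qcomp m (h z)) setT measurableT
  (fun m => RintegrableZ (qcomp n (qe m * w)) measurableT (ih m)).
apply: eq_integrable i => // z _ /=; congr EFin.
by rewrite qcomp_mull; apply: eq_bigr => m _; rewrite mulrC.
Qed.

Lemma qintegrable_mullc h w : qintegrable h -> qintegrable (fun z => w * h z).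
Proof.
move=> ih n.
have [i _] := @Rintegral_sum _ _ _ mu _ (index_enum 'I_4)
  (fun m z => qcomp n (w * qe m) * qcomp m (h z)) setT measurableT
  (fun m => RintegrableZ (qcomp n (w * qe m)) measurableT (ih m)).
apply: eq_integrable i => // z _ /=; congr EFin.
by rewrite qcomp_mulr; apply: eq_bigr => m _; rewrite mulrC.
Qed.

Lemma qint_mulr h w : qintegrable h ->
  qint mu setT (fun z => h z * w) = qint mu setT h * w.
Proof.
move=> ih; apply/rowP => n.
rewrite -/(qcomp n _) -[RHS]/(qcomp n _) qcomp_mull.
transitivity (\int[mu]_z (\sum_(m < 4) qcomp n (qe m * w) * qcomp m (h z))).
  rewrite /qcomp mxE; apply: eq_Rintegral => z _.
  by rewrite qcomp_mull; apply: eq_bigr => m _; rewrite mulrC.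
have [_ ->] := @Rintegral_sum _ _ _ mu _ (index_enum 'I_4)
  (fun m z => qcomp n (qe m * w) * qcomp m (h z)) setT measurableT
  (fun m => RintegrableZ (qcomp n (qe m * w)) measurableT (ih m)).
apply: eq_bigr => m _; rewrite RintegralZl// mulrC; congr (_ * _).
by rewrite /qcomp mxE.
Qed.

Lemma qint_mull h w : qintegrable h ->
  qint mu setT (fun z => w * h z) = w * qint mu setT h.
Proof.
move=> ih; apply/rowP => n.
rewrite -/(qcomp n _) -[RHS]/(qcomp n _) qcomp_mulr.
transitivity (\int[mu]_z (\sum_(m < 4) qcomp n (w * qe m) * qcomp m (h z))).
  rewrite /qcomp mxE; apply: eq_Rintegral => z _.
  by rewrite qcomp_mulr; apply: eq_bigr => m _; rewrite mulrC.
have [_ ->] := @Rintegral_sum _ _ _ mu _ (index_enum 'I_4)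
  (fun m z => qcomp n (w * qe m) * qcomp m (h z)) setT measurableT
  (fun m => RintegrableZ (qcomp n (w * qe m)) measurableT (ih m)).
apply: eq_bigr => m _; rewrite RintegralZl// mulrC; congr (_ * _).
by rewrite /qcomp mxE.
Qed.

Definition qbounded (k : T -> quat R) := forall m,
  measurable_fun setT (fun z => qcomp m (k z)) /\ forall z, `|qcomp m (k z)| <= 1.

Lemma qintegrable_mulr h k : qintegrable h -> qbounded k ->
  qintegrable (fun z => h z * k z).
Proof.
move=> ih kb n.
have [i _] := @Rintegral_sum _ _ _ mu _ (index_enum 'I_4)
  (fun m z => qcomp n (h z * qe m) * qcomp m (k z)) setT measurableT
  (fun m => (Rintegral_bounded_factor measurableT (qintegrable_mulrc (qe m) ih n)
     (kb m).1 (kb m).2).1).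
apply: eq_integrable i => // z _ /=; congr EFin.
by rewrite [RHS]qcomp_mulr; apply: eq_bigr => m _; rewrite mulrC.
Qed.

Lemma qintegrable_mull h k : qintegrable h -> qbounded k ->
  qintegrable (fun z => k z * h z).
Proof.
move=> ih kb n.
have [i _] := @Rintegral_sum _ _ _ mu _ (index_enum 'I_4)
  (fun m z => qcomp n (qe m * h z) * qcomp m (k z)) setT measurableT
  (fun m => (Rintegral_bounded_factor measurableT (qintegrable_mullc (qe m) ih n)
     (kb m).1 (kb m).2).1).
apply: eq_integrable i => // z _ /=; congr EFin.
by rewrite [RHS]qcomp_mull; apply: eq_bigr => m _; rewrite mulrC.
Qed.

Lemma ae_qint_eq (D : set T) (f g : T -> quat R) :
  {ae mu, forall z, f z = g z} -> qint mu D f = qint mu D g.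
Proof.
move=> fg; apply/rowP => n; rewrite !mxE; apply: ae_Rintegral_eq.
by apply: filterS fg => z ->.
Qed.

Lemma qcomp_le_qnorm n (q : quat R) : `|qcomp n q| <= qnorm q.
Proof.
rewrite /qnorm -sqrtr_sqr; apply: ler_wsqrtr.
by rewrite (bigD1 n)//= lerDl sumr_ge0// => i _; exact: sqr_ge0.
Qed.

(** The Borel function provided by measurability is integrable because its
    components are almost everywhere below the modulus of f. *)
Lemma qL1_representative f : qL1 mu f ->
  exists2 g : T -> quat R, qintegrable g & {ae mu, forall x, f x = g x}.
Proof.
move=> [[g mg fg] fi]; exists g => // n; apply/integrableP; split.
  exact/measurable_EFinP.
apply: le_lt_trans fi; apply: ge0_le_integral_ae.
- by move=> x; rewrite abse_ge0.
- by move=> x; rewrite lee_fin sqrtr_ge0.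
- by apply: filterS fg => x fgx; rewrite /= lee_fin -fgx qcomp_le_qnorm.
Qed.

End quaternion_integrals.

Section exponentials.
Context (R : realType).
Implicit Types (a b c s t u v : R).

Lemma qcomp_expi a : [/\ qcomp 0 (expi a) = cos a, qcomp 1 (expi a) = sin a,
  qcomp 2%:R (expi a) = 0 & qcomp 3%:R (expi a) = 0].
Proof.
by rewrite /expi !qcompD !qcompZ !qcompE /=; split; ring.
Qed.

Lemma qcomp_expj a : [/\ qcomp 0 (expj a) = cos a, qcomp 1 (expj a) = 0,
  qcomp 2%:R (expj a) = sin a & qcomp 3%:R (expj a) = 0].
Proof.
by rewrite /expj !qcompD !qcompZ !qcompE /=; split; ring.
Qed.

Lemma expiD a b : expi a * expi b = expi (a + b).
Proof.
have [a0 a1 a2 a3] := qcomp_expi a; have [b0 b1 b2 b3] := qcomp_expi b.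
have [c0 c1 c2 c3] := qcomp_expi (a + b).
by apply: quatP; rewrite ?c0 ?c1 ?c2 ?c3 qcompE /= ?a0 ?a1 ?a2 ?a3 ?b0 ?b1 ?b2 ?b3
  ?cosD ?sinD; ring.
Qed.

Lemma expjD a b : expj a * expj b = expj (a + b).
Proof.
have [a0 a1 a2 a3] := qcomp_expj a; have [b0 b1 b2 b3] := qcomp_expj b.
have [c0 c1 c2 c3] := qcomp_expj (a + b).
by apply: quatP; rewrite ?c0 ?c1 ?c2 ?c3 qcompE /= ?a0 ?a1 ?a2 ?a3 ?b0 ?b1 ?b2 ?b3
  ?cosD ?sinD; ring.
Qed.

Lemma expij a b : expi a * expj b =
  mkquat (cos a * cos b) (sin a * cos b) (cos a * sin b) (sin a * sin b).
Proof.
have [a0 a1 a2 a3] := qcomp_expi a; have [b0 b1 b2 b3] := qcomp_expj b.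
by apply: quatP; rewrite !qcompE /= ?a0 ?a1 ?a2 ?a3 ?b0 ?b1 ?b2 ?b3; ring.
Qed.

(** Moving expi c across expj b changes the sign of c in the j and k
    components. *)
Lemma expiji a b c : expi a * expj b * expi c =
  mkquat (cos (a + c) * cos b) (sin (a + c) * cos b)
         (cos (c - a) * sin b) (- sin (c - a) * sin b).
Proof.
have [c0 c1 c2 c3] := qcomp_expi c.
by rewrite expij; apply: quatP; rewrite !qcompE /= ?qcompE /= ?c0 ?c1 ?c2 ?c3
  ?cosD ?sinD ?cosB ?sinB ?cosN ?sinN; ring.
Qed.

Lemma expjij a b c : expj a * expi b * expj c =
  mkquat (cos b * cos (a + c)) (sin b * cos (c - a))
         (cos b * sin (a + c)) (sin b * sin (c - a)).
Proof.
have [a0 a1 a2 a3] := qcomp_expj a.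
by rewrite -mulrA expij; apply: quatP; rewrite !qcompE /= ?qcompE /= ?a0 ?a1 ?a2 ?a3
  ?cosD ?sinD ?cosB ?sinB ?cosN ?sinN; ring.
Qed.

End exponentials.

(** * The partial inversion integrals as double Dirichlet integrals *)

Section ae_products.
Context d (T : measurableType d) (R : realType) (mu : {measure set T -> \bar R}).

Lemma ae_qint_mulr (D : set T) (f g k : T -> quat R) :
  {ae mu, forall z, f z = g z} ->
  qint mu D (fun z => f z * k z) = qint mu D (fun z => g z * k z).
Proof. by move=> fg; apply: ae_qint_eq; apply: filterS fg => z ->. Qed.

Lemma ae_qint_mull (D : set T) (f g k : T -> quat R) :
  {ae mu, forall z, f z = g z} ->
  qint mu D (fun z => k z * f z) = qint mu D (fun z => k z * g z).
Proof. by move=> fg; apply: ae_qint_eq; apply: filterS fg => z ->. Qed.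

End ae_products.

Section plane.
Context (R : realType).
Notation mu := (@lebesgue_measure R).
Notation mu2 := (leb2 R).

(** The squares [-n, n] x [-n, n] exhaust the plane. *)
Lemma sigma_finite_plane : sigma_finite setT mu2.
Proof.
exists (fun n => (`[- n%:R, n%:R] : set (measurableTypeR R)) `*` (`[- n%:R, n%:R] : set (measurableTypeR R))).
  apply/seteqP; split=> // -[x y] _.
  have [n _ nxy] : \forall n \near \oo, Num.max `|x| `|y| <= n%:R.
    exists (Num.truncn (Num.max `|x| `|y|)).+1 => // n /= h.
    apply: le_trans (ltW (truncnS_gt _)) _; first by rewrite ler_nat.
  exists n => //; have := nxy n (leqnn n); rewrite ge_max !ler_norml => /andP[hx hy].
  by split; rewrite /= in_itv.
move=> k; have mk : measurable (`[- k%:R, k%:R] : set (measurableTypeR R)) by exact: measurable_itv.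
split; first exact: measurableX.
have ky := mu_itv_cc_lty (- k%:R : R) k%:R.
have kk : (mu `[(- k%:R)%R, k%:R]%classic * mu `[(- k%:R)%R, k%:R]%classic < +oo)%E.
  by rewrite lte_mul_pinfty// ge0_fin_numE.
have E := @product_measure1E _ _ _ _ R mu mu _ _ mk mk.
by move: kk; rewrite -E; apply.
Qed.

Definition plane_measure : {sigma_finite_measure set (measurableTypeR R * measurableTypeR R)%type -> \bar R} :=
  HB.pack_for {sigma_finite_measure set (measurableTypeR R * measurableTypeR R)%type -> \bar R} (mu \x mu)%E (Measure_isSigmaFinite.Build _ _ _ (mu \x mu)%E sigma_finite_plane).

End plane.

Section partial_inversion.
Context (R : realType).
Notation mu := (@lebesgue_measure R).
Notation mu2 := (leb2 R).
Implicit Types (F : R * R -> R) (a b : R -> R -> R) (c s t u v M N : R).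

(** Two applications of [Rintegral_kernel_swap], first for u and then for v,
    the second one to the function already integrated against a. *)
Lemma box_swap F a b M N : mu2.-integrable setT (EFin \o F) ->
  measurable_fun setT (fun p : R * R => a p.1 p.2) -> (forall u s, `|a u s| <= 1) ->
  measurable_fun setT (fun p : R * R => b p.1 p.2) -> (forall u s, `|b u s| <= 1) ->
  [/\ forall v, mu.-integrable `[- M, M]
        (EFin \o (fun u => \int[mu2]_z (F z * (a u z.1 * b v z.2)))),
      mu.-integrable `[- N, N] (EFin \o (fun v => \int[mu]_(u in `[- M, M])
        \int[mu2]_z (F z * (a u z.1 * b v z.2)))) &
      \int[mu]_(v in `[- N, N]) \int[mu]_(u in `[- M, M])
        \int[mu2]_z (F z * (a u z.1 * b v z.2)) =
      \int[mu2]_z (F z * ((\int[mu]_(u in `[- M, M]) a u z.1) *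
        (\int[mu]_(v in `[- N, N]) b v z.2)))].
Proof.
move=> iF ma a1 mb b1.
pose nu := plane_measure R.
pose A : set (measurableTypeR R) := `[- M, M]%classic.
pose B : set (measurableTypeR R) := `[- N, N]%classic.
have mA : measurable A by exact: measurable_itv.
have mB : measurable B by exact: measurable_itv.
have Aoo : (mu A < +oo)%E by exact: mu_itv_cc_lty.
have Boo : (mu B < +oo)%E by exact: mu_itv_cc_lty.
pose ka (p : measurableTypeR R * (measurableTypeR R * measurableTypeR R)) : R := a p.1 p.2.1.
pose kb (p : measurableTypeR R * (measurableTypeR R * measurableTypeR R)) : R := b p.1 p.2.2.
have m1 : measurable_fun setT (fun p : measurableTypeR R * (measurableTypeR R * measurableTypeR R) => (p.1, p.2.1)).
  apply: measurable_fun_pair; first exact: measurable_fst.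
  exact: measurableT_comp measurable_fst measurable_snd.
have m2 : measurable_fun setT (fun p : measurableTypeR R * (measurableTypeR R * measurableTypeR R) => (p.1, p.2.2)).
  apply: measurable_fun_pair; first exact: measurable_fst.
  exact: measurableT_comp measurable_snd measurable_snd.
have mka : measurable_fun setT ka by exact: (measurableT_comp ma m1).
have mkb : measurable_fun setT kb by exact: (measurableT_comp mb m2).
have ka1 p : `|ka p| <= 1 by exact: a1.
have kb1 p : `|kb p| <= 1 by exact: b1.
have mbv v : measurable_fun setT (fun z : measurableTypeR R * measurableTypeR R => b v z.2).
  exact: (measurableT_comp mkb (pair1_measurable v)).
have iFb v := (Rintegral_bounded_factor measurableT iF (mbv v) (fun z => b1 v z.2)).1.
(* For fixed v the factor b v belongs to the integrable function. *)
have E1 v u : \int[mu2]_z (F z * b v z.2 * ka (u, z)) =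
    \int[mu2]_z (F z * (a u z.1 * b v z.2)).
  by apply: eq_Rintegral => z _; rewrite /ka/=; ring.
have E2 v : \int[mu]_(u in A) \int[mu2]_z (F z * (a u z.1 * b v z.2)) =
    \int[mu2]_z (F z * (\int[mu]_(u in A) a u z.1) * kb (v, z)).
  transitivity (\int[mu]_(u in A) \int[mu2]_z (F z * b v z.2 * ka (u, z))).
    by apply: eq_Rintegral => u _; rewrite E1.
  rewrite [LHS](@Rintegral_kernel_swap _ _ _ _ R mu nu _ _ _ mA Aoo (iFb v) mka ka1).
  by apply: eq_Rintegral => z _; rewrite /ka /kb/=; ring.
have iG := @integrable_kernel_factor _ _ _ _ R mu nu _ _ _ mA Aoo iF mka ka1.
split.
- move=> v; apply: eq_integrable (@integrable_kernel_integral _ _ _ _ R mu nu _ _ _ mA Aoo (iFb v) mka ka1) => //.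
  by move=> u _ /=; congr EFin; rewrite E1.
- apply: eq_integrable (@integrable_kernel_integral _ _ _ _ R mu nu _ _ _ mB Boo iG mkb kb1) => //.
  by move=> v _ /=; congr EFin; rewrite E2.
- transitivity (\int[mu]_(v in B) \int[mu2]_z (F z * (\int[mu]_(u in A) a u z.1) * kb (v, z))).
    by apply: eq_Rintegral => v _; rewrite E2.
  rewrite [LHS](@Rintegral_kernel_swap _ _ _ _ R mu nu _ _ _ mB Boo iG mkb kb1).
  by apply: eq_Rintegral => z _; rewrite /kb/=; ring.
Qed.

Lemma Rintegral_sin_sym c M : 0 <= M -> \int[mu]_(u in `[- M, M]) sin (u * c) = 0.
Proof.
move=> M0; have [->|c0] := eqVneq c 0.
  under eq_Rintegral do rewrite mulr0 sin0.
  by rewrite Rintegral_cst// mul0r.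
have cf : continuous (fun u : R => sin (u * c)).
  under eq_fun do rewrite mulrC.
  exact: (lip_continuous (lip_scale c ler01 (@lip_sin R))).
pose G (u : R) := - cos (u * c) / c.
have dG x : is_derive x (1:R) G (sin (x * c)).
  by apply: is_derive_eq; rewrite /GRing.scale/=; field.
rewrite (FTC_cc _ cf dG); last by rewrite ge0_cp.
by rewrite /G (mulNr M c) cosN subrr.
Qed.

Lemma measurable_cos_lin c (sg : R) : measurable_fun setT (fun p : R * R => cos (p.1 * (c + sg * p.2))).
Proof.
apply: (measurableT_comp (continuous_measurable_fun (@continuous_cos R))).
apply: measurable_funM; first exact: measurable_fst.
by apply: measurable_funD => //; apply: measurable_funM => //; exact: measurable_snd.
Qed.

Lemma measurable_sin_lin c (sg : R) : measurable_fun setT (fun p : R * R => sin (p.1 * (c + sg * p.2))).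
Proof.
apply: (measurableT_comp (continuous_measurable_fun (@continuous_sin R))).
apply: measurable_funM; first exact: measurable_fst.
by apply: measurable_funD => //; apply: measurable_funM => //; exact: measurable_snd.
Qed.

(** Of the four components of the kernel only the real one has an integral over
    the symmetric box that does not vanish. *)
Lemma box_sum (G : 'I_4 -> R * R -> R) (a b : 'I_4 -> R -> R -> R) M N x0 y0 :
  0 <= M -> 0 <= N ->
  (forall m, mu2.-integrable setT (EFin \o G m)) ->
  (forall m, measurable_fun setT (fun p : R * R => a m p.1 p.2)) ->
  (forall m u s, `|a m u s| <= 1) ->
  (forall m, measurable_fun setT (fun p : R * R => b m p.1 p.2)) ->
  (forall m u s, `|b m u s| <= 1) ->
  (forall s, \int[mu]_(u in `[- M, M]) a 0 u s = dker M (s - x0)) ->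
  (forall t, \int[mu]_(v in `[- N, N]) b 0 v t = dker N (t - y0)) ->
  (forall m s t, m != 0 -> (\int[mu]_(u in `[- M, M]) a m u s) *
     (\int[mu]_(v in `[- N, N]) b m v t) = 0) ->
  \int[mu]_(v in `[- N, N]) \int[mu]_(u in `[- M, M])
    (\sum_(m < 4) \int[mu2]_z (G m z * (a m u z.1 * b m v z.2))) =
  \int[mu2]_z (G 0 z * (dker M (z.1 - x0) * dker N (z.2 - y0))).
Proof.
move=> M0 N0 iG ma a1 mb b1 a0E b0E abE.
have H m := box_swap M N (iG m) (ma m) (a1 m) (mb m) (b1 m).
transitivity (\int[mu]_(v in `[- N, N]) (\sum_(m < 4) \int[mu]_(u in `[- M, M])
    \int[mu2]_z (G m z * (a m u z.1 * b m v z.2)))).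
  apply: eq_Rintegral => v _.
  have Hi m : mu.-integrable `[- M, M]
      (EFin \o (fun u => \int[mu2]_z (G m z * (a m u z.1 * b m v z.2)))).
    by have [h _ _] := H m; exact: h.
  have mD : measurable (`[- M, M]%classic : set (measurableTypeR R)) by exact: measurable_itv.
  exact: (Rintegral_sum (index_enum 'I_4) mD Hi).2.
have Hi m : mu.-integrable `[- N, N] (EFin \o (fun v => \int[mu]_(u in `[- M, M])
        \int[mu2]_z (G m z * (a m u z.1 * b m v z.2)))).
  by have [_ h _] := H m.
have mD : measurable (`[- N, N]%classic : set (measurableTypeR R)) by exact: measurable_itv.
rewrite [LHS](Rintegral_sum (index_enum 'I_4) mD Hi).2.
rewrite (bigD1 0)//= big1 ?addr0; last first.
  move=> m m0; have [_ _ ->] := H m.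
  under eq_Rintegral do rewrite abE// mulr0.
  by rewrite Rintegral_cst// mul0r.
by have [_ _ ->] := H 0; apply: eq_Rintegral => z _; rewrite a0E b0E.
Qed.

Variables (f g : R * R -> quat R).
Hypothesis ig : qintegrable mu2 g.
Hypothesis fg : {ae mu2, forall z, f z = g z}.

Lemma dker_cos x0 s M : \int[mu]_(u in `[- M, M]) cos (u * (x0 - s)) = dker M (s - x0).
Proof. by rewrite -dkerN opprB. Qed.

Lemma abs_mul_le1 (p q : R) : `|p| <= 1 -> `|q| <= 1 -> `|p * q| <= 1.
Proof. by move=> p1 q1; rewrite normrM mulr_ile1. Qed.

Lemma abs_cos_le1 (x : R) : `|cos x| <= 1.
Proof. by rewrite ler_norml cos_geN1 cos_le1. Qed.

Lemma abs_sin_le1 (x : R) : `|sin x| <= 1.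
Proof. by rewrite ler_norml sin_geN1 sin_le1. Qed.

Lemma measurable_mul_fst u (h : R -> R) : continuous h ->
  measurable_fun setT (fun z : R * R => h (- (u * z.1))).
Proof.
move=> ch; apply: (measurableT_comp (continuous_measurable_fun ch)).
by apply: measurable_funN; apply: measurable_funM => //; exact: measurable_fst.
Qed.

Lemma measurable_mul_snd u (h : R -> R) : continuous h ->
  measurable_fun setT (fun z : R * R => h (- (u * z.2))).
Proof.
move=> ch; apply: (measurableT_comp (continuous_measurable_fun ch)).
by apply: measurable_funN; apply: measurable_funM => //; exact: measurable_snd.
Qed.

Lemma measurable_kernel_section a b u v :
  measurable_fun setT (fun p : R * R => a p.1 p.2) ->
  measurable_fun setT (fun p : R * R => b p.1 p.2) ->
  measurable_fun setT (fun z : measurableTypeR R * measurableTypeR R => a u z.1 * b v z.2).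
Proof.
have m1 w : measurable_fun setT (fun z : measurableTypeR R * measurableTypeR R => (w, z.1) : measurableTypeR R * measurableTypeR R).
  by apply: measurable_fun_pair => //; exact: measurable_fst.
have m2 w : measurable_fun setT (fun z : measurableTypeR R * measurableTypeR R => (w, z.2) : measurableTypeR R * measurableTypeR R).
  by apply: measurable_fun_pair => //; exact: measurable_snd.
move=> ma mb; apply: measurable_funM.
  exact: (measurableT_comp ma (m1 u)).
exact: (measurableT_comp mb (m2 v)).
Qed.

(** The components are products of a sine or cosine in s and one in t. *)
Lemma qbounded_kernel u v :
  @qbounded _ _ R (fun z : measurableTypeR R * measurableTypeR R =>
     expi (- (u * z.1)) * expj (- (v * z.2))).
Proof.
have H (h h' : R -> R) : continuous h -> continuous h' ->
    (forall x, `|h x| <= 1) -> (forall x, `|h' x| <= 1) ->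
    measurable_fun setT (fun z : R * R => h (- (u * z.1)) * h' (- (v * z.2))) /\
    forall z : R * R, `|h (- (u * z.1)) * h' (- (v * z.2))| <= 1.
  move=> ch ch' h1 h1'; split; last by move=> z; exact: abs_mul_le1.
  by apply: measurable_funM; [exact: measurable_mul_fst|exact: measurable_mul_snd].
move=> m.
have E (z : measurableTypeR R * measurableTypeR R) := expij (- (u * z.1)) (- (v * z.2)).
have [mh bh] : measurable_fun setT (fun z : R * R =>
    [:: cos (- (u * z.1)) * cos (- (v * z.2)); sin (- (u * z.1)) * cos (- (v * z.2));
        cos (- (u * z.1)) * sin (- (v * z.2)); sin (- (u * z.1)) * sin (- (v * z.2))]`_m) /\
   forall z : R * R, `|[:: cos (- (u * z.1)) * cos (- (v * z.2)); sin (- (u * z.1)) * cos (- (v * z.2));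
        cos (- (u * z.1)) * sin (- (v * z.2)); sin (- (u * z.1)) * sin (- (v * z.2))]`_m| <= 1.
  by case: m => -[|[|[|[|//]]]] im /=; apply: H;
    first [exact: continuous_cos|exact: continuous_sin|exact: abs_cos_le1|exact: abs_sin_le1].
split; last by move=> z; rewrite E qcompE; exact: bh.
by under eq_fun do rewrite E qcompE; exact: mh.
Qed.

(** The kernel acting on the right of f is expi(-us) expj(v(y0 - t)) expi(u x0).
    Its components, by [expiji], are cos(u(x0 - s)) cos(v(y0 - t)) for the real
    one, and for i, j, k a product with at least one sine in u or in v. *)
Lemma inversion_kernel_right n M N x0 y0 : 0 <= M -> 0 <= N ->
  qcomp n (qint_box M N (fun u v => QFT_right f u v * expj (v * y0) * expi (u * x0))) =
  \int[mu2]_z (qcomp n (g z) * (dker M (z.1 - x0) * dker N (z.2 - y0))).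
Proof.
move=> M0 N0.
pose a (m : 'I_4) u s := [:: cos (u * (x0 + -1 * s)); sin (u * (x0 + -1 * s));
   cos (u * (x0 + 1 * s)); - sin (u * (x0 + 1 * s))]`_m.
pose b (m : 'I_4) v t := [:: cos (v * (y0 + -1 * t)); cos (v * (y0 + -1 * t));
   sin (v * (y0 + -1 * t)); sin (v * (y0 + -1 * t))]`_m.
have a1 m u s : `|a m u s| <= 1.
  by case: m => -[|[|[|[|//]]]] im; rewrite /a/= ?normrN; first [exact: abs_cos_le1|exact: abs_sin_le1].
have b1 m v t : `|b m v t| <= 1.
  by case: m => -[|[|[|[|//]]]] im; rewrite /b/=; first [exact: abs_cos_le1|exact: abs_sin_le1].
have ma m : measurable_fun setT (fun p : R * R => a m p.1 p.2).
  by case: m => -[|[|[|[|//]]]] im; rewrite /a/=; try apply: measurable_funN;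
    first [exact: measurable_cos_lin|exact: measurable_sin_lin].
have mb m : measurable_fun setT (fun p : R * R => b m p.1 p.2).
  by case: m => -[|[|[|[|//]]]] im; rewrite /b/=;
    first [exact: measurable_cos_lin|exact: measurable_sin_lin].
pose G (m : 'I_4) z := qcomp n (g z * qe R m).
have iG m : mu2.-integrable setT (EFin \o G m) by exact: qintegrable_mulrc.
have GE z : qcomp n (g z) = G 0 z by rewrite /G qe0 mulr1.
transitivity (\int[mu]_(v in `[- N, N]) \int[mu]_(u in `[- M, M])
    (\sum_(m < 4) \int[mu2]_z (G m z * (a m u z.1 * b m v z.2)))); last first.
  rewrite (box_sum (x0 := x0) (y0 := y0))//.
  - by apply: eq_Rintegral => z _; rewrite GE.
  - by move=> s; rewrite -dker_cos; apply: eq_Rintegral => u _; rewrite /a/= mulN1r.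
  - by move=> s; rewrite -dker_cos; apply: eq_Rintegral => u _; rewrite /b/= mulN1r.
  - move=> m s t; case: m => -[|[|[|[|//]]]] im //= _; rewrite /a /b /=.
    + by rewrite (Rintegral_sin_sym _ M0) mul0r.
    + by rewrite (Rintegral_sin_sym _ N0) mulr0.
    + by rewrite (Rintegral_sin_sym _ N0) mulr0.
rewrite /qint_box /qint /qcomp mxE; apply: eq_Rintegral => v _.
rewrite /qcomp mxE; apply: eq_Rintegral => u _.
have qk := qbounded_kernel u v.
have -> : QFT_right f u v = qint mu2 setT (fun z => g z * (expi (- (u * z.1)) * expj (- (v * z.2)))).
  by rewrite -(ae_qint_mulr _ _ fg); congr qint; apply/funext => z; rewrite mulrA.
rewrite -mulrA -(qint_mulr _ (qintegrable_mulr ig qk)).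
rewrite /qint /qcomp mxE.
have abk z : g z * (expi (- (u * z.1)) * expj (- (v * z.2))) * (expj (v * y0) * expi (u * x0)) =
    g z * mkquat (a 0 u z.1 * b 0 v z.2) (a 1 u z.1 * b 1 v z.2)
      (a 2%:R u z.1 * b 2%:R v z.2) (a 3%:R u z.1 * b 3%:R v z.2).
  rewrite -mulrA; congr (_ * _).
  rewrite !mulrA -(mulrA (expi _) (expj _) (expj _)) expjD expiji /a /b /=.
  have -> : - (v * z.2) + v * y0 = v * (y0 + -1 * z.2) by ring.
  have -> : - (u * z.1) + u * x0 = u * (x0 + -1 * z.1) by ring.
  by have -> : u * x0 - - (u * z.1) = u * (x0 + 1 * z.1) by ring.
transitivity (\int[mu2]_z \sum_(m < 4) (G m z * (a m u z.1 * b m v z.2))).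
  apply: eq_Rintegral => z _; rewrite abk -/(qcomp n _) qcomp_mulr.
  apply: eq_bigr => m _; rewrite mulrC; congr (_ * _).
  by rewrite qcompE; case: m => -[|[|[|[|//]]]] im.
have iGk m : mu2.-integrable setT (EFin \o (fun z => G m z * (a m u z.1 * b m v z.2))).
  apply: (Rintegral_bounded_factor measurableT (iG m) _ _).1; last first.
    by move=> z; exact: abs_mul_le1.
  exact: measurable_kernel_section (ma m) (mb m).
rewrite [LHS](Rintegral_sum (index_enum 'I_4) measurableT iGk).2//.
Qed.

(** The kernel acting on the left of f is expj(v y0) expi(u(x0 - s)) expj(-vt);
    the argument is that of [inversion_kernel_right], with the roles of i and j
    exchanged and [expjij] in place of [expiji]. *)
Lemma inversion_kernel_left n M N x0 y0 : 0 <= M -> 0 <= N ->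
  qcomp n (qint_box M N (fun u v => expj (v * y0) * expi (u * x0) * QFT_left f u v)) =
  \int[mu2]_z (qcomp n (g z) * (dker M (z.1 - x0) * dker N (z.2 - y0))).
Proof.
move=> M0 N0.
pose a (m : 'I_4) u s := [:: cos (u * (x0 + -1 * s)); sin (u * (x0 + -1 * s));
   cos (u * (x0 + -1 * s)); sin (u * (x0 + -1 * s))]`_m.
pose b (m : 'I_4) v t := [:: cos (v * (y0 + -1 * t)); cos (v * (y0 + 1 * t));
   sin (v * (y0 + -1 * t)); - sin (v * (y0 + 1 * t))]`_m.
have a1 m u s : `|a m u s| <= 1.
  by case: m => -[|[|[|[|//]]]] im; rewrite /a/= ?normrN; first [exact: abs_cos_le1|exact: abs_sin_le1].
have b1 m v t : `|b m v t| <= 1.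
  by case: m => -[|[|[|[|//]]]] im; rewrite /b/= ?normrN; first [exact: abs_cos_le1|exact: abs_sin_le1].
have ma m : measurable_fun setT (fun p : R * R => a m p.1 p.2).
  by case: m => -[|[|[|[|//]]]] im; rewrite /a/=;
    first [exact: measurable_cos_lin|exact: measurable_sin_lin].
have mb m : measurable_fun setT (fun p : R * R => b m p.1 p.2).
  by case: m => -[|[|[|[|//]]]] im; rewrite /b/=; try apply: measurable_funN;
    first [exact: measurable_cos_lin|exact: measurable_sin_lin].
pose G (m : 'I_4) z := qcomp n (qe R m * g z).
have iG m : mu2.-integrable setT (EFin \o G m) by exact: qintegrable_mullc.
have GE z : qcomp n (g z) = G 0 z by rewrite /G qe0 mul1r.
transitivity (\int[mu]_(v in `[- N, N]) \int[mu]_(u in `[- M, M])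
    (\sum_(m < 4) \int[mu2]_z (G m z * (a m u z.1 * b m v z.2)))); last first.
  rewrite (box_sum (x0 := x0) (y0 := y0))//.
  - by apply: eq_Rintegral => z _; rewrite GE.
  - by move=> s; rewrite -dker_cos; apply: eq_Rintegral => u _; rewrite /a/= mulN1r.
  - by move=> s; rewrite -dker_cos; apply: eq_Rintegral => u _; rewrite /b/= mulN1r.
  - move=> m s t; case: m => -[|[|[|[|//]]]] im //= _; rewrite /a /b /=.
    + by rewrite (Rintegral_sin_sym _ M0) mul0r.
    + by rewrite (Rintegral_sin_sym _ N0) mulr0.
    + by rewrite (Rintegral_sin_sym _ M0) mul0r.
rewrite /qint_box /qint /qcomp mxE; apply: eq_Rintegral => v _.
rewrite /qcomp mxE; apply: eq_Rintegral => u _.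
have qk := qbounded_kernel u v.
have -> : QFT_left f u v = qint mu2 setT (fun z => expi (- (u * z.1)) * expj (- (v * z.2)) * g z).
  by rewrite -(ae_qint_mull _ _ fg); congr qint; apply/funext => z; rewrite mulrA.
rewrite -(qint_mull _ (qintegrable_mull ig qk)).
rewrite /qint /qcomp mxE.
have abk z : expj (v * y0) * expi (u * x0) * (expi (- (u * z.1)) * expj (- (v * z.2)) * g z) =
    mkquat (a 0 u z.1 * b 0 v z.2) (a 1 u z.1 * b 1 v z.2)
      (a 2%:R u z.1 * b 2%:R v z.2) (a 3%:R u z.1 * b 3%:R v z.2) * g z.
  rewrite mulrA; congr (_ * _).
  rewrite !mulrA -(mulrA (expj _) (expi _) (expi _)) expiD expjij /a /b /=.
  have -> : v * y0 + - (v * z.2) = v * (y0 + -1 * z.2) by ring.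
  have -> : u * x0 + - (u * z.1) = u * (x0 + -1 * z.1) by ring.
  have -> : - (v * z.2) - v * y0 = - (v * (y0 + 1 * z.2)) by ring.
  by rewrite cosN sinN.
transitivity (\int[mu2]_z \sum_(m < 4) (G m z * (a m u z.1 * b m v z.2))).
  apply: eq_Rintegral => z _; rewrite abk -/(qcomp n _) qcomp_mull.
  apply: eq_bigr => m _; rewrite mulrC; congr (_ * _).
  by rewrite qcompE; case: m => -[|[|[|[|//]]]] im.
have iGk m : mu2.-integrable setT (EFin \o (fun z => G m z * (a m u z.1 * b m v z.2))).
  apply: (Rintegral_bounded_factor measurableT (iG m) _ _).1; last first.
    by move=> z; exact: abs_mul_le1.
  exact: measurable_kernel_section (ma m) (mb m).
rewrite [LHS](Rintegral_sum (index_enum 'I_4) measurableT iGk).2//.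
Qed.

End partial_inversion.

(** * Folding the plane and the regions away from the axes *)

Section almost_everywhere.
Context d (T : measurableType d) (R : realType) (mu : {measure set T -> \bar R}).
Implicit Types P Q : T -> Prop.

Lemma ae_imp P Q : (forall x, P x -> Q x) -> {ae mu, forall x, P x} -> {ae mu, forall x, Q x}.
Proof. by move=> PQ; apply: filterS. Qed.

Lemma ae_and P Q : {ae mu, forall x, P x} -> {ae mu, forall x, Q x} ->
  {ae mu, forall x, P x /\ Q x}.
Proof. exact: filterI. Qed.

End almost_everywhere.

Section swap.
Context d1 d2 (T1 : measurableType d1) (T2 : measurableType d2) (R : realType).
Variable m1 : {sigma_finite_measure set T1 -> \bar R}.
Variable m2 : {sigma_finite_measure set T2 -> \bar R}.

(** The measure of a product computed by sections in one variable or in the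
    other is the same, so the exchange of coordinates preserves null sets. *)
Lemma ae_swap (P : T1 * T2 -> Prop) :
  {ae (m1 \x m2)%E, forall z, P z} -> {ae (m2 \x m1)%E, forall z, P (z.2, z.1)}.
Proof.
have ms : measurable_fun setT (fun z : T2 * T1 => (z.2, z.1)).
  by apply: measurable_fun_pair; [exact: measurable_snd|exact: measurable_fst].
move=> [N [mN N0 PN]]; exists ((fun z : T2 * T1 => (z.2, z.1)) @^-1` N); split.
- by rewrite -[X in measurable X]setTI; exact: ms.
- rewrite -[RHS]N0 (@product_measure_unique _ _ _ _ _ m1 m2 (m1 \x^ m2)%E)//.
    by move=> A B mA mB; exact: product_measure2E.
- by move=> z /= Pz; exact: PN.
Qed.
End swap.

Section fold.
Context (R : realType).
Notation mu := (@lebesgue_measure R).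
Notation mu2 := (leb2 R).

Lemma ae_off_axes : {ae mu2, forall z : R * R, z.1 != 0 /\ z.2 != 0}.
Proof.
pose O : set (measurableTypeR R) := [set 0]; pose T : set (measurableTypeR R) := setT.
have mO : measurable O by exact: measurable_set1.
have mT : measurable T by exact: measurableT.
have O0 : mu O = 0%E by exact: lebesgue_measure_set1.
exists ((O `*` T) `|` (T `*` O)); split.
- by apply: measurableU; exact: measurableX.
- have E1 := @product_measure1E _ _ _ _ R mu mu _ _ mO mT.
  have E2 := @product_measure1E _ _ _ _ R mu mu _ _ mT mO.
  have Z1 : (mu O * mu T = 0)%E by rewrite O0 mul0e.
  have Z2 : (mu T * mu O = 0)%E by rewrite O0 mule0.
  rewrite [LHS]measureU0; last exact: (etrans E2 Z2).
  - exact: (etrans E1 Z1).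
  - exact: measurableX.
  - exact: measurableX.
- move=> [x y] /= /not_andP[] /negP; rewrite negbK => /eqP ->; by [left|right].
Qed.

Lemma indic_gt0 (x : R) : \1_(`]0, +oo[%classic : set R) x = ((0 < x)%R)%:R :> R.
Proof.
rewrite indicE; congr (_ %:R); congr nat_of_bool.
by apply/idP/idP => [/set_mem|h]; rewrite ?inE/= in_itv/= andbT.
Qed.

(** The four reflections around (x0, y0) carry the open quadrants onto the first
    one, and the axes are null sets. *)
Lemma fold_quadrants (h : R * R -> R) x0 y0 : mu2.-integrable setT (EFin \o h) ->
  (forall b : bool * bool, mu2.-integrable setT (EFin \o (fun z =>
     \1_(`]0, +oo[%classic : set R) z.1 * \1_(`]0, +oo[%classic : set R) z.2 *
       h (refl_shift2 x0 y0 b.1 b.2 z)))) /\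
  \int[mu2]_z h z = \sum_(b : bool * bool)
    \int[mu2]_z (\1_(`]0, +oo[%classic : set R) z.1 * \1_(`]0, +oo[%classic : set R) z.2 *
       h (refl_shift2 x0 y0 b.1 b.2 z)).
Proof.
move=> ih; set P := (`]0, +oo[%classic : set R).
have mP : measurable (P : set (measurableTypeR R)) by exact: measurable_itv.
have [ih0 h0E] := Rintegral_refl_shift2 x0 y0 false false ih.
pose h0 := h \o refl_shift2 x0 y0 false false.
(* The part of the centred function that lies in the quadrant with signs b. *)
pose F (b : bool * bool) (z : R * R) :=
  h0 z * (\1_P ((-1) ^+ b.1 * z.1) * \1_P ((-1) ^+ b.2 * z.2)).
have mF (b : bool * bool) : measurable_fun setT (fun z : measurableTypeR R * measurableTypeR R =>
    \1_P ((-1) ^+ b.1 * z.1) * \1_P ((-1) ^+ b.2 * z.2) : R).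
  apply: measurable_funM.
    apply: (measurableT_comp (measurable_indic mP)).
    by apply: measurable_funM => //; exact: measurable_fst.
  apply: (measurableT_comp (measurable_indic mP)).
  by apply: measurable_funM => //; exact: measurable_snd.
have iF b : mu2.-integrable setT (EFin \o F b).
  apply: (Rintegral_bounded_factor measurableT ih0 (mF b) _).1 => z.
  by rewrite !indic_gt0 -natrM normr_nat lern1; case: (_ < _); case: (_ < _).
have iF' b := Rintegral_refl_shift2 0 0 b.1 b.2 (iF b).
have FE (b : bool * bool) z : F b (refl_shift2 0 0 b.1 b.2 z) = \1_P z.1 * \1_P z.2 * h (refl_shift2 x0 y0 b.1 b.2 z).
  rewrite /F /h0 /refl_shift2 /refl_shift /= mulrC !add0r !mulrA -!signr_addb !addbb expr0 !mul1r.
  by [].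
split=> [b|].
  have [h1 _] := iF' b; apply: eq_integrable h1 => // z _ /=; by rewrite FE.
transitivity (\int[mu2]_z \sum_(b : bool * bool) F b z).
  rewrite -h0E; apply: ae_Rintegral_eq; apply: ae_imp ae_off_axes => z [z1 z2].
  rewrite -mulr_sumr -[LHS]mulr1; congr (_ * _); apply/esym.
  rewrite -(pair_bigA _ (fun b1 b2 : bool => \1_P ((-1) ^+ b1 * z.1) * \1_P ((-1) ^+ b2 * z.2)))/=.
  rewrite !big_bool /= !indic_gt0 !expr1 !expr0 !mul1r !mulN1r !oppr_gt0.
  case: (ltgtP z.1 0) z1 => // _ _; case: (ltgtP z.2 0) z2 => // _ _ /=; ring.
rewrite [LHS](Rintegral_sum _ measurableT iF).2; apply: eq_bigr => b _.
have [_ <-] := iF' b.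
by apply: eq_Rintegral => z _; rewrite FE.
Qed.

End fold.

Section far.
Context (R : realType).
Notation mu := (@lebesgue_measure R).
Notation mu2 := (leb2 R).
Implicit Types (G : R * R -> R) (h : R -> R) (d e M N s t : R).

(** The factor 2 / s of the Dirichlet kernel, cut off at d so as to be bounded. *)
Definition recip d s : R := \1_(`]d, +oo[%classic : set R) s * (2 * s^-1).

Lemma measurable_recip d : measurable_fun setT (recip d).
Proof.
apply: measurable_funM; last by apply: measurable_funM => //; exact: measurable_invr.
by apply: measurable_indic; exact: measurable_itv.
Qed.

Lemma recip_le d s : 0 < d -> `|recip d s| <= 2 / d.
Proof.
move=> d0; rewrite /recip indicE; case: (boolP (s \in _)) => [/set_mem|_].
  rewrite /= in_itv/= andbT => ds.
  have s0 := lt_trans d0 ds.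
  rewrite mul1r ger0_norm; last by rewrite divr_ge0// ltW.
  by rewrite ler_pM2l// lef_pV2 ?posrE// ltW.
by rewrite mul0r normr0; apply: divr_ge0 => //; exact: ltW.
Qed.

Lemma recip_dker d M s : 0 <= d -> 0 <= M ->
  \1_(`]d, +oo[%classic : set R) s * dker M s = recip d s * sin (M * s).
Proof.
move=> d0 M0; rewrite /recip indicE; case: (boolP (s \in _)) => [/set_mem|_]; last by rewrite !mul0r.
rewrite /= in_itv/= andbT => ds.
by rewrite !mul1r dker_sin// gt_eqF// (le_lt_trans d0).
Qed.

Lemma integrable_mul_bounded disp (T : measurableType disp) (m : {measure set T -> \bar R})
  (f k : T -> R) C : m.-integrable setT (EFin \o f) -> measurable_fun setT k ->
  (forall x, `|k x| <= C) -> m.-integrable setT (EFin \o (fun x => f x * k x)).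
Proof.
move=> iF mk kC.
have mf : measurable_fun setT f by have /measurable_int/measurable_EFinP := iF.
apply: (@le_Rintegrable _ _ _ m _ (fun x => C * f x)) => //.
- exact: measurable_funM.
- by move=> x _; rewrite !normrM mulrC ler_wpM2r// (le_trans (kC x))// ler_norm.
- exact: RintegrableZ.
Qed.

Lemma measurable_recip_snd d : measurable_fun setT
  (fun z : measurableTypeR R * measurableTypeR R => recip d z.2).
Proof. exact: (measurableT_comp (measurable_recip d) measurable_snd). Qed.

Lemma measurable_recip_fst d : measurable_fun setT
  (fun z : measurableTypeR R * measurableTypeR R => recip d z.1).
Proof. exact: (measurableT_comp (measurable_recip d) measurable_fst). Qed.

Lemma measurable_sinM M : measurable_fun setT (fun s => sin (M * s)).
Proof.
by apply: (measurableT_comp (continuous_measurable_fun (@continuous_sin R))); exact: measurable_funM.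
Qed.

(** Both factors 2 / s and 2 / t are bounded, so this is the Riemann-Lebesgue
    lemma for the variable t, uniformly in the bounded factor sin(M s). *)
Lemma far_far G e1 e2 e : 0 < e1 -> 0 < e2 -> mu2.-integrable setT (EFin \o G) -> 0 < e ->
  \forall N \near +oo, forall M, 0 < M ->
    `|\int[mu2]_z (\1_(`]e1, +oo[%classic : set R) z.1 * \1_(`]e2, +oo[%classic : set R) z.2 *
       (G z * (dker M z.1 * dker N z.2)))| <= e.
Proof.
move=> e10 e20 iG e0.
have iH : mu2.-integrable setT (EFin \o (fun z => G z * recip e1 z.1 * recip e2 z.2)).
  have i1 := integrable_mul_bounded iG (measurable_recip_fst e1) (fun z => recip_le z.1 e10).
  exact: (integrable_mul_bounded i1 (measurable_recip_snd e2) (fun z => recip_le z.2 e20)).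
have N0 : \forall N \near +oo, 0 < N :> R by exact: nbhs_pinfty_gt.
apply: (filterS _ (filterI N0 (riemann_lebesgue2 iH e0))) => N [{}N0 HN] M M0.
apply: le_trans (HN _ (measurable_sinM M) (fun s => abs_sin_le1 (M * s))).
rewrite le_eqVlt; apply/orP; left; apply/eqP; congr `| _ |.
apply: eq_Rintegral => z _.
have a1 := recip_dker z.1 (ltW e10) (ltW M0); have a2 := recip_dker z.2 (ltW e20) (ltW N0).
rewrite (_ : _ * _ * (G z * _) = G z * (\1_(`]e1, +oo[%classic : set R) z.1 * dker M z.1) *
  (\1_(`]e2, +oo[%classic : set R) z.2 * dker N z.2)); last by ring.
rewrite a1 a2; ring.
Qed.

(** Fubini. *)
Lemma Rintegral_tensor (f g : R -> R) : mu.-integrable setT (EFin \o f) ->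
  mu.-integrable setT (EFin \o g) ->
  \int[mu2]_z (f z.1 * g z.2) = (\int[mu]_s f s) * \int[mu]_t g t.
Proof.
move=> ia ib; rewrite (Rintegral_fubini1 (integrable_tensor ia ib)) [RHS]mulrC.
rewrite -RintegralZl//; apply: eq_Rintegral => s _ /=.
by rewrite RintegralZl// mulrC.
Qed.

(** Write G as (G - h) + h.  The difference divided by s is integrable, so the
    kernel in s leaves only the bounded factor 2 sin(M s) and the plane lemma
    applies.  The function h of t alone gives a product, whose factor in s is
    bounded by [dker_int_le] and whose factor in t tends to 0.  Both bounds are
    uniform in M. *)
Lemma far_near G h e1 e2 e : 0 < e1 -> 0 < e2 -> 
  mu2.-integrable setT (EFin \o (fun z => \1_(`]0, e1]%classic : set R) z.1 *
    \1_(`]e2, +oo[%classic : set R) z.2 * ((G z - h z.2) * z.1^-1))) ->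
  mu.-integrable setT (EFin \o h) -> 0 < e ->
  \forall N \near +oo, forall M, 0 < M ->
    `|\int[mu2]_z (\1_(`]0, e1]%classic : set R) z.1 * \1_(`]e2, +oo[%classic : set R) z.2 *
       (G z * (dker M z.1 * dker N z.2)))| <= e.
Proof.
move=> e10 e20 iF1 ih e0.
pose F1 z := \1_(`]0, e1]%classic : set R) z.1 *
    \1_(`]e2, +oo[%classic : set R) z.2 * ((G z - h z.2) * z.1^-1).
have iH : mu2.-integrable setT (EFin \o (fun z => 2 * (F1 z * recip e2 z.2))).
  apply: RintegrableZ => //.
  exact: (integrable_mul_bounded iF1 (measurable_recip_snd e2) (fun z => recip_le z.2 e20)).
have ihr : mu.-integrable setT (EFin \o (fun t => h t * recip e2 t)).
  exact: (integrable_mul_bounded ih (measurable_recip e2) (fun t => recip_le t e20)).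
have N0 : \forall N \near +oo, 0 < N :> R by exact: nbhs_pinfty_gt.
have e2' : 0 < e / 2 by rewrite divr_gt0.
have e12 : 0 < e / 12 by rewrite divr_gt0.
apply: (filterS _ (filterI N0 (filterI (riemann_lebesgue2 iH e2') (riemann_lebesgue ihr e12)))).
move=> N [{}N0 [HN1 HN2]] M M0.
have {}HN1 := HN1 _ (measurable_sinM M) (fun s => abs_sin_le1 (M * s)).
pose A1 : set (measurableTypeR R) := `]0, e1]%classic.
have mA1 : measurable A1 by exact: measurable_itv.
have iK : mu.-integrable setT (EFin \o (fun s => \1_A1 s * dker M s)).
  apply: indic_integrable => //; exact: lip_integrable (lip_dker (ltW M0)).
have ihs : mu.-integrable setT (EFin \o (fun t => h t * recip e2 t * sin (N * t))).
  exact: (Rintegral_bounded_factor measurableT ihr (measurable_sinM N) (fun t => abs_sin_le1 (N * t))).1.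
have iHs : mu2.-integrable setT (EFin \o (fun z => 2 * (F1 z * recip e2 z.2) * (sin (M * z.1) * sin (N * z.2)))).
  apply: (Rintegral_bounded_factor measurableT iH _ _).1; last first.
    by move=> z; apply: abs_mul_le1; exact: abs_sin_le1.
  apply: measurable_funM.
    exact: (measurableT_comp (measurable_sinM M) measurable_fst).
  exact: (measurableT_comp (measurable_sinM N) measurable_snd).
have iT := integrable_tensor iK ihs.
rewrite (_ : \int[mu2]_z _ = \int[mu2]_z (2 * (F1 z * recip e2 z.2) * (sin (M * z.1) * sin (N * z.2))) +
  (\int[mu]_s (\1_A1 s * dker M s)) * \int[mu]_t (h t * recip e2 t * sin (N * t))); last first.
  rewrite -Rintegral_tensor// -[RHS]RintegralD//; apply: eq_Rintegral => z _.
  have := recip_dker z.2 (ltW e20) (ltW N0).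
  rewrite /F1 !indicE; case: (boolP (z.2 \in _)) => zB; last first.
    rewrite /recip indicE (negbTE zB) => _ /=; ring.
  rewrite mul1r => ->; case: (boolP (z.1 \in _)) => [/set_mem|]; last by move=> _ /=; ring.
  rewrite /= in_itv/= => /andP[s0 _]; rewrite (dker_sin (ltW M0)) ?gt_eqF//; ring.
apply: le_trans (ler_normD _ _) _; rewrite normrM -Rintegral_indic.
rewrite [e]splitr; apply: lerD; first exact: HN1.
rewrite (_ : e / 2 = 6 * (e / 12)); last by field.
by apply: ler_pM => //; exact: (dker_int_le M0 (ltW e10)).
Qed.

(** The integrand is almost everywhere a component of the quaternionic integrand
    of condition LC, hence bounded by its modulus; it is Borel, so that the
    finiteness of the iterated integral gives integrability on the plane. *)
Lemma LC_integrable (ft : R -> R -> quat R) G h a e1 e2 (n : 'I_4) : 0 < e1 -> 0 < e2 ->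
  mu2.-integrable setT (EFin \o G) -> mu.-integrable setT (EFin \o h) ->
  {ae mu2, forall z : R * R, qcomp n (ft z.1 z.2) = G z} ->
  {ae mu, forall t : R, qcomp n (ft a t) = h t} ->
  (\int[mu]_(t in `[e2, +oo[) \int[mu]_(s in `[0%R, e1])
          (qnorm (s^-1 *: (ft s t - ft a t)))%:E < +oo)%E ->
  mu2.-integrable setT (EFin \o (fun z => \1_(`]0, e1]%classic : set R) z.1 *
    \1_(`]e2, +oo[%classic : set R) z.2 * ((G z - h z.2) * z.1^-1))).
Proof.
move=> e10 e20 iG ih ftG fth LCoo.
have mG : measurable_fun setT G by have /measurable_int/measurable_EFinP := iG.
have mh : measurable_fun setT h by have /measurable_int/measurable_EFinP := ih.
pose A : set (measurableTypeR R) := `]0, e1]%classic.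
pose B : set (measurableTypeR R) := `]e2, +oo[%classic.
have mA : measurable A by exact: measurable_itv.
have mB : measurable B by exact: measurable_itv.
pose F (z : measurableTypeR R * measurableTypeR R) : R := \1_A z.1 * \1_B z.2 * ((G z - h z.2) * z.1^-1).
have mF : measurable_fun setT F.
  apply: measurable_funM.
    apply: measurable_funM.
      exact: (measurableT_comp (measurable_indic mA) measurable_fst).
    exact: (measurableT_comp (measurable_indic mB) measurable_snd).
  apply: measurable_funM.
    by apply: measurable_funB => //; exact: (measurableT_comp mh measurable_snd).
  exact: (measurableT_comp (@measurable_invr R) measurable_fst).
have mF' : measurable_fun setT (EFin \o F) by exact/measurable_EFinP.
apply/(integrable21ltyP mu mu mF') => /=.
apply: le_lt_trans LCoo; rewrite [leRHS]integral_mkcond.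
have qn0 (q : quat R) : (0 <= (qnorm q)%:E)%E by rewrite lee_fin sqrtr_ge0.
apply: ge0_le_integral_ae.
- by move=> t; exact: integral_ge0.
- by move=> t; apply: erestrict_ge0 => {}t _; exact: integral_ge0.
(* The outer variable of the LC integral is t, the second coordinate. *)
have fts := ae_xsection (ae_swap ftG).
apply: ae_imp (ae_and fts fth) => t [ftt htt].
rewrite patchE; case: ifPn => tB; last first.
  rewrite (eq_integral (fun=> 0%E)) ?integral0// => s _.
  rewrite /F [\1_B t]indicE (_ : t \in B = false) ?mulr0 ?mul0r ?normr0//.
  apply/negP => /set_mem tB'; move/negP: tB; apply; apply/mem_set.
  by move: tB'; rewrite /B/= !in_itv/= !andbT => /ltW.
rewrite [leRHS]integral_mkcond; apply: ge0_le_integral_ae => //.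
  by move=> s; apply: erestrict_ge0.
apply: ae_imp ftt => s /= ftst.
rewrite patchE /F [\1_A s]indicE; case: (boolP (s \in A)) => [/set_mem sA|_]; last first.
  by rewrite !mul0r normr0; case: ifP.
rewrite mem_set; last by move: sA; rewrite /A/= !in_itv/= => /andP[/ltW -> ->].
rewrite lee_fin mul1r; apply: le_trans (qcomp_le_qnorm n _).
rewrite qcompZ /qcomp !mxE -!/(qcomp n _) -ftst -htt normrM [leRHS]normrM /= [leRHS]mulrC [leLHS]mulrC normrM.
rewrite -[leRHS]mulr1 indicE; case: (_ \in _); rewrite ?normr1 ?normr0 ?mul0r ?mulr0 ?mul1r ?mulr1//.
Qed.

End far.

(** * The limit of the double Dirichlet integral *)

Section kernel_limit.
Context (R : realType).
Notation mu := (@lebesgue_measure R).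
Notation mu2 := (leb2 R).
Implicit Types (G : R * R -> R) (h : R -> R) (d e M N s t : R).

Lemma integrable_rect_dker G (A B : set (measurableTypeR R)) M N :
  measurable A -> measurable B -> 0 <= M -> 0 <= N ->
  mu2.-integrable setT (EFin \o G) ->
  mu2.-integrable setT (EFin \o (fun z => \1_A z.1 * \1_B z.2 *
    (G z * (dker M z.1 * dker N z.2)))).
Proof.
move=> mA mB M0 N0 iG.
have mk : measurable_fun setT (fun z : measurableTypeR R * measurableTypeR R =>
    \1_A z.1 * \1_B z.2 * (dker M z.1 * dker N z.2)).
  apply: measurable_funM; apply: measurable_funM.
  - exact: (measurableT_comp (measurable_indic mA) measurable_fst).
  - exact: (measurableT_comp (measurable_indic mB) measurable_snd).
  - exact: (measurableT_comp (lip_measurable (lip_dker M0)) measurable_fst).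
  - exact: (measurableT_comp (lip_measurable (lip_dker N0)) measurable_snd).
apply: eq_integrable (integrable_mul_bounded (C := 2 * M * (2 * N)) iG mk _) => //.
  by move=> z _ /=; congr EFin; ring.
move=> z; rewrite normrM -[leRHS]mul1r; apply: ler_pM => //.
  by rewrite !indicE -natrM normr_nat lern1; case: (_ \in _); case: (_ \in _).
by rewrite normrM; apply: ler_pM => //; exact: dker_le.
Qed.

(** The Borel function G may be replaced by phi in almost every section, after
    which the integral is the one of [corner_integral]. *)
Lemma near_near G (phi : R -> R -> R) e1 e2 C D L : 0 < e1 -> 0 < e2 ->
  mu2.-integrable setT (EFin \o G) ->
  {ae mu2, forall z : R * R, phi z.1 z.2 = G z} ->
  bv_curve e1 e2 C phi D ->
  phi p.1 p.2 @[p --> corner R] --> L -> forall e, 0 < e ->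
  \forall p \near pinfty2 R,
    `|\int[mu2]_z (\1_(`]0, e1]%classic : set R) z.1 * \1_(`]0, e2]%classic : set R) z.2 *
       (G z * (dker p.1 z.1 * dker p.2 z.2))) - pi ^+ 2 * L| <= e.
Proof.
move=> e10 e20 iG phiG phiP phiL e e0.
have M0 : \forall N \near +oo, 0 < N :> R by exact: nbhs_pinfty_gt.
apply: (filterS _ (filterI (corner_integral e10 e20 phiP phiL e0)
  (filterI (pinfty2_fst M0) (pinfty2_snd M0)))) => -[M N] /= [H [{}M0 N0]].
rewrite (_ : \int[mu2]_z _ = \int[mu]_(s in `]0, e1])
  ((\int[mu]_(t in `]0, e2]) (phi s t * dker N t)) * dker M s)) //.
have mA : measurable (`]0, e1]%classic : set (measurableTypeR R)) by exact: measurable_itv.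
have mB : measurable (`]0, e2]%classic : set (measurableTypeR R)) by exact: measurable_itv.
rewrite (Rintegral_rect1 (integrable_rect_dker mA mB (ltW M0) (ltW N0) iG)).
transitivity (\int[mu]_(s in `]0, e1]) \int[mu]_(t in `]0, e2]) (phi s t * (dker M s * dker N t))).
  apply: ae_Rintegral_eq; apply: ae_imp (ae_xsection phiG) => s phis.
  by apply: ae_Rintegral_eq; apply: ae_imp phis => t /= ->.
have [h1 _ _] := phiP.
apply: eq_Rintegral => s; rewrite inE/= in_itv/= => /andP[s0 s1].
have [r rP] := h1 s s0 s1.
rewrite mulrC -RintegralZl//; last exact: NV_integrable rP (lip_dker (ltW N0)).
by apply: eq_Rintegral => t _; ring.
Qed.

Lemma sign_dker c M (b : bool) s : dker M (refl_shift c b s - c) = dker M s.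
Proof.
rewrite /refl_shift addrC addKr; case: b; rewrite ?expr0 ?mul1r// expr1 mulN1r.
exact: dkerN.
Qed.

Lemma indic_gt0_split (e s : R) : 0 < e -> \1_(`]0, +oo[%classic : set R) s =
  \1_(`]0, e]%classic : set R) s + \1_(`]e, +oo[%classic : set R) s :> R.
Proof.
move=> e0; rewrite indic_gt0 !indicE.
have -> : (s \in (`]0, e]%classic : set R)) = (0 < s) && (s <= e).
  by apply/idP/idP => [/set_mem|h]; rewrite ?inE/= in_itv.
have -> : (s \in (`]e, +oo[%classic : set R)) = (e < s).
  by apply/idP/idP => [/set_mem|h]; rewrite ?inE/= in_itv/= andbT.
case: (leP s e) => h; first by rewrite andbT addr0.
by rewrite (lt_trans e0 h) add0r.
Qed.

Lemma sum_far_le (I : finType) (near Lb : I -> R) (i1 i2 i3 e : R) :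
  (forall b, `|near b - pi ^+ 2 * Lb b| <= e / 2 / #|I|%:R) -> 0 < e ->
  `|i1| <= e / 6 -> `|i2| <= e / 6 -> `|i3| <= e / 6 ->
  `|\sum_b near b + i1 + i2 + i3 - pi ^+ 2 * \sum_b Lb b| <= e.
Proof.
move=> H e0 h1 h2 h3.
have S : `|\sum_b near b - pi ^+ 2 * \sum_b Lb b| <= e / 2.
  rewrite mulr_sumr -sumrB; apply: le_trans (ler_norm_sum _ _ _) _.
  apply: le_trans (ler_sum _ (fun b _ => H b)) _.
  rewrite sumr_const (_ : #|_| = #|I|); last exact: eq_card.
  rewrite -[leLHS]mulr_natr; have [->|I0] := eqVneq #|I| 0%N.
    by rewrite mulr0; apply: divr_ge0 => //; exact: ltW.
  by rewrite divfK// pnatr_eq0.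
move: S h1 h2 h3; rewrite !ler_norml => /andP[? ?] /andP[? ?] /andP[? ?] /andP[? ?].
by apply/andP; split; lra.
Qed.

Section limit.
Variables (F G : R * R -> R) (x0 y0 e1 e2 : R) (h1 h2 : R -> R).
Variables (L : bool * bool -> R) (C : bool * bool -> R) (D : bool * bool -> R -> R -> R).
Hypotheses (e10 : 0 < e1) (e20 : 0 < e2).
Hypothesis iG : mu2.-integrable setT (EFin \o G).
Hypothesis FG : {ae mu2, forall z, F z = G z}.
Let corner_of (b : bool * bool) s t := F (refl_shift2 x0 y0 b.1 b.2 (s, t)).
Hypothesis bvF : forall b, bv_curve e1 e2 (C b) (corner_of b) (D b).
Hypothesis limF : forall b, corner_of b p.1 p.2 @[p --> corner R] --> L b.
Let Gsym z := \sum_(b : bool * bool) G (refl_shift2 x0 y0 b.1 b.2 z).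
Hypotheses (ih1 : mu.-integrable setT (EFin \o h1)) (ih2 : mu.-integrable setT (EFin \o h2)).
Hypothesis far1 : mu2.-integrable setT (EFin \o (fun z => \1_(`]0, e1]%classic : set R) z.1 *
    \1_(`]e2, +oo[%classic : set R) z.2 * ((Gsym z - h1 z.2) * z.1^-1))).
Hypothesis far2 : mu2.-integrable setT (EFin \o (fun z => \1_(`]0, e2]%classic : set R) z.1 *
    \1_(`]e1, +oo[%classic : set R) z.2 * ((Gsym (z.2, z.1) - h2 z.2) * z.1^-1))).

Let iGb b : mu2.-integrable setT (EFin \o (fun z => G (refl_shift2 x0 y0 b.1 b.2 z))).
Proof. by have [] := Rintegral_refl_shift2 x0 y0 b.1 b.2 iG. Qed.

Let iGsym : mu2.-integrable setT (EFin \o Gsym).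
Proof. exact: (Rintegral_sum (index_enum _) measurableT iGb).1. Qed.

(** Fold, then cut the quadrant.  The strip with small t and large s is written
    with exchanged coordinates, so that [far_near] covers both strips. *)
Lemma kernel_split M N : 0 <= M -> 0 <= N ->
  \int[mu2]_z (G z * (dker M (z.1 - x0) * dker N (z.2 - y0))) =
  \sum_(b : bool * bool) \int[mu2]_z (\1_(`]0, e1]%classic : set R) z.1 *
    \1_(`]0, e2]%classic : set R) z.2 *
      (G (refl_shift2 x0 y0 b.1 b.2 z) * (dker M z.1 * dker N z.2))) +
  \int[mu2]_z (\1_(`]0, e1]%classic : set R) z.1 * \1_(`]e2, +oo[%classic : set R) z.2 *
      (Gsym z * (dker M z.1 * dker N z.2))) +
  \int[mu2]_z (\1_(`]0, e2]%classic : set R) z.1 * \1_(`]e1, +oo[%classic : set R) z.2 *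
      (Gsym (z.2, z.1) * (dker N z.1 * dker M z.2))) +
  \int[mu2]_z (\1_(`]e1, +oo[%classic : set R) z.1 * \1_(`]e2, +oo[%classic : set R) z.2 *
      (Gsym z * (dker M z.1 * dker N z.2))).
Proof.
move=> M0 N0.
have mk : measurable_fun setT (fun z : measurableTypeR R * measurableTypeR R =>
    dker M (z.1 - x0) * dker N (z.2 - y0)).
  apply: measurable_funM.
    apply: (measurableT_comp (lip_measurable (lip_dker M0))).
    by apply: measurable_funB => //; exact: measurable_fst.
  apply: (measurableT_comp (lip_measurable (lip_dker N0))).
  by apply: measurable_funB => //; exact: measurable_snd.
have iK : mu2.-integrable setT (EFin \o (fun z => G z * (dker M (z.1 - x0) * dker N (z.2 - y0)))).
  apply: (integrable_mul_bounded (C := 2 * M * (2 * N)) iG mk) => z.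
  by rewrite normrM; apply: ler_pM => //; exact: dker_le.
have mitv (i : interval R) : measurable ([set` i] : set (measurableTypeR R)) by exact: measurable_itv.
have iR A B := @integrable_rect_dker _ A B M N.
have [iQ ->] := fold_quadrants x0 y0 iK.
have E b z : G (refl_shift2 x0 y0 b.1 b.2 z) *
   (dker M ((refl_shift2 x0 y0 b.1 b.2 z).1 - x0) * dker N ((refl_shift2 x0 y0 b.1 b.2 z).2 - y0)) =
   G (refl_shift2 x0 y0 b.1 b.2 z) * (dker M z.1 * dker N z.2).
  by rewrite /refl_shift2/= !sign_dker.
have iN b := iR _ _ _ (mitv `]0, e1]) (mitv `]0, e2]) M0 N0 (iGb b).
have iFN := iR _ _ _ (mitv `]0, e1]) (mitv `]e2, +oo[) M0 N0 iGsym.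
have iNF := iR _ _ _ (mitv `]e1, +oo[) (mitv `]0, e2]) M0 N0 iGsym.
have iFF := iR _ _ _ (mitv `]e1, +oo[) (mitv `]e2, +oo[) M0 N0 iGsym.
have [iNs NsE] := Rintegral_sum (index_enum _) measurableT iN.
rewrite -[X in _ = X + _ + _ + _]NsE.
have -> : \int[mu2]_z (\1_(`]0, e2]%classic : set R) z.1 * \1_(`]e1, +oo[%classic : set R) z.2 *
      (Gsym (z.2, z.1) * (dker N z.1 * dker M z.2))) =
  \int[mu2]_z (\1_(`]e1, +oo[%classic : set R) z.1 * \1_(`]0, e2]%classic : set R) z.2 *
      (Gsym z * (dker M z.1 * dker N z.2))).
  have [_ <-] := integral_swap iNF; apply: eq_Rintegral => z _ /=.
  ring.
rewrite -!RintegralD//; last first.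
- exact: RintegrableD.
- exact: (RintegrableD _ (RintegrableD _ iNs iFN)).
transitivity (\int[mu2]_z \sum_(b : bool * bool) (\1_(`]0, +oo[%classic : set R) z.1 * \1_(`]0, +oo[%classic : set R) z.2 *
  (G (refl_shift2 x0 y0 b.1 b.2 z) * (dker M ((refl_shift2 x0 y0 b.1 b.2 z).1 - x0) * dker N ((refl_shift2 x0 y0 b.1 b.2 z).2 - y0))))).
  by rewrite [RHS](Rintegral_sum (index_enum _) measurableT iQ).2.
apply: eq_Rintegral => z _.
rewrite -mulr_sumr (indic_gt0_split _ e10) (indic_gt0_split _ e20).
under eq_bigr do rewrite E.
rewrite -!mulr_sumr /Gsym -!mulr_suml; ring.
Qed.

Lemma kernel_limit e : 0 < e -> \forall p \near pinfty2 R,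
  `|\int[mu2]_z (G z * (dker p.1 (z.1 - x0) * dker p.2 (z.2 - y0)))
    - pi ^+ 2 * \sum_b L b| <= e.
Proof.
move=> e0.
have M0 : \forall N \near +oo, 0 < N :> R by exact: nbhs_pinfty_gt.
have e6 : 0 < e / 6 by rewrite divr_gt0.
have e8 : 0 < e / 2 / #|{: bool * bool}|%:R by rewrite card_prod card_bool !divr_gt0.
have HN b := near_near (phi := corner_of b) e10 e20 (iGb b) (ae_refl_shift2 x0 y0 b.1 b.2 FG) (bvF b) (@limF b) e8.
have HN' : \forall p \near pinfty2 R, forall b, `|\int[mu2]_z (\1_(`]0, e1]%classic : set R) z.1 *
    \1_(`]0, e2]%classic : set R) z.2 *
      (G (refl_shift2 x0 y0 b.1 b.2 z) * (dker p.1 z.1 * dker p.2 z.2))) - pi ^+ 2 * L b| <=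
   e / 2 / #|{: bool * bool}|%:R.
  apply: (filterS _ (filterI (filterI (HN (true, true)) (HN (true, false)))
    (filterI (HN (false, true)) (HN (false, false))))).
  by move=> p [[? ?] [? ?]] [[] []].
have X1 := pinfty2_snd (far_near e10 e20 far1 ih1 e6).
have X2 := pinfty2_fst (far_near e20 e10 far2 ih2 e6).
have X3 := pinfty2_snd (far_far e10 e20 iGsym e6).
apply: (filterS _ (filterI (filterI HN' (filterI X1 (filterI X2 X3)))
  (filterI (pinfty2_fst M0) (pinfty2_snd M0)))) => -[M N] /= [[Hn [Y1 [Y2 Y3]]] [{}M0 N0]].
rewrite (kernel_split (ltW M0) (ltW N0)).
exact: (sum_far_le Hn e0 (Y1 M M0) (Y2 N N0) (Y3 M M0)).
Qed.

End limit.
End kernel_limit.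

(** * Inversion *)

Section quaternion_limits.
Context (R : realType).

(** The topology of quaternions is that of the four coordinates. *)
Lemma qcvg (T : Type) (F : set_system T) (FF : Filter F) (q : T -> quat R) (l : quat R) :
  (forall n, qcomp n (q p) @[p --> F] --> qcomp n l) -> q p @[p --> F] --> l.
Proof.
move=> ql; apply/cvg_ballP => e e0.
have H : \forall p \near F, forall n : 'I_4, ball (qcomp n l) e (qcomp n (q p)).
  apply: filter_forall => n; have /cvg_ballP := ql n; exact.
by apply: filterS H => p Hp; split=> // i j; rewrite (ord1 i); exact: Hp.
Qed.

Lemma qcomp_cvg (T : Type) (F : set_system T) (FF : Filter F) (q : T -> quat R) (l : quat R) n :
  q p @[p --> F] --> l -> qcomp n (q p) @[p --> F] --> qcomp n l.
Proof.
move=> ql; apply/cvg_ballP => e e0.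
by have /cvg_ballP/(_ e e0) := ql; apply: filterS => p [_ /(_ ord0 n)].
Qed.

Lemma sum_bool2 (V : zmodType) (F : bool * bool -> V) :
  \sum_(b : bool * bool) F b =
  F (false, false) + F (false, true) + F (true, false) + F (true, true).
Proof.
rewrite (eq_bigr (fun b => F (b.1, b.2))); last by case.
rewrite -(pair_bigA _ (fun b1 b2 => F (b1, b2)))/= !big_bool/=.
by rewrite addrC [F (false, true) + _]addrC [F (true, true) + _]addrC -!addrA.
Qed.

Lemma refl_shift_cvg c b : refl_shift c b s @[s --> (0 : R)^'+] --> (c : R).
Proof.
rewrite -[X in _ --> X]addr0 -[X in _ --> _ + X](mulr0 ((-1) ^+ b)).
apply: cvgD; first exact: cvg_cst.
by apply: cvgM; [exact: cvg_cst|apply: cvg_within_filter; exact: cvg_id].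
Qed.

Lemma corner_continuous (V : topologicalType) (f : R * R -> V) x0 y0 b1 b2 :
  {for (x0, y0), continuous f} ->
  f (refl_shift2 x0 y0 b1 b2 p) @[p --> corner R] --> f (x0, y0).
Proof.
move=> cf; suff H : refl_shift2 x0 y0 b1 b2 p @[p --> corner R] --> (x0, y0).
  exact: (cvg_comp _ _ H cf).
apply: (@cvg_pair _ _ _ (corner R) (nbhs x0) (nbhs y0)).
  by apply: (cvg_comp _ _ cvg_fst); exact: refl_shift_cvg.
by apply: (cvg_comp _ _ cvg_snd); exact: refl_shift_cvg.
Qed.

Lemma ltr_center (c e : R) : 0 < e -> c - e < c + e.
Proof. by move=> e0; lra. Qed.

Lemma refl_shift_itv (c e : R) (b : bool) s : 0 < s -> s <= e ->
  c - e <= refl_shift c b s /\ refl_shift c b s <= c + e.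
Proof. by move=> s0 se; rewrite /refl_shift; case: b; rewrite ?expr0 ?expr1; split; lra. Qed.

End quaternion_limits.

Section inversion.
Context (R : realType).
Notation mu := (@lebesgue_measure R).
Notation mu2 := (leb2 R).
Variables (f : R * R -> quat R) (x0 y0 e1 e2 : R).
Hypothesis hf : qL1 mu2 f.
Hypotheses (he1 : 0 < e1) (he2 : 0 < e2).
Hypothesis hBV : QBVF_in (cross_nbhd x0 y0 e1 e2) f.
Hypothesis hLC : LC x0 y0 e1 e2 f.

Let fb (b : bool * bool) (p : R * R) := f (refl_shift2 x0 y0 b.1 b.2 p).
Let fbn (b : bool * bool) n s t := qcomp n (fb b (s, t)).

Lemma symmE s t : symm f x0 y0 s t = \sum_(b : bool * bool) fb b (s, t).
Proof.
rewrite sum_bool2 /symm /fb /refl_shift2 /refl_shift /= !expr0 !expr1 !mul1r !mulN1r.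
by rewrite [RHS]addrC !addrA [RHS]addrAC.
Qed.

Lemma corner_bv_curve n : exists (C : R) (D : bool * bool -> R -> R -> R),
  forall b, bv_curve e1 e2 C (fbn b n) (D b).
Proof.
have box : `[x0 - e1, x0 + e1] `*` `[y0 - e2, y0 + e2] `<=` cross_nbhd x0 y0 e1 e2.
  move=> [s t] [/= + _]; rewrite in_itv/= => /andP[h1 h2]; left.
  by rewrite /= ler_distl h1 h2.
have l1 : x0 - e1 < x0 + e1 by exact: ltr_center.
have l2 : y0 - e2 < y0 + e2 by exact: ltr_center.
have H : BVF (x0 - e1) (x0 + e1) (y0 - e2) (y0 + e2) (fun z => qcomp n (f z)).
  exact: (hBV l1 l2 box).
have [C [D0 HD]] := BVF_bv_curve l2 H.
exists C, (fun b s s' => D0 (refl_shift x0 b.1 s) (refl_shift x0 b.1 s')) => b.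
by apply: HD => s; exact: refl_shift_itv.
Qed.

Lemma corner_cvgP b : cvg (fb b @ corner R).
Proof.
have H n : exists l, fbn b n p.1 p.2 @[p --> corner R] --> (l : R).
  have [C [D HD]] := corner_bv_curve n.
  have c := corner_cvg he1 he2 (HD b).
  by exists (lim (fbn b n p.1 p.2 @[p --> corner R])).
have [l lP] := choice H.
apply/cvg_ex; exists (\row_n l n); apply: qcvg => n.
rewrite /qcomp mxE; move: (lP n); rewrite /fbn (_ : (fun p => _) = fun p => qcomp n (fb b p))//.
Qed.

Let L b : quat R := lim (fb b @ corner R).

Lemma corner_functions : [/\ fb (false, false) = fpp f x0 y0,
  fb (false, true) = fpm f x0 y0, fb (true, false) = fmp f x0 y0 &
  fb (true, true) = fmm f x0 y0].
Proof.
split; apply/funext => p; rewrite /fb /refl_shift2 /refl_shift/= ?expr0 ?expr1 ?mul1r ?mulN1r.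
all: reflexivity.
Qed.

Lemma etaE : eta f x0 y0 = 4%:R^-1 *: \sum_b L b.
Proof.
have [c1 c2 c3 c4] := corner_functions.
by rewrite sum_bool2 /L c1 c2 c3 c4.
Qed.

Lemma corner_limits : corner_limits_exist f x0 y0.
Proof.
have [c1 c2 c3 c4] := corner_functions.
by split; rewrite -?c1 -?c2 -?c3 -?c4; exact: corner_cvgP.
Qed.

Lemma continuous_eta : {for (x0, y0), continuous f} -> f (x0, y0) = eta f x0 y0.
Proof.
move=> cf; rewrite etaE (eq_bigr (fun=> f (x0, y0))); last first.
  by move=> b _; apply/cvg_lim; [exact: norm_hausdorff|exact: corner_continuous].
rewrite (_ : \sum_b _ = 4%:R *: f (x0, y0)); first by rewrite scalerA mulVf ?scale1r// pnatr_eq0.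
by rewrite scaler_nat sum_bool2 !mulrS mulr0n addr0 !addrA.
Qed.

(** [kernel_limit] for one component.  The functions h1 and h2 are Borel
    representatives of the sections of the symmetrised f at the points a and b
    of condition LC; the symmetrised f agrees almost everywhere with the sum of
    the four reflections of the representative g. *)
Lemma kernel_cvg g n : qintegrable mu2 g -> {ae mu2, forall z, f z = g z} -> forall e : R, 0 < e ->
  \forall p \near pinfty2 R,
  `|\int[mu2]_z (qcomp n (g z) * (dker p.1 (z.1 - x0) * dker p.2 (z.2 - y0)))
    - pi ^+ 2 * \sum_b qcomp n (L b)| <= e.
Proof.
move=> ig fg e e0.
have [C [D HD]] := corner_bv_curve n.
have [a [b [fa fb' LCa LCb]]] := hLC.
have [ha iha fha] := qL1_representative fa.
have [hb ihb fhb] := qL1_representative fb'.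
have fgn : {ae mu2, forall z, qcomp n (f z) = qcomp n (g z)} by apply: ae_imp fg => z ->.
pose Gs z := \sum_(b : bool * bool) qcomp n (g (refl_shift2 x0 y0 b.1 b.2 z)).
have iGs : mu2.-integrable setT (EFin \o Gs).
  apply: (Rintegral_sum (index_enum _) measurableT _).1 => c.
  by have [] := Rintegral_refl_shift2 x0 y0 c.1 c.2 (ig n).
have fGs : {ae mu2, forall z : R * R, qcomp n (symm f x0 y0 z.1 z.2) = Gs z}.
  have H c := ae_refl_shift2 x0 y0 c.1 c.2 fgn.
  apply: ae_imp (ae_and (ae_and (H (true, true)) (H (true, false)))
    (ae_and (H (false, true)) (H (false, false)))) => z [[h1 h2] [h3 h4]].
  rewrite symmE qcomp_sum /Gs !sum_bool2 /fb.
  by congr (_ + _ + _ + _).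
have [iGs' _] := integral_swap iGs.
have fGs' : {ae mu2, forall z : R * R, qcomp n (symm f x0 y0 z.2 z.1) = Gs (z.2, z.1)}.
  exact: ae_swap fGs.
have fha' : {ae mu, forall t, qcomp n (symm f x0 y0 a t) = qcomp n (ha t)} by apply: ae_imp fha => t ->.
have fhb' : {ae mu, forall s, qcomp n (symm f x0 y0 s b) = qcomp n (hb s)} by apply: ae_imp fhb => t ->.
have far1 := LC_integrable he1 he2 iGs (iha n) fGs fha' LCa.
have far2 := LC_integrable (ft := fun t s => symm f x0 y0 s t) he2 he1 iGs' (ihb n) fGs' fhb' LCb.
apply: (kernel_limit he1 he2 (ig n) fgn HD _ (iha n) (ihb n) far1 far2 e0) => c.
rewrite (_ : (fun p => _) = fun p => qcomp n (fb c p)); last by apply/funext => -[].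
exact: (qcomp_cvg _ (corner_cvgP (b := c))).
Qed.

(** The common end of (a) and (b): both partial integrals are the same double
    Dirichlet integral. *)
Lemma inversion_cvg (Q : R -> R -> quat R) :
  (forall g, qintegrable mu2 g -> {ae mu2, forall z, f z = g z} ->
   forall n M N, 0 <= M -> 0 <= N -> qcomp n (Q M N) =
   \int[mu2]_z (qcomp n (g z) * (dker M (z.1 - x0) * dker N (z.2 - y0)))) ->
  (4%:R * pi ^+ 2)^-1 *: Q p.1 p.2 @[p --> pinfty2 R] --> eta f x0 y0.
Proof.
move=> HQ; have [g ig fg] := qL1_representative hf.
apply: qcvg => n; apply/cvgrPdist_le => e e0.
have c0 : 0 < 4 * pi ^+ 2 :> R by rewrite mulr_gt0// exprn_gt0// pi_gt0.
have c1 : 0 < e * (4 * pi ^+ 2) by exact: mulr_gt0.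
have M0 : \forall N \near +oo, 0 <= N :> R by exact: nbhs_pinfty_ge.
apply: (filterS _ (filterI (kernel_cvg n ig fg c1)
  (filterI (pinfty2_fst M0) (pinfty2_snd M0)))) => -[M N] /= [H [{}M0 N0]].
rewrite etaE !qcompZ (HQ g)// qcomp_sum distrC.
have -> : 4^-1 * (\sum_b qcomp n (L b)) = (4 * pi ^+ 2)^-1 * (pi ^+ 2 * \sum_b qcomp n (L b)).
  by rewrite invfM -mulrA mulKf// expf_neq0// gt_eqF// pi_gt0.
by rewrite -mulrBr normrM gtr0_norm ?invr_gt0// mulrC ler_pdivrMr.
Qed.

End inversion.

Theorem theorem3p3 (R : realType) (f : R * R -> quat R) (x0 y0 e1 e2 : R)
  (hf : qL1 (leb2 R) f)
  (he1 : 0 < e1) (he2 : 0 < e2)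
  (hBV : QBVF_in (cross_nbhd x0 y0 e1 e2) f)
  (hLC : LC x0 y0 e1 e2 f) :
  [/\ corner_limits_exist f x0 y0,
      (4%:R * pi ^+ 2)^-1 *:
        qint_box p.1 p.2
          (fun u v => QFT_right f u v * expj (v * y0) * expi (u * x0))
        @[p --> pinfty2 R] --> eta f x0 y0,
      (4%:R * pi ^+ 2)^-1 *:
        qint_box p.1 p.2
          (fun u v => expj (v * y0) * expi (u * x0) * QFT_left f u v)
        @[p --> pinfty2 R] --> eta f x0 y0 &
      {for (x0, y0), continuous f} -> f (x0, y0) = eta f x0 y0].
Proof.
split.
- exact: corner_limits hBV.
- apply: (inversion_cvg hf he1 he2 hBV hLC (Q := fun M N => qint_box M N
    (fun u v => QFT_right f u v * expj (v * y0) * expi (u * x0)))) => g ig fg n M N M0 N0.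
  exact: inversion_kernel_right.
- apply: (inversion_cvg hf he1 he2 hBV hLC (Q := fun M N => qint_box M N
    (fun u v => expj (v * y0) * expi (u * x0) * QFT_left f u v))) => g ig fg n M N M0 N0.
  exact: inversion_kernel_left.
- exact: continuous_eta.
Qed.
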